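(* The half-liberated versions $O_n^*$ and $H_n^*$ of $O_n$ and $H_n$ are easy quantum groups, and the corresponding categories of partitions are as follows: (1) for $O_n^*$: $E_o$, the pairings with each string connecting an odd number to an even number; (2) for $H_n^*$: $E_h$, the partitions with each block having the same number of odd and even legs.
   Context: A compact quantum group $G\subset O_n^+$ is given by a Woronowicz Hopf $C^*$-algebra $C(G)$ generated by the entries of a matrix $u=(u_{ij})_{1\le i,j\le n}$ with $u_{ij}=u_{ij}^*$ and $uu^t=u^tu=1$, with $\Delta(u_{ij})=\sum_k u_{ik}\otimes u_{kj}$, $\varepsilon(u_{ij})=\delta_{ij}$, $S(u_{ij})=u_{ji}$ (quantum groups with the same Hopf $*$-algebra generated by the $u_{ij}$ are identified). An inclusion $G\subset H$ means that there is a surjection $C(H)\to C(G)$ (at the level of the $*$-algebras generated by coordinates) mapping standard coordinates to standard coordinates. $Hom(u^{\otimes k},u^{\otimes l})$ is the space of linear maps $T:(\mathbb C^n)^{\otimes k}\to(\mathbb C^n)^{\otimes l}$ with $Tu^{\otimes k}=u^{\otimes l}T$. $P(k,l)$ is the set of partitions of $k$ upper points and $l$ lower points. For $p\in P(k,l)$, $T_p(e_{i_1}\otimes\cdots\otimes e_{i_k})=\sum_{j_1\ldots j_l}\delta_p\binom{i_1\ldots i_k}{j_1\ldots j_l}e_{j_1}\otimes\cdots\otimes e_{j_l}$, where $\delta_p=1$ if all blocks of $p$ contain equal indices and $\delta_p=0$ otherwise. A compact quantum group $S_n\subset G\subset O_n^+$ is called easy if there are sets $D(k,l)\subset P(k,l)$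 with $Hom(u^{\otimes k},u^{\otimes l})=span(T_p\mid p\in D(k,l))$ for all $k,l$; the collection $(D(k,l))$, which is a category of partitions (closed under horizontal and vertical concatenation and upside-down turning, containing the identity $|$ and the semicircle), is the corresponding category. $C(O_n^+)$ is the universal algebra with $u_{ij}=u_{ij}^*$, $u^t=u^{-1}$. $C(H_n^+)$ is its quotient by the cubic relations $u_{ij}u_{ik}=u_{ji}u_{ki}=0$ for $j\ne k$. For $G=O_n,H_n$, the half-liberated version $G^*$ is defined by $C(G^* )=C(G^+)/I$, where $I$ is the ideal generated by the half-commutation relations $abc=cba$, for $a,b,c\in\{u_{ij}\}$. The legs of each partition are labeled $1,2,3,\ldots$ clockwise starting from top left; odd/even refers to this labeling. A pairing is a partition with all blocks of size 2 (its blocks are called strings). *)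

(* Defs.v *)
From HB Require Import structures.
From mathcomp Require Import all_boot all_order perm all_algebra.
From mathcomp Require Import boolp reals complex.

Set Implicit Arguments.
Unset Strict Implicit.
Unset Printing Implicit Defensive.

Import Order.TTheory GRing.Theory Num.Theory.
Local Open Scope ring_scope.
Local Open Scope quotient_scope.
Local Open Scope complex_scope.

HB.mixin Record hasStar (R : realType) A
    of GRing.Algebra R[i] A := {
  star : A -> A;
  starK : forall x, star (star x) = x;
  starD : forall x y, star (x + y) = star x + star y;
  starZ : forall (c : R[i]) x, star (c *: x) = c^* *: star x;
  starM : forall x y, star (x * y) = star y * star x
}.

#[short(type="starAlgType")]
HB.structure Definition StarAlgebra (R : realType) :=
  {A of hasStar R A & GRing.Algebra R[i] A}.

HB.mixin Record isCstar (R : realType) A of StarAlgebra R A := {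
  cnorm : A -> R;
  cnorm0_eq0 : forall x, cnorm x = 0 -> x = 0;
  cnormD : forall x y, cnorm (x + y) <= cnorm x + cnorm y;
  cnormZ : forall (c : R[i]) x, cnorm (c *: x) = Normc.normc c * cnorm x;
  cnormM : forall x y, cnorm (x * y) <= cnorm x * cnorm y;
  cnorm_star : forall x, cnorm (star x * x) = cnorm x ^+ 2;
  cnorm_complete : forall s : nat -> A,
    (forall e : R, 0 < e -> exists N, forall m n,
       (N <= m)%N -> (N <= n)%N -> cnorm (s m - s n) < e) ->
    exists l, forall e : R, 0 < e -> exists N, forall n,
       (N <= n)%N -> cnorm (s n - l) < e
}.

#[short(type="cstarAlgType")]
HB.structure Definition CstarAlgebra (R : realType) :=
  {A of isCstar R A & StarAlgebra R A}.

Definition star_preserving (R : realType) (A B : starAlgType R)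
  (f : A -> B) : Prop := forall x, f (star x) = star (f x).

Definition surjective (T U : Type) (f : T -> U) : Prop :=
  forall y, exists x, f x = y.

Section ComplexStar.
Variable R : realType.
Implicit Types x y c : R[i]^o.

Fact conjc_starK x : (x^*)^* = x. Proof. exact: conjcK. Qed.
Fact conjc_starD x y : (x + y)^* = x^* + y^*. Proof. exact: rmorphD. Qed.
Fact conjc_starZ (c : R[i]) x : (c *: x)^* = c^* *: x^* :> R[i]^o.
Proof. exact: rmorphM. Qed.
Fact conjc_starM x y : (x * y)^* = y^* * x^*.
Proof. by rewrite mulrC; exact: rmorphM. Qed.

HB.instance Definition _ := hasStar.Build R R[i]^o
  conjc_starK conjc_starD conjc_starZ conjc_starM.
End ComplexStar.

Section Coordinates.
Variables (R : realType) (A : starAlgType R) (n : nat) (u : 'M[A]_n).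

Inductive coord_generated : A -> Prop :=
| CoordGen i j : coord_generated (u i j)
| Coord1 : coord_generated 1
| CoordZ (c : R[i]) x : coord_generated x -> coord_generated (c *: x)
| CoordD x y : coord_generated x -> coord_generated y -> coord_generated (x + y)
| CoordM x y : coord_generated x -> coord_generated y -> coord_generated (x * y)
| CoordS x : coord_generated x -> coord_generated (star x).

Definition coord_pred : {pred A} := [pred x | `[< coord_generated x >]].

Record coord_alg := CoordAlg { coord_val : A; _ : coord_val \in coord_pred }.

HB.instance Definition _ := [isSub for coord_val].
HB.instance Definition _ := [Choice of coord_alg by <:].

Fact coord_closed : GRing.subsemialg_closed coord_pred.
Proof.
split; rewrite ?inE.
- by apply/asboolP; exact: Coord1.
- split; first by apply/asboolP; rewrite -(scale0r 1); exact/CoordZ/Coord1.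
  move=> x y /asboolP xP /asboolP yP; apply/asboolP; exact: CoordD.
- move=> c x /asboolP xP; apply/asboolP; exact: CoordZ.
- move=> x y /asboolP xP /asboolP yP; apply/asboolP; exact: CoordM.
Qed.

HB.instance Definition _ :=
  GRing.SubChoice_isSubAlgebra.Build R[i] A coord_pred coord_alg coord_closed.

Fact coord_star_subproof (x : coord_alg) : star (val x) \in coord_pred.
Proof. by apply/asboolP/CoordS/asboolP; exact: (valP x). Qed.

Definition coord_star (x : coord_alg) : coord_alg :=
  CoordAlg (coord_star_subproof x).

Fact coord_starK x : coord_star (coord_star x) = x.
Proof. by apply: val_inj; rewrite /= starK. Qed.
Fact coord_starD x y : coord_star (x + y) = coord_star x + coord_star y.
Proof. by apply: val_inj; rewrite /= starD. Qed.
Fact coord_starZ (c : R[i]) x : coord_star (c *: x) = c^* *: coord_star x.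
Proof. by apply: val_inj; rewrite /= starZ. Qed.
Fact coord_starM x y : coord_star (x * y) = coord_star y * coord_star x.
Proof. by apply: val_inj; rewrite /= starM. Qed.

HB.instance Definition _ := hasStar.Build R coord_alg
  coord_starK coord_starD coord_starZ coord_starM.

Fact coord_gen_subproof i j : u i j \in coord_pred.
Proof. by apply/asboolP; exact: CoordGen. Qed.

Definition coord i j : coord_alg := CoordAlg (coord_gen_subproof i j).

End Coordinates.

(* An element is represented by a list [:: (a_1, b_1); ..; (a_m, b_m)]
   standing for the sum of the a_i (x) b_i; two lists are identified when no
   bilinear form tells them apart (over a field, bilinear forms separate the
   points of the tensor product). *)
Section Tensor.
Variables (R : realType) (A B : starAlgType R).

Record bilinear_form := BilinearForm {
  bform :> A -> B -> R[i];
  bform_linearl : forall (c : R[i]) a a' b,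
    bform (c *: a + a') b = c * bform a b + bform a' b;
  bform_linearr : forall (c : R[i]) a b b',
    bform a (c *: b + b') = c * bform a b + bform a b'
}.

Definition tensor_eval (f : bilinear_form) (s : seq (A * B)) : R[i] :=
  \sum_(ab <- s) f ab.1 ab.2.

Definition tensor_rel : rel (seq (A * B)) :=
  fun s t => `[< forall f, tensor_eval f s = tensor_eval f t >].

Fact tensor_rel_equiv : equiv_class_of tensor_rel.
Proof.
split=> [s|s t|t s r].
- by apply/asboolP.
- by apply/asboolP/asboolP=> st f; rewrite st.
- by move=> /asboolP st /asboolP tr; apply/asboolP=> f; rewrite st.
Qed.

Canonical tensor_equiv := EquivRelPack tensor_rel_equiv.

Definition tensor : Type := {eq_quot tensor_rel}.
HB.instance Definition _ := Choice.on tensor.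
HB.instance Definition _ := EqQuotient.on tensor.

Implicit Types (s t : seq (A * B)) (x y z : tensor) (f : bilinear_form).

Definition teval f x : R[i] := tensor_eval f (repr x).

Lemma teval_pi f s : teval f (\pi_tensor s) = tensor_eval f s.
Proof. by rewrite /teval; case: piP => t /eqmodP /asboolP ->. Qed.

Lemma tensorP x y : (forall f, teval f x = teval f y) -> x = y.
Proof.
move=> xy; rewrite -[x]reprK -[y]reprK; apply/eqmodP/asboolP => f.
exact: xy.
Qed.

Definition pure a b : tensor := \pi_tensor [:: (a, b)].
Definition tensor0 : tensor := \pi_tensor [::].
Definition tensorD x y : tensor := \pi_tensor (repr x ++ repr y).
Definition tensorZ (c : R[i]) x : tensor :=
  \pi_tensor [seq (c *: ab.1, ab.2) | ab <- repr x].
Definition tensorN x : tensor := tensorZ (-1) x.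
Definition tensorM x y : tensor :=
  \pi_tensor [seq (ab.1 * cd.1, ab.2 * cd.2) | ab <- repr x, cd <- repr y].
Definition tensorS x : tensor := \pi_tensor [seq (star ab.1, star ab.2) | ab <- repr x].

Lemma bformZl f (c : R[i]) a b : f (c *: a) b = c * f a b.
Proof.
have f0 : f 0 b = 0.
  have := bform_linearl f 1 0 0 b; rewrite scaler0 addr0 mul1r => h.
  by apply: (@addrI _ (f 0 b)); rewrite addr0 -h.
by rewrite -[c *: a]addr0 bform_linearl f0 addr0.
Qed.
Lemma bformZr f (c : R[i]) a b : f a (c *: b) = c * f a b.
Proof.
have f0 : f a 0 = 0.
  have := bform_linearr f 1 a 0 0; rewrite scaler0 addr0 mul1r => h.
  by apply: (@addrI _ (f a 0)); rewrite addr0 -h.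
by rewrite -[c *: b]addr0 bform_linearr f0 addr0.
Qed.

Program Definition bform_mulr f c d : bilinear_form :=
  @BilinearForm (fun a b => f (a * c) (b * d)) _ _.
Next Obligation. by rewrite mulrDl -scalerAl bform_linearl. Qed.
Next Obligation. by rewrite mulrDl -scalerAl bform_linearr. Qed.
Program Definition bform_mull f c d : bilinear_form :=
  @BilinearForm (fun a b => f (c * a) (d * b)) _ _.
Next Obligation. by rewrite mulrDr -scalerAr bform_linearl. Qed.
Next Obligation. by rewrite mulrDr -scalerAr bform_linearr. Qed.
Program Definition bform_star f : bilinear_form :=
  @BilinearForm (fun a b => (f (star a) (star b))^*) _ _.
Next Obligation.
by rewrite starD starZ bform_linearl rmorphD rmorphM /= conjcK.
Qed.
Next Obligation.
by rewrite starD starZ bform_linearr rmorphD rmorphM /= conjcK.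
Qed.

Lemma teval_pure f a b : teval f (pure a b) = f a b.
Proof. by rewrite teval_pi /tensor_eval big_seq1. Qed.
Lemma teval0 f : teval f tensor0 = 0.
Proof. by rewrite teval_pi /tensor_eval big_nil. Qed.
Lemma tevalD f x y : teval f (tensorD x y) = teval f x + teval f y.
Proof. by rewrite teval_pi /tensor_eval big_cat. Qed.
Lemma tevalZ f c x : teval f (tensorZ c x) = c * teval f x.
Proof.
rewrite teval_pi /tensor_eval big_map mulr_sumr.
by apply: eq_bigr => ab _; rewrite bformZl.
Qed.
Lemma tevalN f x : teval f (tensorN x) = - teval f x.
Proof. by rewrite tevalZ mulN1r. Qed.
Lemma tevalM f x y : teval f (tensorM x y) =
  \sum_(ab <- repr x) \sum_(cd <- repr y) f (ab.1 * cd.1) (ab.2 * cd.2).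
Proof. by rewrite teval_pi /tensor_eval big_allpairs_dep. Qed.
Lemma tevalMl f x y : teval f (tensorM x y) =
  \sum_(ab <- repr x) teval (bform_mull f ab.1 ab.2) y.
Proof. by rewrite tevalM. Qed.
Lemma tevalMr f x y : teval f (tensorM x y) =
  \sum_(cd <- repr y) teval (bform_mulr f cd.1 cd.2) x.
Proof. by rewrite tevalM exchange_big. Qed.
Lemma tevalS f x : teval f (tensorS x) = (teval (bform_star f) x)^*.
Proof.
rewrite teval_pi /tensor_eval big_map [RHS]rmorph_sum.
by apply: eq_bigr => ab _ /=; rewrite conjcK.
Qed.

Fact tensorDA : associative tensorD.
Proof. by move=> x y z; apply: tensorP => f; rewrite !tevalD addrA. Qed.
Fact tensorDC : commutative tensorD.
Proof. by move=> x y; apply: tensorP => f; rewrite !tevalD addrC. Qed.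
Fact tensor0D : left_id tensor0 tensorD.
Proof. by move=> x; apply: tensorP => f; rewrite tevalD teval0 add0r. Qed.
Fact tensorND : left_inverse tensor0 tensorN tensorD.
Proof. by move=> x; apply: tensorP => f; rewrite tevalD tevalN teval0 addNr. Qed.

HB.instance Definition _ := GRing.isZmodule.Build tensor
  tensorDA tensorDC tensor0D tensorND.

Fact tensorZA (a b : R[i]) x : tensorZ a (tensorZ b x) = tensorZ (a * b) x.
Proof. by apply: tensorP => f; rewrite !tevalZ mulrA. Qed.
Fact tensor1Z : left_id 1 tensorZ.
Proof. by move=> x; apply: tensorP => f; rewrite tevalZ mul1r. Qed.
Fact tensorZDr : right_distributive tensorZ +%R.
Proof. by move=> c x y; apply: tensorP => f; rewrite !(tevalZ, tevalD) mulrDr. Qed.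
Fact tensorZDl x : {morph tensorZ^~ x : a b / a + b}.
Proof. by move=> a b; apply: tensorP => f; rewrite !(tevalZ, tevalD) mulrDl. Qed.

HB.instance Definition _ := GRing.Zmodule_isLmodule.Build R[i] tensor
  tensorZA tensor1Z tensorZDr tensorZDl.

Fact tensorMA : associative tensorM.
Proof.
move=> x y z; apply: tensorP => f; rewrite tevalMl tevalMr.
under eq_bigr do rewrite tevalM; under [RHS]eq_bigr do rewrite tevalM.
rewrite [RHS]exchange_big; apply: eq_bigr => ab _ /=.
rewrite [RHS]exchange_big; apply: eq_bigr => cd _ /=.
by apply: eq_bigr => ef _; rewrite !mulrA.
Qed.
Fact tensor1M : left_id (pure 1 1) tensorM.
Proof.
move=> x; apply: tensorP => f; rewrite tevalMr /teval.
under eq_bigr do rewrite -/(teval _ _) teval_pure /= !mul1r.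
by [].
Qed.
Fact tensorM1 : right_id (pure 1 1) tensorM.
Proof.
move=> x; apply: tensorP => f; rewrite tevalMl /teval.
under eq_bigr do rewrite -/(teval _ _) teval_pure /= !mulr1.
by [].
Qed.
Fact tensorMDl : left_distributive tensorM tensorD.
Proof.
move=> x y z; apply: tensorP => f; rewrite tevalD !tevalMr -big_split /=.
by apply: eq_bigr => cd _; rewrite tevalD.
Qed.
Fact tensorMDr : right_distributive tensorM tensorD.
Proof.
move=> x y z; apply: tensorP => f; rewrite tevalD !tevalMl -big_split /=.
by apply: eq_bigr => cd _; rewrite tevalD.
Qed.

HB.instance Definition _ := GRing.Zmodule_isPzRing.Build tensor
  tensorMA tensor1M tensorM1 tensorMDl tensorMDr.

End Tensor.

Section QuantumGroups.
Variable R : realType.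

Definition orthogonal_coords (A : starAlgType R) n (u : 'M[A]_n) : Prop :=
  [/\ forall i j, star (u i j) = u i j,
      u *m u^T = 1%:M & u^T *m u = 1%:M].

(* The Hopf structure lives on the *-algebra generated by the coordinates, so
   the tensor product is the algebraic one: quantum groups with the same Hopf
   *-algebra are identified, whatever the C*-completion.
   Values on the u_ij determine Delta, epsilon and S, so that
   coassociativity and the counit and antipode axioms are automatic. *)
Definition has_Hopf_maps (A : starAlgType R) n (u : 'M[A]_n) : Prop :=
  [/\ exists Delta : {lrmorphism coord_alg u ->
                                 tensor (coord_alg u) (coord_alg u)},
        (forall x, Delta (star x) = tensorS (Delta x)) /\
        (forall i j, Delta (coord u i j) =
                     \sum_k pure (coord u i k) (coord u k j)),
      exists eps : {lrmorphism coord_alg u -> R[i]^o},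
        star_preserving eps /\ forall i j, eps (coord u i j) = (i == j)%:R &
      exists S : {linear coord_alg u -> coord_alg u},
        [/\ S 1 = 1, forall x y, S (x * y) = S y * S x &
            forall i j, S (coord u i j) = coord u j i]].

Definition compact_quantum_group (A : cstarAlgType R) n (u : 'M[A]_n) : Prop :=
  [/\ orthogonal_coords u,
      forall (x : A) (e : R), 0 < e ->
        exists y : coord_alg u, cnorm (x - val y) < e
    & has_Hopf_maps u].

(* qincluded u v : the quantum group with coordinates u is contained in the
   one with coordinates v. *)
Definition qincluded (A B : starAlgType R) n (u : 'M[A]_n) (v : 'M[B]_n) :
    Prop :=
  exists f : {lrmorphism coord_alg v -> coord_alg u},
    [/\ star_preserving f, surjective f &
        forall i j, f (coord v i j) = coord u i j].

End QuantumGroups.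

(* C(S_n), with u_ij the indicator function of the s such that s(j) = i. *)
Section SymmetricGroup.
Variables (R : realType) (n : nat).

Definition fun_Sn : Type := {ffun 'S_n -> R[i]^o}.
Implicit Types f g : fun_Sn.

HB.instance Definition _ := GRing.PzRing.on fun_Sn.

Fact fun_Sn_nonzero : (1 : fun_Sn) != 0.
Proof. by apply/eqP => /ffunP /(_ 1%g); rewrite !ffunE; apply/eqP/oner_neq0. Qed.

HB.instance Definition _ :=
  GRing.PzSemiRing_isNonZero.Build fun_Sn fun_Sn_nonzero.
HB.instance Definition _ := GRing.Lmodule.on fun_Sn.

Fact fun_Sn_scaleAl (c : R[i]) f g : c *: (f * g) = (c *: f) * g.
Proof. by apply/ffunP => s; rewrite !ffunE scalerAl. Qed.
HB.instance Definition _ :=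
  GRing.Lmodule_isLalgebra.Build R[i] fun_Sn fun_Sn_scaleAl.
Fact fun_Sn_scaleAr (c : R[i]) f g : c *: (f * g) = f * (c *: g).
Proof. by apply/ffunP => s; rewrite !ffunE scalerAr. Qed.
HB.instance Definition _ :=
  GRing.Lalgebra_isAlgebra.Build R[i] fun_Sn fun_Sn_scaleAr.

Definition fun_Sn_star f : fun_Sn := [ffun s => (f s)^*].

Fact fun_Sn_starK f : fun_Sn_star (fun_Sn_star f) = f.
Proof. by apply/ffunP => s; rewrite !ffunE conjcK. Qed.
Fact fun_Sn_starD f g : fun_Sn_star (f + g) = fun_Sn_star f + fun_Sn_star g.
Proof. by apply/ffunP => s; rewrite !ffunE rmorphD. Qed.
Fact fun_Sn_starZ (c : R[i]) f : fun_Sn_star (c *: f) = c^* *: fun_Sn_star f.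
Proof. by apply/ffunP => s; rewrite !ffunE rmorphM. Qed.
Fact fun_Sn_starM f g : fun_Sn_star (f * g) = fun_Sn_star g * fun_Sn_star f.
Proof. by apply/ffunP => s; rewrite !ffunE rmorphM mulrC. Qed.
HB.instance Definition _ := hasStar.Build R fun_Sn
  fun_Sn_starK fun_Sn_starD fun_Sn_starZ fun_Sn_starM.

Definition coords_Sn : 'M[fun_Sn]_n :=
  \matrix_(i, j) [ffun s : 'S_n => (i == s j)%:R].

End SymmetricGroup.

Section Quotients.
Variable R : realType.

(* (A, u) is the universal C*-algebra C(O_n^+); this determines it up to
   isomorphism. *)
Definition is_free_orthogonal (A : cstarAlgType R) n (u : 'M[A]_n) : Prop :=
  orthogonal_coords u /\
  forall (B : cstarAlgType R) (v : 'M[B]_n), orthogonal_coords v ->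
    exists2 f : {lrmorphism A -> B},
      star_preserving f /\ (forall i j, f (u i j) = v i j) &
      forall g : {lrmorphism A -> B}, star_preserving g ->
        (forall i j, g (u i j) = v i j) -> g =1 f.

(* A quotient of C*-algebras is by a norm-closed two-sided ideal; such an ideal
   is automatically stable under star. *)
Definition closed_ideal (A : cstarAlgType R) (I : A -> Prop) : Prop :=
  [/\ I 0, forall x y, I x -> I y -> I (x + y),
      forall a x, I x -> I (a * x) /\ I (x * a) &
      forall x, (forall e : R, 0 < e -> exists2 y, I y & cnorm (x - y) < e) ->
        I x].

Definition ideal_generated (A : cstarAlgType R) (X : A -> Prop) (x : A) : Prop :=
  forall I, closed_ideal I -> (forall y, X y -> I y) -> I x.

(* (B, v) is the quotient of (A, u) by the relations x = 0, for x in X. *)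
Definition is_quotient (A B : cstarAlgType R) n (u : 'M[A]_n) (v : 'M[B]_n)
    (X : A -> Prop) : Prop :=
  exists p : {lrmorphism A -> B},
    [/\ star_preserving p, surjective p, forall i j, p (u i j) = v i j &
        forall x, p x = 0 <-> ideal_generated X x].

Definition cubic_relators (A : cstarAlgType R) n (u : 'M[A]_n) (x : A) : Prop :=
  exists i j k, j != k /\ (x = u i j * u i k \/ x = u j i * u k i).

Definition is_entry (A : cstarAlgType R) n (u : 'M[A]_n) (a : A) : Prop :=
  exists i j, a = u i j.

Definition half_commutators (A : cstarAlgType R) n (u : 'M[A]_n) (x : A) :
    Prop :=
  exists a b c, [/\ is_entry u a, is_entry u b, is_entry u c &
                    x = a * b * c - c * b * a].

(* Here (A, u) is C(O_n^+) and (B, v) is C(H_n^+). *)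
Definition is_free_hyperoctahedral (A B : cstarAlgType R) n
    (u : 'M[A]_n) (v : 'M[B]_n) : Prop :=
  is_quotient u v (cubic_relators u).

(* Here (A, u) is C(G^+) and (B, v) is C(G^* ). *)
Definition is_half_liberated (A B : cstarAlgType R) n
    (u : 'M[A]_n) (v : 'M[B]_n) : Prop :=
  is_quotient u v (half_commutators u).

End Quotients.

(* [inl] for the k upper points, [inr] for the l lower points, both
   numbered from left to right. *)
Definition point (k l : nat) : finType := ('I_k + 'I_l)%type.
Notation diagram k l := {set {set point k l}}.

Definition partitions k l : {set diagram k l} :=
  [set p | partition p [set: point k l]].

Definition diagram_family := forall k l, {set diagram k l}.

Definition tensor_inl k l k' l' (x : point k l) : point (k + k') (l + l') :=
  match x with inl a => inl (lshift k' a) | inr b => inr (lshift l' b) end.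
Definition tensor_inr k l k' l' (x : point k' l') : point (k + k') (l + l') :=
  match x with inl a => inl (rshift k a) | inr b => inr (rshift l b) end.

Definition hconcat k l k' l' (p : diagram k l) (q : diagram k' l') :
    diagram (k + k') (l + l') :=
  [set (@tensor_inl k l k' l') @: B | B : {set point k l} in p] :|:
  [set (@tensor_inr k l k' l') @: B | B : {set point k' l'} in q].

Definition flip_point k l (x : point k l) : point l k :=
  match x with inl a => inr a | inr b => inl b end.

Definition upside_down k l (p : diagram k l) : diagram l k :=
  [set (@flip_point k l) @: B | B : {set point k l} in p].

(* Vertical concatenation, p above q: the l lower points of p are glued to the
   l upper points of q, and components made only of such middle points are
   dropped. *)
Definition stack_point (k l m : nat) : finType := ('I_k + 'I_l + 'I_m)%type.

Definition stack_top k l m (x : point k l) : stack_point k l m := inl x.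
Definition stack_bottom k l m (x : point l m) : stack_point k l m :=
  match x with inl a => inl (inr a) | inr b => inr b end.
Definition stack_outer k l m (x : point k m) : stack_point k l m :=
  match x with inl a => inl (inl a) | inr b => inr b end.

Definition stack_rel k l m (p : diagram k l) (q : diagram l m) :
    rel (stack_point k l m) := fun x y =>
  [exists B in p, (x \in (@stack_top k l m) @: B) &&
                  (y \in (@stack_top k l m) @: B)] ||
  [exists B in q, (x \in (@stack_bottom k l m) @: B) &&
                  (y \in (@stack_bottom k l m) @: B)].

Definition vconcat k l m (p : diagram k l) (q : diagram l m) : diagram k m :=
  equivalence_partition
    (fun x y => connect (stack_rel p q) (stack_outer l x) (stack_outer l y))
    [set: point k m].

Definition identity_diagram : diagram 1 1 := [set [set: point 1 1]].
Definition semicircle : diagram 0 2 := [set [set: point 0 2]].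

Definition category_of_partitions (D : diagram_family) : Prop :=
  [/\ forall k l, D k l \subset partitions k l,
      forall k l k' l' p q,
        p \in D k l -> q \in D k' l' -> hconcat p q \in D (k + k')%N (l + l')%N,
      forall k l m p q, p \in D k l -> q \in D l m -> vconcat p q \in D k m,
      forall k l p, p \in D k l -> upside_down p \in D l k &
      identity_diagram \in D 1%N 1%N /\ semicircle \in D 0%N 2%N].

(* Clockwise labels 1, 2, 3, .. starting from the top left, so that the lower
   row is labeled from right to left. *)
Definition label k l (x : point k l) : nat :=
  match x with inl a => a.+1 | inr b => (k + (l - b))%N end.

Definition E_o : diagram_family := fun k l =>
  [set p in partitions k l | [forall B in p, (#|B| == 2) &&
     [exists x in B, exists y in B, odd (label x) && ~~ odd (label y)]]].

Definition E_h : diagram_family := fun k l =>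
  [set p in partitions k l | [forall B in p,
     #|[set x in B | odd (label x)]| == #|[set x in B | ~~ odd (label x)]|]].

Section Easiness.
Variables (R : realType) (n : nat).

(* A basis vector of (C^n)^{(x) k} is indexed by i = (i_1, .., i_k), and a
   tensor is the function giving its coordinates. *)
Definition multi_index k : finType := {ffun 'I_k -> 'I_n}.
Notation tens k := {ffun multi_index k -> R[i]^o}.

Definition basis_tensor k (i : multi_index k) : tens k :=
  [ffun i' => (i' == i)%:R].

Definition index_at k l (i : multi_index k) (j : multi_index l)
    (x : point k l) : 'I_n :=
  match x with inl a => i a | inr b => j b end.

Definition delta k l (p : diagram k l) (i : multi_index k) (j : multi_index l) :
    bool :=
  [forall B in p, forall x in B, forall y in B,
     index_at i j x == index_at i j y].

Definition T_fun k l (p : diagram k l) (t : tens k) : tens l :=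
  \sum_i t i *: \sum_j (delta p i j)%:R *: basis_tensor j.

Fact T_fun_linear k l (p : diagram k l) : linear (T_fun p).
Proof.
move=> c s t; rewrite /T_fun scaler_sumr -big_split /=.
by apply: eq_bigr => i _; rewrite !ffunE scalerDl scalerA.
Qed.
HB.instance Definition _ k l (p : diagram k l) :=
  GRing.isLinear.Build R[i] (tens k) (tens l) *:%R (T_fun p) (T_fun_linear p).

Definition T_ k l (p : diagram k l) : 'Hom(tens k, tens l) := linfun (T_fun p).

Lemma T_basis k l (p : diagram k l) i :
  T_ p (basis_tensor i) = \sum_j (delta p i j)%:R *: basis_tensor j.
Proof.
rewrite lfunE /= /T_fun (bigD1 i) //= ffunE eqxx scale1r [X in _ + X]big1 ?addr0 // => j ji.
by rewrite ffunE (negPf ji) scale0r.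
Qed.

Section Hom.
Variables (A : starAlgType R) (u : 'M[A]_n).

Definition tensor_power k (i j : multi_index k) : A := \prod_(a < k) u (i a) (j a).

(* T u^{(x) k} = u^{(x) l} T, entry by entry. *)
Definition intertwines k l (T : 'Hom(tens k, tens l)) : Prop :=
  forall (i : multi_index k) (j : multi_index l),
    \sum_i' T (basis_tensor i') j *: tensor_power i' i =
    \sum_j' T (basis_tensor i) j' *: tensor_power j j'.

Definition Hom_spanned_by (D : diagram_family) : Prop :=
  forall k l (T : 'Hom(tens k, tens l)),
    intertwines T <-> T \in <<[seq T_ p | p in D k l]>>%VS.

End Hom.

(* (P, v) is C(O_n^+). *)
Definition easy (P A : cstarAlgType R) (v : 'M[P]_n) (u : 'M[A]_n) : Prop :=
  [/\ compact_quantum_group u,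
      qincluded (coords_Sn R n) u, qincluded u v &
      exists2 D : diagram_family,
        forall k l, D k l \subset partitions k l & Hom_spanned_by u D].

Definition corresponding_category (A : cstarAlgType R) (u : 'M[A]_n)
    (D : diagram_family) : Prop :=
  category_of_partitions D /\ Hom_spanned_by u D.

End Easiness.

(* Main.v *)
(* For a unitary matrix U, sending u_ij to the matrix with zero diagonal and
   off-diagonal entries U_ij and its conjugate defines a representation of
   C(O_n^* ) in M_2, and of C(H_n^* ) when U is moreover monomial.  It yields a
   functional sending a monomial in the u_ij to the product of the entries of U,
   conjugated at the even places.  So an intertwiner between tensor powers of u
   is invariant under an alternating tensor product of copies of U and of its
   conjugate, for all U in the group U_n, respectively in the group of monomial
   unitaries.  By Schur-Weyl duality these invariants are spanned by the T_p with
   p in E_o; for monomial unitaries, permutation matrices and the torus leave the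
   p in E_h.  Conversely the relations abc = cba and the cubic ones make these
   T_p intertwiners.

   The same duality shows that the functionals separate the algebra generated by
   the coordinates: a projection commuting with the group has intertwiners as
   coefficients.  Comultiplication, counit, antipode and the inclusion of S_n are
   then obtained from the corresponding operations on the matrices U. *)

From HB Require Import structures.
From mathcomp Require Import all_boot all_order perm all_algebra.
From mathcomp Require Import boolp reals complex ring lra zify.
Require Import Defs.

Set Implicit Arguments.
Unset Strict Implicit.
Unset Printing Implicit Defensive.

Import Order.TTheory GRing.Theory Num.Theory.
Local Open Scope ring_scope.
Local Open Scope complex_scope.

(** Three zero-diagonal matrices with upper right entries [x], [y], [z] multiply to one with upper
    right entry [x * y^* * z], symmetric in [x] and [z]: this is the source of [abc = cba] and of
    the alternating conjugates. The conjugation that a letter receives depends on the parity of what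
    precedes it, so the functionals obtained are linear but not multiplicative; algebra maps out of
    the coordinates are therefore built by checking that they respect every polynomial relation.

    The universal property ranges over C*-algebras, so M_2 has to carry a complete operator norm.
    Quotients are by closed ideals while morphisms come without continuity, so a model descends to a
    quotient only once its kernel is known to be closed.

    Averaging over a group takes the form of the orthogonal projection onto the span of the vectors
    that the group produces; stability of the span under the group and under adjoints makes it
    commute with the group. The same projection ends the Schur-Weyl argument, after commutation with
    unitaries has been extended to all matrices by polynomial identities along Cayley transforms and
    polarized by Ryser's formula. *)

Local Notation "M ^H" := ((map_mx conjc M)^T) (at level 8, format "M ^H").
Local Notation normc := Normc.normc.

(** * The categories of partitions *)

Section Dihedral.
Variables (Z : finType) (f h : Z -> Z) (e : rel Z).
Hypotheses (fK : involutive f) (hK : involutive h).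
Hypothesis efh : forall x y, e x y -> [|| y == x, y == f x | y == h x].

(* [g = h f] generates the rotations of a dihedral action; from a
   fixed point of [h], its powers reach the whole component, on which a
   reflection fixes only the points with 2i = 0, 2i = N or 2i + 1 = N. *)
Let g := h \o f.

Let g_inj : injective g.
Proof. exact: inj_comp (inv_inj hK) (inv_inj fK). Qed.

(** For a product [g] of two involutions [h] and [f], the identity [g h g = h] holds; the factors
    [g] on both sides cancel one pair at a time. *)
Lemma dihedral_reflect x i : h x = x -> iter i g (h (iter i g x)) = x.
Proof.
move=> hx; elim: i => [|i IH]; first by rewrite /= hx.
by rewrite iterSr iterS {2}/g /= hK {2}/g /= fK IH.
Qed.

(** The [g]-orbit of a fixed point of [h] is already stable under [h], which sends the [i]-th
    iterate to the [-i]-th, and hence under [f], which is [h] after [g]. *)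
Lemma dihedral_component x y : h x = x -> connect e x y -> fconnect g x y.
Proof.
move=> hx /connectP[s]; elim/last_ind: s y => [|s z IH] y /=; first by move=> _ ->.
rewrite rcons_path last_rcons => /andP[ps ez] ->; have {}IH := IH _ ps erefl.
set w := last x s in ez IH.
have closeh v : fconnect g x v -> fconnect g x (h v).
  move=> xv; rewrite fconnect_sym //.
  have := dihedral_reflect (findex g x v) hx; rewrite iter_findex // => gx.
  by rewrite -[X in fconnect _ _ X]gx fconnect_iter.
have /or3P[/eqP ->|/eqP ->|/eqP ->] := efh ez; first exact: IH.
- rewrite (_ : f w = h (g w)); last by rewrite /g /= hK.
  by apply: closeh; apply: connect_trans IH (fconnect1 _ _).
- exact: closeh.
Qed.

Lemma iter_small_eq x i : (i < order g x)%N -> iter i g x = x -> i = 0%N.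
Proof. by move=> io gx; rewrite -(findex_iter io) gx findex0. Qed.

Lemma dihedral_fixed_index x y : h x = x -> connect e x y -> y != x ->
  (f y == y) || (h y == y) ->
  exists i, [/\ y = iter i g x, (i < order g x)%N &
    (i.*2 == order g x) || (i.*2.+1 == order g x)].
Proof.
move=> hx /(dihedral_component hx) xy yx fixy.
pose i := findex g x y; have yi : iter i g x = y by exact: iter_findex.
have io : (i < order g x)%N by exact: findex_max.
have small j : iter j g x = x -> (j < (order g x).*2)%N -> j != 0%N -> j = order g x.
  move=> gj jo j0; case: (ltnP j (order g x)) => jN.
    by move: j0; rewrite (iter_small_eq jN gj).
  have : iter (j - order g x) g x = x.
    by have := gj; rewrite -{1}(subnK jN) iterD iter_order.
  move=> /iter_small_eq; rewrite -addnn in jo; move=> /(_ ltac:(lia)); lia.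
have i0 : i != 0%N by apply: contraNneq yx => i0; rewrite -yi i0.
exists i; split=> //; case/orP: fixy => /eqP fixy; apply/orP; [right|left]; apply/eqP.
  apply: small; [|rewrite -addnn; lia|by []].
  have hy : h (iter i.+1 g x) = y by rewrite iterS yi /g /= hK.
  by have := dihedral_reflect i.+1 hx; rewrite hy -{1}yi -iterD addSn addnn.
apply: small; [|rewrite -addnn; lia|rewrite -addnn; lia].
by have := dihedral_reflect i hx; rewrite yi fixy -{1}yi -iterD addnn.
Qed.

(** The parity of the order of the orbit decides between [2i = N] and [2i + 1 = N], so one index is
    left. Applied to two stacked pairings, it says that a component has at most two outer points. *)
Lemma dihedral_two_fixed x y z : h x = x -> connect e x y -> connect e x z ->
  y != x -> z != x -> (f y == y) || (h y == y) -> (f z == z) || (h z == z) -> y = z.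
Proof.
move=> hx xy xz yx zx fy fz.
have [i [-> _ hi]] := dihedral_fixed_index hx xy yx fy.
have [j [-> _ hj]] := dihedral_fixed_index hx xz zx fz.
by congr (iter _ _ _); move: hi hj; rewrite -!addnn; lia.
Qed.

End Dihedral.

Lemma partitionU (T : finType) (P Q : {set {set T}}) (D E : {set T}) :
  partition P D -> partition Q E -> [disjoint D & E] -> partition (P :|: Q) (D :|: E).
Proof.
move=> /and3P[/eqP cP tP nP] /and3P[/eqP cQ tQ nQ] dDE.
rewrite /partition inE negb_or nP nQ !andbT; apply/andP; split.
  by rewrite /cover bigcup_setU -!/(cover _) cP cQ.
by apply: trivIsetU => //; rewrite cP cQ.
Qed.

Section Balance.
Variables k l : nat.

(** A signed count: balance of odd and even legs becomes the vanishing of a sum, which is additive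
    over unions of blocks and only changes by a sign when labels are shifted. *)
Definition weight (x : point k l) : int := (-1) ^+ odd (label x).
Definition total_weight (B : {set point k l}) : int := \sum_(x in B) weight x.

Lemma total_weightE (B : {set point k l}) : total_weight B =
  #|[set x in B | ~~ odd (label x)]|%:Z - #|[set x in B | odd (label x)]|%:Z.
Proof.
rewrite /total_weight (bigID (fun x => odd (label x))) /= addrC; congr (_ + _).
  under eq_bigr => x /andP[_ /negPf ox] do rewrite /weight ox.
  by rewrite sumr_const -cardsE natz.
under eq_bigr => x /andP[_ ox] do rewrite /weight ox.
by rewrite sumr_const -cardsE mulNrn natz.
Qed.

Lemma balancedE (B : {set point k l}) :
  (#|[set x in B | odd (label x)]| == #|[set x in B | ~~ odd (label x)]|) =
  (total_weight B == 0).
Proof. by rewrite total_weightE subr_eq0 eqz_nat eq_sym. Qed.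

Lemma card_odd_even (B : {set point k l}) :
  #|B| = (#|[set x in B | odd (label x)]| + #|[set x in B | ~~ odd (label x)]|)%N.
Proof.
rewrite -(cardsID [set x | odd (label x)] B).
by congr (_ + _)%N; apply: eq_card => x; rewrite !inE // andbC.
Qed.

Lemma in_E_h p : (p \in E_h k l) =
  partition p [set: point k l] && [forall B in p, total_weight B == 0].
Proof. by rewrite !inE; congr (_ && _); apply: eq_forallb => B; rewrite balancedE. Qed.

(** A block of two points is balanced exactly when one leg is odd and the other even. Hence [E_o] is
    [E_h] cut down to pairings, and each stability proof for [E_o] only adds a count of points to
    the one for [E_h]. *)
Lemma in_E_o p : (p \in E_o k l) =
  (p \in E_h k l) && [forall B in p, #|B| == 2].
Proof.
rewrite in_E_h !inE -andbA; congr (_ && _); apply/forallP/andP => [h|[/forallP h1 /forallP h2] B].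
  split; apply/forallP => B; have := h B; case: (B \in p) => //= /andP[B2 /existsP[x]] //.
  move=> /andP[Bx /existsP[y /andP[By /andP[ox ey]]]].
  have xy : x != y by apply: contraNneq ey => <-.
  have -> : B = [set x; y].
    apply/esym/eqP; rewrite eqEcard (eqP B2) cards2 xy andbT.
    by apply/subsetP => z; rewrite !inE => /orP[]/eqP ->.
  by rewrite /total_weight big_setU1 ?inE //= big_set1 /weight ox (negPf ey) addNr.
have := h1 B; have := h2 B; case: (B \in p) => //= B2; rewrite -balancedE B2 /=.
have := card_odd_even B; rewrite (eqP B2) => B2' /eqP eq1.
have e0 : (0 < #|[set x in B | ~~ odd (label x)]|)%N.
  by rewrite lt0n; apply: contra_eqN B2' => /eqP e0; rewrite eq1 e0.
have o0 := e0; rewrite -eq1 in o0.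
have /card_gt0P[x] := o0; have /card_gt0P[y] := e0.
rewrite !inE => /andP[By ey] /andP[Bx ox].
by apply/existsP; exists x; rewrite Bx; apply/existsP; exists y; rewrite By ox.
Qed.

Lemma even_card_balanced (B : {set point k l}) : total_weight B = 0 -> ~~ odd #|B|.
Proof.
move=> /eqP; rewrite -balancedE => /eqP h; rewrite card_odd_even h.
by rewrite addnn odd_double.
Qed.

(** This parity controls the labels of the lower row, which are counted from the right end and so
    depend on [k + l]: the weight of a lower point is then given by its position from the left. *)
Lemma E_h_even p : p \in E_h k l -> ~~ odd (k + l).
Proof.
rewrite in_E_h => /andP[pp /forallP bp].
have <- : #|[set: point k l]| = (k + l)%N by rewrite cardsT card_sum !card_ord.
apply: even_card_balanced; rewrite /total_weight (set_partition_big _ pp) /=.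
by apply: big1 => B Bp; have := bp B; rewrite Bp /= => /eqP.
Qed.

Lemma weight_inl (a : 'I_k) : weight (inl a) = (-1) ^+ a.+1.
Proof. by rewrite /weight signr_odd. Qed.

Lemma weight_inr (b : 'I_l) : ~~ odd (k + l) -> weight (inr b) = (-1) ^+ b.
Proof.
move=> ekl; rewrite /weight /= -[RHS]signr_odd; congr (_ ^+ nat_of_bool _).
have := ltn_ord b; lia.
Qed.

End Balance.

Lemma weight_imset k l k' l' (f : point k l -> point k' l') (c : int) (B : {set point k l}) :
  injective f -> (forall x, weight (f x) = c * weight x) ->
  total_weight B = 0 -> total_weight (f @: B) = 0.
Proof.
move=> fi fw B0; rewrite /total_weight big_imset /=; last by move=> x y _ _; exact: fi.
by under eq_bigr do rewrite fw; rewrite -mulr_sumr -/(total_weight B) B0 mulr0.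
Qed.

Lemma tensor_inl_inj k l k' l' : injective (@tensor_inl k l k' l').
Proof. by case=> a [] b //= []; [move/val_inj ->|move/val_inj ->]. Qed.

Lemma tensor_inr_inj k l k' l' : injective (@tensor_inr k l k' l').
Proof. by case=> a [] b //= [] /addnI/val_inj ->. Qed.

Lemma flip_inj k l : injective (@flip_point k l).
Proof. by case=> a [] b //= [] ->. Qed.

Lemma weight_tensor_inl k l k' l' x : ~~ odd (k' + l') ->
  weight (@tensor_inl k l k' l' x) = 1 * weight x.
Proof.
move=> e'; rewrite mul1r /weight; congr (_ ^+ nat_of_bool _).
by case: x => [a|b] //=; have := ltn_ord b; lia.
Qed.

Lemma weight_tensor_inr k l k' l' x : ~~ odd (k + l) ->
  weight (@tensor_inr k l k' l' x) = (-1) ^+ k * weight x.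
Proof.
move=> e'; rewrite /weight -(signr_odd _ k) -signr_addb; congr (_ ^+ nat_of_bool _).
by case: x => [a|b] /=; [lia|have := ltn_ord b; lia].
Qed.

Lemma in_E_hP k l (p : diagram k l) :
  reflect (partition p [set: point k l] /\ forall B, B \in p -> total_weight B = 0)
    (p \in E_h k l).
Proof.
rewrite in_E_h; apply: (iffP andP) => -[pp bp]; split=> //.
  by move=> B Bp; move/forallP/(_ B): bp; rewrite Bp => /eqP.
by apply/forallP => B; apply/implyP => /bp ->.
Qed.

Lemma in_E_oP k l (p : diagram k l) :
  reflect (p \in E_h k l /\ forall B, B \in p -> #|B| = 2) (p \in E_o k l).
Proof.
rewrite in_E_o; apply: (iffP andP) => -[pp bp]; split=> //.
  by move=> B Bp; move/forallP/(_ B): bp; rewrite Bp => /eqP.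
by apply/forallP => B; apply/implyP => /bp ->.
Qed.

Lemma tensor_cover k l k' l' :
  [set: point (k + k') (l + l')] =
  (@tensor_inl k l k' l') @: [set: point k l] :|: (@tensor_inr k l k' l') @: [set: point k' l'].
Proof.
apply/esym/eqP; rewrite -subTset; apply/subsetP => x _; rewrite inE; apply/orP.
case: x => a; rewrite -[a]splitK; case: (split a) => b /=; [left|right|left|right].
- by apply/imsetP; exists (inl b); rewrite ?inE.
- by apply/imsetP; exists (inl b); rewrite ?inE.
- by apply/imsetP; exists (inr b); rewrite ?inE.
- by apply/imsetP; exists (inr b); rewrite ?inE.
Qed.

Lemma tensor_disjoint k l k' l' :
  [disjoint (@tensor_inl k l k' l') @: [set: point k l]
          & (@tensor_inr k l k' l') @: [set: point k' l']].
Proof.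
apply/pred0P => x /=; apply/negP => /andP[/imsetP[y _ ->] /imsetP[z _]].
case: y => a; case: z => b //= [] ab; have := ltn_ord a; lia.
Qed.

Lemma E_h_hconcat k l k' l' p q : p \in E_h k l -> q \in E_h k' l' ->
  hconcat p q \in E_h (k + k')%N (l + l')%N.
Proof.
move=> pE qE; have ep := E_h_even pE; have eq := E_h_even qE.
have [[pp bp] [pq bq]] := (in_E_hP _ pE, in_E_hP _ qE).
apply/in_E_hP; split.
  rewrite tensor_cover; apply: partitionU; last exact: tensor_disjoint.
    by rewrite imset_partition //; exact: tensor_inl_inj.
  by rewrite imset_partition //; exact: tensor_inr_inj.
move=> B; rewrite inE => /orP[]/imsetP[B' B'p ->].
  apply: (weight_imset (c := 1)); [exact: tensor_inl_inj| |exact: bp].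
  by move=> x; exact: weight_tensor_inl.
apply: (weight_imset (c := (-1) ^+ k)); [exact: tensor_inr_inj| |exact: bq].
by move=> x; exact: weight_tensor_inr.
Qed.

Lemma E_o_hconcat k l k' l' p q : p \in E_o k l -> q \in E_o k' l' ->
  hconcat p q \in E_o (k + k')%N (l + l')%N.
Proof.
move=> /in_E_oP[ph p2] /in_E_oP[qh q2]; apply/in_E_oP; split; first exact: E_h_hconcat.
move=> B; rewrite inE => /orP[]/imsetP[B' B'p ->].
  by rewrite card_imset; [exact: p2|exact: tensor_inl_inj].
by rewrite card_imset; [exact: q2|exact: tensor_inr_inj].
Qed.

Lemma weight_flip k l (x : point k l) : ~~ odd (k + l) ->
  weight (flip_point x) = -1 * weight x.
Proof.
move=> e; rewrite /weight -[X in X * _](expr1 (-1)) -(signr_odd _ 1) -signr_addb.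
by congr (_ ^+ nat_of_bool _); case: x => [a|b] /=; [have := ltn_ord a|have := ltn_ord b]; lia.
Qed.

Lemma E_h_upside_down k l p : p \in E_h k l -> upside_down p \in E_h l k.
Proof.
move=> pE; have ep := E_h_even pE; have [pp bp] := in_E_hP _ pE.
apply/in_E_hP; split.
  have -> : [set: point l k] = (@flip_point k l) @: [set: point k l].
    apply/esym/eqP; rewrite -subTset; apply/subsetP => x _; apply/imsetP.
    by exists (flip_point x); [rewrite inE|case: x].
  by rewrite imset_partition //; exact: flip_inj.
move=> B /imsetP[B' B'p ->]; apply: (weight_imset (c := -1)); [exact: flip_inj| |exact: bp].
by move=> x; exact: weight_flip.
Qed.

Lemma E_o_upside_down k l p : p \in E_o k l -> upside_down p \in E_o l k.
Proof.
move=> /in_E_oP[ph p2]; apply/in_E_oP; split; first exact: E_h_upside_down.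
by move=> B /imsetP[B' B'p ->]; rewrite card_imset; [exact: p2|exact: flip_inj].
Qed.

Lemma partition1 (T : finType) (x : T) : partition [set [set: T]] [set: T].
Proof.
apply/and3P; split; first by rewrite /cover big_set1.
  exact: trivIset1.
by rewrite inE eq_sym; apply/set0Pn; exists x.
Qed.

Lemma point11 : [set: point 1 1] = [set inl ord0; inr ord0].
Proof. by apply/setP => -[] a; rewrite !inE (ord1 a). Qed.

Lemma point02 : [set: point 0 2] = [set inr ord0; inr ord_max].
Proof.
apply/setP => -[[]//|a]; rewrite !inE; apply/esym.
by case: a => [[|[|//]] ha]; apply/orP; [left|right]; apply/eqP; congr inr; exact: val_inj.
Qed.

Lemma E_o_identity : identity_diagram \in E_o 1 1.
Proof.
apply/in_E_oP; split; last by move=> B /set1P ->; rewrite cardsT card_sum !card_ord.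
apply/in_E_hP; split; first exact: (partition1 (inl ord0)).
move=> B /set1P ->; rewrite point11 /total_weight big_setU1 ?inE //= big_set1.
by [].
Qed.

Lemma E_o_semicircle : semicircle \in E_o 0 2.
Proof.
apply/in_E_oP; split; last by move=> B /set1P ->; rewrite cardsT card_sum !card_ord.
apply/in_E_hP; split; first exact: (partition1 (inr ord0)).
move=> B /set1P ->; rewrite point02 /total_weight big_setU1 ?inE //= big_set1.
by [].
Qed.

Lemma E_o_sub_E_h k l p : p \in E_o k l -> p \in E_h k l.
Proof. by case/in_E_oP. Qed.

Lemma stack_top_inj k l m : injective (@stack_top k l m).
Proof. by move=> x y []. Qed.

Lemma stack_bottom_inj k l m : injective (@stack_bottom k l m).
Proof. by case=> a [] b //= [] ->. Qed.

Lemma stack_outer_inj k l m : injective (@stack_outer k l m).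
Proof. by case=> a [] b //= [] ->. Qed.

Section Stack.
Variables (k l m : nat) (p : diagram k l) (q : diagram l m).
Local Notation e := (stack_rel p q).

Lemma stack_rel_sym : symmetric e.
Proof.
by move=> x y; rewrite /stack_rel; congr (_ || _); apply: eq_existsb => B;
  congr (_ && _); exact: andbC.
Qed.

Lemma stack_rel_top B x y : B \in p -> x \in B -> y \in B ->
  e (stack_top m x) (stack_top m y).
Proof.
by move=> Bp Bx By; apply/orP; left; apply/existsP; exists B;
  rewrite Bp !(mem_imset _ _ (@stack_top_inj k l m)) Bx By.
Qed.

Lemma stack_rel_bottom B x y : B \in q -> x \in B -> y \in B ->
  e (stack_bottom k x) (stack_bottom k y).
Proof.
by move=> Bp Bx By; apply/orP; right; apply/existsP; exists B;
  rewrite Bp !(mem_imset _ _ (@stack_bottom_inj k l m)) Bx By.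
Qed.

Lemma stack_connect_equivalence :
  {in [set: point k m] & &, equivalence_rel
     (fun x y => connect e (stack_outer l x) (stack_outer l y))}.
Proof.
move=> x y z _ _ _; split; first exact: connect0.
by move=> xy; apply: same_connect => //; exact: sym_connect_sym stack_rel_sym.
Qed.

Lemma vconcat_partition : partition (vconcat p q) [set: point k m].
Proof. exact: equivalence_partitionP stack_connect_equivalence. Qed.

Lemma vconcat_block B : B \in vconcat p q -> exists x,
  x \in B /\ B = [set y | connect e (stack_outer l x) (stack_outer l y)].
Proof.
move=> /imsetP[x _ ->]; exists x; split; first by rewrite !inE connect0.
by apply/setP => y; rewrite !inE.
Qed.

Hypotheses (pE : p \in E_h k l) (qE : q \in E_h l m).

(* A block of [p] or [q] lies entirely in the component or in its complement. *)
Lemma component_weight k' l' (r : diagram k' l') (s : point k' l' -> stack_point k l m) z :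
  (forall B x y, B \in r -> x \in B -> y \in B -> e (s x) (s y)) -> r \in E_h k' l' ->
  \sum_(x | connect e z (s x)) weight x = 0.
Proof.
move=> es /in_E_hP[pp bp].
transitivity (\sum_(x in [set: point k' l'] | connect e z (s x)) weight x).
  by apply: eq_bigl => x; rewrite inE.
rewrite (set_partition_big_cond _ pp) /=; apply: big1 => B Bp.
have [->|/set0Pn[y By]] := eqVneq B set0; first by rewrite big1 // => x; rewrite inE.
have yB x : x \in B -> connect e z (s x) = connect e z (s y).
  move=> Bx; rewrite -!(sym_connect_sym stack_rel_sym (s _) z).
  apply: same_connect; first exact: sym_connect_sym stack_rel_sym.
  by apply: connect1; exact: es Bp Bx By.
rewrite (eq_bigl (fun x => (x \in B) && connect e z (s y))); last first.
  by move=> x; apply: andb_id2l => /yB.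
case: (connect e z (s y)); last by rewrite big1 // => x; rewrite andbF.
by under eq_bigl do rewrite andbT; exact: bp.
Qed.

(** A component has total weight 0 in [p] and in [q]. A middle point is a lower point of [p] and an
    upper point of [q], with opposite weights, so adding the two sums leaves the outer points. *)
Lemma vconcat_balanced B : B \in vconcat p q -> total_weight B = 0.
Proof.
move=> /vconcat_block[x [_ ->]]; set z := stack_outer l x.
have ep := E_h_even pE; have eq := E_h_even qE.
have ekm : ~~ odd (k + m) by lia.
have := component_weight z stack_rel_top pE.
have := component_weight z stack_rel_bottom qE.
rewrite !big_sumType /= => hq hp.
rewrite /total_weight; under eq_bigl do rewrite inE.
rewrite big_sumType /=.
have mid : \sum_(b | connect e z (inl (inr b))) weight (inr b : point k l) =
    - \sum_(b | connect e z (inl (inr b))) weight (inl b : point l m).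
  rewrite -sumrN; apply: eq_bigr => b _.
  by rewrite weight_inr // weight_inl exprS mulN1r opprK.
have top : \sum_(a | connect e z (inl (inl a))) weight (inl a : point k m) =
    \sum_(a | connect e z (inl (inl a))) weight (inl a : point k l).
  by apply: eq_bigr => a _; rewrite !weight_inl.
have bot : \sum_(c | connect e z (inr c)) weight (inr c : point k m) =
    \sum_(c | connect e z (inr c)) weight (inr c : point l m).
  by apply: eq_bigr => c _; rewrite !weight_inr.
rewrite /stack_top /= mid in hp; rewrite top bot.
by move/eqP: hp; rewrite subr_eq0 => /eqP ->.
Qed.

Lemma E_h_vconcat : vconcat p q \in E_h k m.
Proof.
by apply/in_E_hP; split; [exact: vconcat_partition|exact: vconcat_balanced].
Qed.

End Stack.

Section Partner.
Variables (T : finType) (r : {set {set T}}).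
Hypotheses (rT : partition r [set: T]) (r2 : forall B, B \in r -> #|B| = 2).

Definition partner (x : T) : T := odflt x [pick y in pblock r x :\ x].

Lemma partnerP B x : B \in r -> x \in B ->
  [/\ partner x \in B, partner x != x & B = [set x; partner x]].
Proof.
move=> Br Bx; have tr := partition_trivIset rT.
rewrite /partner (def_pblock tr Br Bx); case: pickP => [y|none] /=.
  rewrite !inE => /andP[yx By]; split=> //.
  apply/esym/eqP; rewrite eqEcard cards2 eq_sym yx r2 // andbT.
  by apply/subsetP => z; rewrite !inE => /orP[]/eqP ->.
have : #|B :\ x| = 1%N by have := cardsD1 x B; rewrite Bx r2 // add1n => -[].
by rewrite (eq_card0 none).
Qed.

Lemma partner_block x : exists2 B, B \in r & x \in B.
Proof.
have : x \in cover r by rewrite (cover_partition rT) inE.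
by case/bigcupP => B Br Bx; exists B.
Qed.

Lemma partnerK : involutive partner.
Proof.
move=> x; have [B Br Bx] := partner_block x.
have [Bpx pxx BE] := partnerP Br Bx; have [Bppx ppxx _] := partnerP Br Bpx.
by move: Bppx; rewrite {1}BE !inE (negPf ppxx) orbF => /eqP.
Qed.

Lemma partner_eq B x y : B \in r -> x \in B -> y \in B -> (y == x) || (y == partner x).
Proof. by move=> Br Bx; have [_ _ ->] := partnerP Br Bx; rewrite !inE. Qed.

End Partner.

Section StackPairing.
Variables (k l m : nat) (p : diagram k l) (q : diagram l m).
Hypotheses (pE : p \in E_o k l) (qE : q \in E_o l m).
Local Notation e := (stack_rel p q).

Let pp : partition p [set: point k l]. Proof. by case/in_E_oP: pE => /in_E_hP[]. Qed.
Let pq : partition q [set: point l m]. Proof. by case/in_E_oP: qE => /in_E_hP[]. Qed.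
Let p2 B : B \in p -> #|B| = 2. Proof. by case/in_E_oP: pE => _; apply. Qed.
Let q2 B : B \in q -> #|B| = 2. Proof. by case/in_E_oP: qE => _; apply. Qed.

(** Each pairing is extended by the identity to the points outside it. Thus every outer point is
    fixed by one of the two involutions, and components of the stack are dihedral orbits. *)
Definition top_partner (x : stack_point k l m) : stack_point k l m :=
  match x with inl y => inl (partner p y) | inr c => inr c end.
Definition bottom_partner (x : stack_point k l m) : stack_point k l m :=
  match x with
  | inl (inl a) => inl (inl a)
  | inl (inr b) => stack_bottom k (partner q (inl b))
  | inr c => stack_bottom k (partner q (inr c)) end.

Lemma bottom_partnerE y : bottom_partner (stack_bottom k y) = stack_bottom k (partner q y).
Proof. by case: y. Qed.

Lemma top_partnerK : involutive top_partner.
Proof. by case=> [y|c] //=; rewrite partnerK. Qed.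

Lemma bottom_partnerK : involutive bottom_partner.
Proof.
case=> [[a|b]|c] //=; rewrite ?bottom_partnerE partnerK //.
Qed.

Lemma stack_rel_partner x y : e x y ->
  [|| y == x, y == top_partner x | y == bottom_partner x].
Proof.
case/orP => /existsP[B /and3P[Br /imsetP[x' Bx ->] /imsetP[y' By ->]]].
  by have /orP[/eqP ->|/eqP ->] := partner_eq pp p2 Br Bx By; rewrite eqxx ?orbT.
rewrite bottom_partnerE.
by have /orP[/eqP ->|/eqP ->] := partner_eq pq q2 Br Bx By; rewrite eqxx ?orbT.
Qed.

Lemma outer_fixed (x : point k m) : (top_partner (stack_outer l x) == stack_outer l x) ||
  (bottom_partner (stack_outer l x) == stack_outer l x).
Proof. by case: x => a; rewrite /= eqxx ?orbT. Qed.

Lemma outer_component (x y z : point k m) : connect e (stack_outer l x) (stack_outer l y) ->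
  connect e (stack_outer l x) (stack_outer l z) -> y != x -> z != x -> y = z.
Proof.
move=> xy xz yx zx; apply: (@stack_outer_inj k l m).
have {}yx : stack_outer l y != stack_outer l x by rewrite (inj_eq (@stack_outer_inj k l m)).
have {}zx : stack_outer l z != stack_outer l x by rewrite (inj_eq (@stack_outer_inj k l m)).
(* The base point has to be fixed by [h], so the two involutions exchange their roles according to
   which of them fixes the point. *)
case/orP: (outer_fixed x) => /eqP fx.
  apply: (dihedral_two_fixed (f := bottom_partner) (h := top_partner) _ _ _ fx xy xz) => //.
  - exact: bottom_partnerK.
  - exact: top_partnerK.
  - by move=> u v /stack_rel_partner /or3P[] ->; rewrite ?orbT.
  - by rewrite orbC outer_fixed.
  - by rewrite orbC outer_fixed.
apply: (dihedral_two_fixed (f := top_partner) (h := bottom_partner) _ _ _ fx xy xz) => //.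
- exact: top_partnerK.
- exact: bottom_partnerK.
- exact: stack_rel_partner.
- exact: outer_fixed.
- exact: outer_fixed.
Qed.

(** A block is nonempty, has at most two points by [outer_component], and has evenly many by
    balance. *)
Lemma E_o_vconcat : vconcat p q \in E_o k m.
Proof.
have ph := E_o_sub_E_h pE; have qh := E_o_sub_E_h qE.
apply/in_E_oP; split=> [|B Br]; first exact: E_h_vconcat.
have := even_card_balanced (vconcat_balanced ph qh Br).
have [x [Bx BE]] := vconcat_block Br; rewrite (cardsD1 x B) Bx add1n /= negbK.
suff : (#|B :\ x| <= 1)%N by case: #|_| => [|[|]].
apply/card_le1_eqP => y z; rewrite !inE BE !inE => /andP[yx xy] /andP[zx xz].
exact: outer_component xz xy zx yx.
Qed.

End StackPairing.

Lemma category_E_h : category_of_partitions E_h.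
Proof.
split.
- by move=> k l; apply/subsetP => p /in_E_hP[pp _]; rewrite inE.
- by move=> *; exact: E_h_hconcat.
- by move=> *; exact: E_h_vconcat.
- by move=> *; exact: E_h_upside_down.
- by split; apply: E_o_sub_E_h; [exact: E_o_identity|exact: E_o_semicircle].
Qed.

Lemma category_E_o : category_of_partitions E_o.
Proof.
split.
- by move=> k l; apply/subsetP => p /E_o_sub_E_h/in_E_hP[pp _]; rewrite inE.
- by move=> *; exact: E_o_hconcat.
- by move=> *; exact: E_o_vconcat.
- by move=> *; exact: E_o_upside_down.
- by split; [exact: E_o_identity|exact: E_o_semicircle].
Qed.

(** * C*-algebras of matrices *)

Section RealSequences.
Variable R : realType.

(** The limit is taken as the supremum of the eventual lower bounds, that is, the limit inferior. *)
Lemma cauchy_seq_cvg (r : nat -> R) :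
  (forall e, 0 < e -> exists N, forall m n, (N <= m)%N -> (N <= n)%N ->
     `|r m - r n| < e) ->
  exists l, forall e, 0 < e -> exists N, forall n, (N <= n)%N -> `|r n - l| < e.
Proof.
move=> cr; pose S : classical_sets.set R := fun x => exists N, forall n, (N <= n)%N -> x <= r n.
have loS e N : (forall m n, (N <= m)%N -> (N <= n)%N -> `|r m - r n| < e) ->
    S (r N - e).
  move=> h; exists N => n /(h N n (leqnn _)); rewrite ltr_norml => /andP[_ h2].
  by lra.
have upS e N : (forall m n, (N <= m)%N -> (N <= n)%N -> `|r m - r n| < e) ->
    classical_sets.ubound S (r N + e).
  move=> h x [M hM].
  have := h N (maxn N M) (leqnn _) (leq_maxl _ _).
  have := hM (maxn N M) (leq_maxr _ _).
  by rewrite ltr_norml => h1 /andP[h2 h3]; lra.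
have [N0 hN0] := cr 1 ltr01.
have supS : classical_sets.has_sup S by split; [exists (r N0 - 1); exact: loS|
  exists (r N0 + 1); exact: upS].
exists (sup S) => e e0; have [|N hN] := cr (e / 2); first by lra.
exists N => n Nn.
have h1 := ub_le_sup supS.2 (loS _ _ hN).
have h2 := ge_sup supS.1 (upS _ _ hN).
have := hN N n (leqnn _) Nn.
by rewrite !ltr_norml => /andP[h3 h4]; apply/andP; split; lra.
Qed.

Lemma normc_ge0 (x : R[i]) : 0 <= normc x.
Proof. by case: x => a b; exact: sqrtr_ge0. Qed.

Lemma normc_conj (x : R[i]) : normc x^* = normc x.
Proof. by case: x => a b; rewrite /normc /= sqrrN. Qed.

Lemma normc_sqr (x : R[i]) : normc x ^+ 2 = complex.Re x ^+ 2 + complex.Im x ^+ 2.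
Proof. by case: x => a b; rewrite /normc sqr_sqrtr // addr_ge0 ?sqr_ge0. Qed.

Lemma sqr_normc_C (x : R[i]) : (normc x ^+ 2)%:C = x * x^*.
Proof. by rewrite -sqr_normc rmorphXn /=; case: x. Qed.

Lemma Re_le_normc (x : R[i]) : `|complex.Re x| <= normc x.
Proof.
by rewrite -(@ler_pXn2r _ 2) ?nnegrE ?normc_ge0 // real_normK ?num_real //
  normc_sqr lerDl sqr_ge0.
Qed.

Lemma Im_le_normc (x : R[i]) : `|complex.Im x| <= normc x.
Proof.
by rewrite -(@ler_pXn2r _ 2) ?nnegrE ?normc_ge0 // real_normK ?num_real //
  normc_sqr lerDr sqr_ge0.
Qed.

Lemma normc_le_ReIm (x : R[i]) : normc x <= `|complex.Re x| + `|complex.Im x|.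
Proof.
rewrite -(@ler_pXn2r _ 2) ?nnegrE ?normc_ge0 ?addr_ge0 // normc_sqr.
rewrite -[in leLHS](real_normK (num_real (complex.Re x))).
rewrite -[in leLHS](real_normK (num_real (complex.Im x))).
have := mulr_ge0 (normr_ge0 (complex.Re x)) (normr_ge0 (complex.Im x)).
by rewrite sqrrD => h; lra.
Qed.

Lemma ReB (x y : R[i]) : complex.Re (x - y) = complex.Re x - complex.Re y.
Proof. by case: x; case: y. Qed.

Lemma ImB (x y : R[i]) : complex.Im (x - y) = complex.Im x - complex.Im y.
Proof. by case: x; case: y. Qed.

Lemma cauchy_seq_cvg_complex (r : nat -> R[i]) :
  (forall e : R, 0 < e -> exists N, forall m n, (N <= m)%N -> (N <= n)%N ->
     normc (r m - r n) < e) ->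
  exists l, forall e : R, 0 < e -> exists N, forall n, (N <= n)%N ->
    normc (r n - l) < e.
Proof.
move=> cr.
have [|a ha] := @cauchy_seq_cvg (fun n => complex.Re (r n)).
  move=> e /cr[N hN]; exists N => m n Nm Nn; rewrite -ReB.
  by apply: le_lt_trans (hN m n Nm Nn); exact: Re_le_normc.
have [|b hb] := @cauchy_seq_cvg (fun n => complex.Im (r n)).
  move=> e /cr[N hN]; exists N => m n Nm Nn; rewrite -ImB.
  by apply: le_lt_trans (hN m n Nm Nn); exact: Im_le_normc.
exists (a +i* b) => e e0.
have [|N hN] := ha (e / 2); first by lra.
have [|M hM] := hb (e / 2); first by lra.
exists (maxn N M) => n; rewrite geq_max => /andP[/hN h1 /hM h2].
apply: le_lt_trans (normc_le_ReIm _) _; rewrite ReB ImB /=; lra.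
Qed.

(** Bernoulli's inequality for [q^-1 = 1 + h], with an archimedean bound on [e^-1 / h]. *)
Lemma geometric_small (q e : R) : 0 <= q -> q < 1 -> 0 < e ->
  exists N, forall n, (N <= n)%N -> q ^+ n < e.
Proof.
move=> q0 q1 e0; have [->|qn0] := eqVneq q 0.
  by exists 1%N => -[|n] // _; rewrite expr0n.
have qp : 0 < q by rewrite lt_def qn0.
pose h := q^-1 - 1.
have h0 : 0 < h by rewrite subr_gt0 invf_gt1.
have bern n : 1 + h *+ n <= q^-1 ^+ n.
  elim: n => [|n IH]; first by rewrite mulr0n addr0 expr0.
  rewrite exprS (_ : q^-1 = 1 + h); last by rewrite /h addrCA subrr addr0.
  apply: le_trans (_ : (1 + h) * (1 + h *+ n) <= _).
    have : 0 <= h * (h *+ n) by rewrite mulr_ge0 ?mulrn_wge0 // ltW.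
    by rewrite mulrS; set x := h *+ n => hx; lra.
  rewrite ler_pM2l; last by lra.
  by move: IH; rewrite (_ : q^-1 = 1 + h) // /h addrCA subrr addr0.
pose N := Num.bound (e^-1 / h).
exists N => n Nn; rewrite -[q]invrK exprVn invf_plt ?posrE //; last first.
  by rewrite exprn_gt0 // invr_gt0.
apply: lt_le_trans (bern n).
have : e^-1 / h < N%:R.
  by apply: archi_boundP; rewrite divr_ge0 ?invr_ge0 // ltW.
rewrite ltr_pdivrMr // => hN.
have : h *+ N <= h *+ n by rewrite ler_pMn2l.
by rewrite -mulr_natl => hh; lra.
Qed.

(** The sum of the squares of [B * a i - P * b i] equals [B * (A * B - P ^+ 2)], and [B] can be
    cancelled unless all the [b i] vanish. *)
Lemma cauchy_schwarz_sum (I : finType) (a b : I -> R) :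
  (\sum_i a i * b i) ^+ 2 <= (\sum_i a i ^+ 2) * (\sum_i b i ^+ 2).
Proof.
set A := \sum_i a i ^+ 2; set B := \sum_i b i ^+ 2; set P := \sum_i _.
have B0 : 0 <= B by apply: sumr_ge0 => i _; exact: sqr_ge0.
have [BE|Bn] := eqVneq B 0.
  suff -> : P = 0 by rewrite BE mulr0 expr0n.
  apply: big1 => i _.
  have /eqP : b i ^+ 2 = 0.
    apply/eqP; move/eqP: BE; rewrite psumr_eq0 => [/allP/(_ i)|j _]; last exact: sqr_ge0.
    by rewrite mem_index_enum => /(_ isT).
  by rewrite sqrf_eq0 => /eqP ->; rewrite mulr0.
have Bp : 0 < B by rewrite lt_def Bn.
have : 0 <= \sum_i (B * a i - P * b i) ^+ 2 by apply: sumr_ge0 => i _; exact: sqr_ge0.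
have -> : \sum_i (B * a i - P * b i) ^+ 2 = B ^+ 2 * A - 2 * B * P * P + P ^+ 2 * B.
  rewrite (eq_bigr (fun i => B ^+ 2 * a i ^+ 2 - 2 * B * P * (a i * b i) +
    P ^+ 2 * b i ^+ 2)); last by move=> i _; ring.
  by rewrite big_split sumrB -!mulr_sumr.
rewrite (_ : _ + _ = B * (A * B - P ^+ 2)); last by ring.
by rewrite pmulr_rge0 // subr_ge0.
Qed.

End RealSequences.

Section MatrixCstar.
Variables (R : realType) (n : nat).

(** The index [n.+1] provides the unital algebra structure; the two-by-two matrices of the models
    are [mxC R 1]. The norm put on it is the operator norm for the hermitian norm on columns. *)
Definition mxC : Type := 'M[R[i]]_n.+1.
HB.instance Definition _ := GRing.Algebra.on mxC.
Implicit Types (x y : mxC) (v w : 'cV[R[i]]_n.+1).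

Definition mxC_star x : mxC := (map_mx (@conjc R) x)^T.

Fact mxC_starK x : mxC_star (mxC_star x) = x.
Proof. by apply/matrixP => i j; rewrite !mxE conjcK. Qed.
Fact mxC_starD x y : mxC_star (x + y) = mxC_star x + mxC_star y.
Proof. by apply/matrixP => i j; rewrite !mxE rmorphD. Qed.
Fact mxC_starZ (c : R[i]) x : mxC_star (c *: x) = c^* *: mxC_star x.
Proof. by apply/matrixP => i j; rewrite !mxE rmorphM. Qed.
Fact mxC_starM x y : mxC_star (x * y) = mxC_star y * mxC_star x.
Proof. by rewrite /mxC_star map_mxM trmx_mul. Qed.
HB.instance Definition _ := hasStar.Build R mxC
  mxC_starK mxC_starD mxC_starZ mxC_starM.

Definition vnorm v : R := Num.sqrt (\sum_i normc (v i 0) ^+ 2).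

Let nsq_ge0 v : 0 <= \sum_i normc (v i 0) ^+ 2.
Proof. by apply: sumr_ge0 => i _; exact: sqr_ge0. Qed.

Lemma vnorm_ge0 v : 0 <= vnorm v. Proof. exact: sqrtr_ge0. Qed.

Lemma vnorm_sqr v : vnorm v ^+ 2 = \sum_i normc (v i 0) ^+ 2.
Proof. by rewrite sqr_sqrtr. Qed.

Lemma vnorm_sqrC v : (vnorm v ^+ 2)%:C = \sum_i (v i 0)^* * v i 0.
Proof.
rewrite vnorm_sqr raddf_sum; apply: eq_bigr => i _.
by rewrite /= sqr_normc_C mulrC.
Qed.

Lemma normc_le_vnorm v i : normc (v i 0) <= vnorm v.
Proof.
rewrite -(@ler_pXn2r _ 2) ?nnegrE ?normc_ge0 ?vnorm_ge0 // vnorm_sqr.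
by rewrite (bigD1 i) //= lerDl sumr_ge0 // => j _; exact: sqr_ge0.
Qed.

Lemma vnorm0_eq0 v : vnorm v = 0 -> v = 0.
Proof.
move=> v0; apply/colP => i; rewrite mxE; apply: Normc.eq0_normc.
by apply/eqP; rewrite eq_le normc_ge0 andbT -v0 normc_le_vnorm.
Qed.

Lemma normc_sum (I : finType) (f : I -> R[i]) :
  normc (\sum_i f i) <= \sum_i normc (f i).
Proof.
elim/big_ind2: _ => [|a b c d h1 h2|//]; first by rewrite Normc.normc0.
by apply: le_trans (le_normcD _ _) _; exact: lerD.
Qed.

Lemma vnorm_cs v w : normc (\sum_i (v i 0)^* * w i 0) <= vnorm v * vnorm w.
Proof.
apply: le_trans (normc_sum _) _.
rewrite -(@ler_pXn2r _ 2) ?nnegrE ?mulr_ge0 ?vnorm_ge0 ?sumr_ge0 //; last first.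
  by move=> i _; exact: normc_ge0.
rewrite exprMn !vnorm_sqr; apply: le_trans (cauchy_schwarz_sum _ _).
by rewrite le_eqVlt (eq_bigr _ (fun i _ => Normc.normcM _ _)); apply/orP; left;
  apply/eqP; congr (_ ^+ 2); apply: eq_bigr => i _; rewrite normc_conj.
Qed.

Lemma vnormD v w : vnorm (v + w) <= vnorm v + vnorm w.
Proof.
rewrite -(@ler_pXn2r _ 2) ?nnegrE ?addr_ge0 ?vnorm_ge0 //.
rewrite sqrrD vnorm_sqr.
apply: le_trans (_ : \sum_i (normc (v i 0) + normc (w i 0)) ^+ 2 <= _).
  apply: ler_sum => i _; rewrite mxE.
  by rewrite ler_pXn2r ?nnegrE ?addr_ge0 ?normc_ge0 // le_normcD.
under eq_bigr do rewrite sqrrD.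
rewrite 2!big_split /= -!vnorm_sqr lerD2r lerD2l sumrMnl lerMn2r /=.
rewrite -(@ler_pXn2r _ 2) ?nnegrE ?mulr_ge0 ?vnorm_ge0 ?sumr_ge0 //; last first.
  by move=> i _; rewrite mulr_ge0 ?normc_ge0.
by rewrite exprMn !vnorm_sqr cauchy_schwarz_sum.
Qed.

Lemma vnormZ (c : R[i]) v : vnorm (c *: v) = normc c * vnorm v.
Proof.
rewrite /vnorm; under eq_bigr do rewrite mxE Normc.normcM exprMn.
by rewrite -mulr_sumr sqrtrM ?sqr_ge0 // sqrtr_sqr ger0_norm ?normc_ge0.
Qed.

Lemma vnorm0 : vnorm 0 = 0.
Proof. by rewrite -(scale0r 0) vnormZ Normc.normc0 mul0r. Qed.

Definition opnorm_set x : classical_sets.set R :=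
  fun r => exists2 v, vnorm v <= 1 & vnorm (x *m v) = r.
Definition mxC_norm x : R := sup (opnorm_set x).

Lemma vnorm_le_sum v : vnorm v <= \sum_i normc (v i 0).
Proof.
have s0 : 0 <= \sum_i normc (v i 0) by apply: sumr_ge0 => i _; exact: normc_ge0.
rewrite -(@ler_pXn2r _ 2) ?nnegrE ?vnorm_ge0 // vnorm_sqr expr2 mulr_suml.
apply: ler_sum => i _; rewrite expr2 ler_wpM2l ?normc_ge0 //.
by rewrite (bigD1 i) //= lerDl sumr_ge0 // => j _; exact: normc_ge0.
Qed.

Lemma vnorm_mul_le x v :
  vnorm v <= 1 -> vnorm (x *m v) <= \sum_i \sum_j normc (x i j).
Proof.
move=> v1; apply: le_trans (vnorm_le_sum _) _; apply: ler_sum => i _.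
rewrite mxE; apply: le_trans (normc_sum _) _; apply: ler_sum => j _.
rewrite Normc.normcM ler_piMr ?normc_ge0 //.
exact: le_trans (normc_le_vnorm _ _) v1.
Qed.

Lemma has_sup_opnorm x : classical_sets.has_sup (opnorm_set x).
Proof.
split; first by exists (vnorm (x *m 0)), 0 => //=; rewrite vnorm0.
by exists (\sum_i \sum_j normc (x i j)) => _ [v /= v1 <-]; exact: vnorm_mul_le.
Qed.

Lemma mxC_norm_ge0 x : 0 <= mxC_norm x.
Proof.
apply: (ub_le_sup (has_sup_opnorm x).2).
by exists 0; rewrite /= ?mulmx0 vnorm0.
Qed.

Lemma mxC_norm_le x : mxC_norm x <= \sum_i \sum_j normc (x i j).
Proof.
by apply: (ge_sup (has_sup_opnorm x).1) => _ [v /= v1 <-]; exact: vnorm_mul_le.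
Qed.

Lemma vnorm_mul x v : vnorm (x *m v) <= mxC_norm x * vnorm v.
Proof.
have [/vnorm0_eq0 ->|v0] := eqVneq (vnorm v) 0.
  by rewrite mulmx0 vnorm0 mulr0.
have vp : 0 < vnorm v by rewrite lt_def v0 vnorm_ge0.
have ni : normc ((vnorm v)^-1)%:C = (vnorm v)^-1.
  by rewrite /Normc.normc /= expr0n addr0 sqrtr_sqr ger0_norm // invr_ge0 ltW.
rewrite -ler_pdivrMr // mulrC -ni -vnormZ scalemxAr.
apply: (ub_le_sup (has_sup_opnorm x).2); exists (((vnorm v)^-1)%:C *: v) => //=.
by rewrite vnormZ ni mulVf.
Qed.

Lemma mxC_norm_bound x (K : R) :
  (forall v, vnorm (x *m v) <= K * vnorm v) -> 0 <= K -> mxC_norm x <= K.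
Proof.
move=> h K0; apply: (ge_sup (has_sup_opnorm x).1) => _ [v /= v1 <-].
by apply: le_trans (h v) _; rewrite ler_piMr.
Qed.

Lemma mxC_entry_le x i j : normc (x i j) <= mxC_norm x.
Proof.
pose v : 'cV[R[i]]_n.+1 := delta_mx j 0.
have v1 : vnorm v = 1.
  rewrite /vnorm (bigD1 j) //= mxE !eqxx Normc.normc1 expr1n.
  rewrite big1 ?addr0 ?sqrtr1 // => k kj.
  by rewrite mxE (negPf kj) Normc.normc0 expr0n.
have := vnorm_mul x v; rewrite v1 mulr1; apply: le_trans.
have -> : x i j = (x *m v) i 0.
  rewrite mxE (bigD1 j) //= mxE !eqxx mulr1 big1 ?addr0 // => k kj.
  by rewrite mxE (negPf kj) mulr0.
exact: normc_le_vnorm.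
Qed.

Fact mxC_norm0_eq0 x : mxC_norm x = 0 -> x = 0.
Proof.
move=> x0; apply/matrixP => i j; rewrite mxE; apply: Normc.eq0_normc.
by apply/eqP; rewrite eq_le normc_ge0 andbT -x0 mxC_entry_le.
Qed.
Fact mxC_normD x y : mxC_norm (x + y) <= mxC_norm x + mxC_norm y.
Proof.
apply: mxC_norm_bound; last by rewrite addr_ge0 ?mxC_norm_ge0.
move=> v; rewrite mulmxDl mulrDl; apply: le_trans (vnormD _ _) _.
by rewrite lerD ?vnorm_mul.
Qed.
Fact mxC_normZ (c : R[i]) x : mxC_norm (c *: x) = normc c * mxC_norm x.
Proof.
have le (d : R[i]) z : mxC_norm (d *: z) <= normc d * mxC_norm z.
  apply: mxC_norm_bound => [v|]; last by rewrite mulr_ge0 ?normc_ge0 ?mxC_norm_ge0.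
  by rewrite -scalemxAl vnormZ -mulrA ler_wpM2l ?normc_ge0 ?vnorm_mul.
apply/eqP; rewrite eq_le le /=; have [->|c0] := eqVneq c 0.
  by rewrite Normc.normc0 mul0r mxC_norm_ge0.
have nc0 : 0 < normc c.
  rewrite lt_def normc_ge0 andbT; apply: contra c0 => /eqP /Normc.eq0_normc ->.
  by [].
rewrite -ler_pdivlMl // -Normc.normcV.
have := le c^-1 (c *: x); rewrite scalerA mulVf // scale1r; apply.
Qed.
Fact mxC_normM x y : mxC_norm (x * y) <= mxC_norm x * mxC_norm y.
Proof.
apply: mxC_norm_bound => [v|]; last by rewrite mulr_ge0 ?mxC_norm_ge0.
rewrite -mulmxA; apply: le_trans (vnorm_mul _ _) _.
by rewrite -mulrA ler_wpM2l ?mxC_norm_ge0 ?vnorm_mul.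
Qed.

(** The square of the norm of [x *m v] is the inner product of [v] with [star x * x] applied to [v],
    bounded by Cauchy-Schwarz. *)
Lemma mxC_norm_sqr_le x : mxC_norm x ^+ 2 <= mxC_norm (mxC_star x * x).
Proof.
set K := mxC_norm (mxC_star x * x); have K0 : 0 <= K by exact: mxC_norm_ge0.
rewrite -[K]sqr_sqrtr // ler_pXn2r ?nnegrE ?mxC_norm_ge0 ?sqrtr_ge0 //.
apply: mxC_norm_bound; last exact: sqrtr_ge0.
move=> v; rewrite -(@ler_pXn2r _ 2) ?nnegrE ?mulr_ge0 ?vnorm_ge0 ?sqrtr_ge0 //.
rewrite exprMn (sqr_sqrtr K0).
have e : (vnorm (x *m v) ^+ 2)%:C =
    \sum_i (v i 0)^* * ((mxC_star x * x : mxC) *m v) i 0.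
  rewrite vnorm_sqrC -mulmxA.
  transitivity (\sum_i \sum_j (v j 0)^* * ((x i j)^* * (x *m v) i 0)).
    apply: eq_bigr => i _; rewrite [in X in X * _]mxE.
    rewrite rmorph_sum mulr_suml; apply: eq_bigr => j _.
    by rewrite /= rmorphM mulrAC mulrC.
  rewrite exchange_big; apply: eq_bigr => j _ /=.
  by rewrite -mulr_sumr [X in _ = _ * X]mxE; congr (_ * _); apply: eq_bigr => i _; rewrite !mxE.
have := vnorm_cs v ((mxC_star x * x : mxC) *m v); rewrite -e.
rewrite {1}/Normc.normc /= expr0n addr0 sqrtr_sqr ger0_norm ?sqr_ge0 // => h.
apply: le_trans h _; apply: le_trans (_ : vnorm v * (K * vnorm v) <= _).
  by rewrite ler_wpM2l ?vnorm_ge0 ?vnorm_mul.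
by rewrite mulrCA -expr2.
Qed.

(** From [mxC_norm_sqr_le] and submultiplicativity, after cancelling one factor [mxC_norm x]. *)
Lemma mxC_norm_star_le x : mxC_norm x <= mxC_norm (mxC_star x).
Proof.
have [->|x0] := eqVneq (mxC_norm x) 0; first exact: mxC_norm_ge0.
have xp : 0 < mxC_norm x by rewrite lt_def x0 mxC_norm_ge0.
rewrite -(ler_pM2r xp) -expr2; apply: le_trans (mxC_norm_sqr_le x) _.
exact: mxC_normM.
Qed.

Fact mxC_norm_star x : mxC_norm (star x * x) = mxC_norm x ^+ 2.
Proof.
apply/eqP; rewrite eq_le mxC_norm_sqr_le andbT.
apply: le_trans (mxC_normM _ _) _; rewrite expr2 ler_wpM2r ?mxC_norm_ge0 //.
by apply: le_trans (mxC_norm_star_le _) _; rewrite mxC_starK.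
Qed.

Fact mxC_complete (s : nat -> mxC) :
  (forall e : R, 0 < e -> exists N, forall m k,
     (N <= m)%N -> (N <= k)%N -> mxC_norm (s m - s k) < e) ->
  exists l, forall e : R, 0 < e -> exists N, forall k,
     (N <= k)%N -> mxC_norm (s k - l) < e.
Proof.
move=> cs.
have lim (ij : 'I_n.+1 * 'I_n.+1) : {l : R[i] | forall e : R, 0 < e -> exists N,
    forall k, (N <= k)%N -> normc (s k ij.1 ij.2 - l) < e}.
  apply: cid; apply: cauchy_seq_cvg_complex => e /cs[N hN].
  exists N => m k Nm Nk; apply: le_lt_trans (hN m k Nm Nk).
  have -> : s m ij.1 ij.2 - s k ij.1 ij.2 = (s m - s k) ij.1 ij.2 by rewrite !mxE.
  exact: mxC_entry_le.
pose l : mxC := \matrix_(i, j) sval (lim (i, j)).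
(* The denominator is one more than the number of entries, so that the sum of all entry bounds stays
   strictly below [e]. *)
exists l => e e0; pose d := e / (n.+1 * n.+1).+1%:R.
have d0 : 0 < d by rewrite divr_gt0.
have hN ij : {N | forall k, (N <= k)%N -> normc (s k ij.1 ij.2 - sval (lim ij)) < d}.
  by apply: cid; exact: (svalP (lim ij)).
exists (\max_ij sval (hN ij)) => k /bigmax_leqP Nk.
apply: le_lt_trans (mxC_norm_le _) _.
apply: le_lt_trans (_ : \sum_(i < n.+1) \sum_(j < n.+1) d < e).
  apply: ler_sum => i _; apply: ler_sum => j _.
  by rewrite !mxE ltW //; apply: (svalP (hN (i, j))); exact: Nk.
under eq_bigr do rewrite sumr_const card_ord.
rewrite sumr_const card_ord -mulrnA -[X in X < _]mulr_natr /d -mulrA gtr_pMr //.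
by rewrite ltr_pdivrMl // mulr1 ltr_nat.
Qed.

HB.instance Definition _ := isCstar.Build R mxC
  mxC_norm0_eq0 mxC_normD mxC_normZ mxC_normM mxC_norm_star mxC_complete.

End MatrixCstar.

Section StarBasics.
Variables (R : realType) (A : starAlgType R).
Implicit Types x y : A.

Lemma star0 : star (0 : A) = 0.
Proof. by apply: (@addrI _ (star 0)); rewrite -starD !addr0. Qed.

Lemma starN x : star (- x) = - star x.
Proof. by apply: (@addrI _ (star x)); rewrite -starD !subrr star0. Qed.

Lemma star_sum (I : Type) (r : seq I) (F : I -> A) :
  star (\sum_(i <- r) F i) = \sum_(i <- r) star (F i).
Proof. exact: (big_morph star (@starD R A) star0). Qed.

End StarBasics.

(** * Neumann series and closed kernels of two-dimensional representations *)

Section CstarBasics.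
Variables (R : realType) (A : cstarAlgType R).
Implicit Types x y : A.

Lemma cnormN x : cnorm (- x) = cnorm x.
Proof. by rewrite -scaleN1r cnormZ normcN Normc.normc1 mul1r. Qed.

Lemma cnorm0 : cnorm (0 : A) = 0.
Proof. by rewrite -(scale0r 0) cnormZ Normc.normc0 mul0r. Qed.

Lemma cnorm_ge0 x : 0 <= cnorm x.
Proof.
have := cnormD x (- x); rewrite subrr cnorm0 cnormN => h; lra.
Qed.

Lemma cnormBC x y : cnorm (x - y) = cnorm (y - x).
Proof. by rewrite -opprB cnormN. Qed.

Lemma cnorm_star_le x : cnorm x <= cnorm (star x).
Proof.
have [->|x0] := eqVneq (cnorm x) 0; first exact: cnorm_ge0.
have xp : 0 < cnorm x by rewrite lt_def x0 cnorm_ge0.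
by rewrite -(ler_pM2r xp) -expr2 -cnorm_star cnormM.
Qed.

Lemma cnorm_starE x : cnorm (star x) = cnorm x.
Proof.
apply/eqP; rewrite eq_le cnorm_star_le andbT.
by apply: le_trans (cnorm_star_le _) _; rewrite starK.
Qed.

Lemma cnormX x k : cnorm (x ^+ k) <= cnorm x ^+ k * cnorm (1 : A).
Proof.
elim: k => [|k IH]; first by rewrite !expr0 mul1r.
rewrite !exprS -mulrA; apply: le_trans (cnormM _ _) _.
by rewrite ler_wpM2l ?cnorm_ge0.
Qed.

Lemma limit_eq0 x (K : R) :
  (forall e : R, 0 < e -> cnorm x <= K * e) -> x = 0.
Proof.
move=> h; apply: cnorm0_eq0; apply/eqP; rewrite eq_le cnorm_ge0 andbT.
rewrite leNgt; apply/negP => x0.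
have K1 : 0 < `|K| + 1 by rewrite ltr_wpDl.
pose d := cnorm x / 2 / (`|K| + 1).
have d0 : 0 < d by rewrite !divr_gt0.
have := h d d0; apply/negP; rewrite -ltNge.
apply: le_lt_trans (_ : (`|K| + 1) * d < _).
  rewrite ler_pM2r //; apply: le_trans (ler_norm _) _.
  by rewrite lerDl.
by rewrite /d mulrC divfK ?gt_eqF // gtr_pMr ?invf_lt1 ?ltr1n.
Qed.

(** The inverse is the limit of the geometric sums [s N], for which [(1 - x) * s N] telescopes to
    [1 - x ^+ N]. The constant [c1] enters through the zeroth power in [cnormX]. *)
Lemma neumann x : cnorm x < 1 -> exists y, (1 - x) * y = 1.
Proof.
move=> x1; pose q := cnorm x; have q0 : 0 <= q := cnorm_ge0 x.
pose c1 := cnorm (1 : A).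
pose s N : A := \sum_(k < N) x ^+ k.
have c10 : 0 <= c1 := cnorm_ge0 1.
have sS N : (1 - x) * s N = 1 - x ^+ N.
  elim: N => [|N IH]; first by rewrite /s big_ord0 mulr0 expr0 subrr.
  rewrite /s big_ord_recr mulrDr -/(s N) IH /= mulrBl mul1r -exprS.
  by rewrite addrA subrK.
(* The bound by a finite geometric sum, multiplied through by [1 - q] so that the induction step is
   a ring identity. *)
have diff N d : cnorm (s (N + d)%N - s N) * (1 - q) <= q ^+ N * c1 * (1 - q ^+ d).
  elim: d => [|d IH].
    by rewrite addn0 subrr cnorm0 mul0r expr0 subrr mulr0.
  rewrite addnS {1}/s big_ord_recr /= -/(s (N + d)%N) addrAC.
  apply: le_trans (_ : (cnorm (s (N + d)%N - s N) + q ^+ (N + d) * c1) * (1 - q) <= _).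
    rewrite ler_wpM2r; [by []|by rewrite subr_ge0 ltW|].
    by apply: le_trans (cnormD _ _) _; rewrite lerD2l cnormX.
  rewrite mulrDl; apply: le_trans (lerD IH (lexx _)) _.
  by rewrite exprD exprS le_eqVlt; apply/orP; left; apply/eqP; ring.
have [|l hl] := @cnorm_complete R A s.
- move=> e e0; have [|//||N hN] := @geometric_small R q (e * (1 - q) / 2 / (c1 + 1)).
  + exact: q0.
  + by rewrite !divr_gt0 ?mulr_gt0 ?subr_gt0 // ltr_wpDl.
  exists N => m k Nm Nk.
  have bnd j : (N <= j)%N -> cnorm (s j - s N) * (1 - q) < e * (1 - q) / 2.
    move=> Nj; have := diff N (j - N)%N; rewrite subnKC // => h.
    apply: le_lt_trans h _.
    apply: le_lt_trans (_ : q ^+ N * (c1 + 1) < _).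
      apply: le_trans (_ : q ^+ N * c1 <= _).
        by rewrite ler_piMr ?mulr_ge0 ?exprn_ge0 // gerBl exprn_ge0.
      by rewrite ler_wpM2l ?exprn_ge0 // lerDl.
    by rewrite -ltr_pdivlMr; [exact: hN | rewrite ltr_wpDl].
  have q1 : 0 < 1 - q by rewrite subr_gt0.
  rewrite -(ltr_pM2r q1); apply: le_lt_trans (_ :
    (cnorm (s m - s N) + cnorm (s N - s k)) * (1 - q) < _).
    rewrite ler_wpM2r ?(ltW q1) //.
    by rewrite -[s m - s k](subrKA (s N)) cnormD.
  by rewrite mulrDl [cnorm (s N - _)]cnormBC; have := bnd m Nm; have := bnd k Nk; lra.
exists l; apply/eqP; rewrite -subr_eq0; apply/eqP.
apply: (@limit_eq0 _ (cnorm (1 - x) + c1)) => e e0.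
have [N hN] := hl e e0; have [M hM] := geometric_small q0 x1 e0.
pose k := maxn N M; have := hN k (leq_maxl _ _); have := hM k (leq_maxr _ _).
move=> h1 h2.
have -> : (1 - x) * l - 1 = (1 - x) * (l - s k) - x ^+ k.
  by rewrite mulrBr sS opprB addrA addrAC addrK.
apply: le_trans (cnormD _ _) _; rewrite cnormN [leRHS]mulrDl lerD //.
  by apply: le_trans (cnormM _ _) _; rewrite ler_wpM2l ?cnorm_ge0 // cnormBC ltW.
apply: le_trans (cnormX _ _) _; rewrite mulrC ler_wpM2l //.
exact: ltW.
Qed.

End CstarBasics.

Lemma lift0_1 : lift ord0 ord0 = 1 :> 'I_2. Proof. exact: val_inj. Qed.

Lemma lift1_0 : lift 1 ord0 = 0 :> 'I_2. Proof. exact: val_inj. Qed.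

Lemma mxtrace2 (F : nmodType) (h : 'M[F]_2) : \tr h = h 0 0 + h 1 1.
Proof. by rewrite /mxtrace big_ord_recl big_ord1 lift0_1. Qed.

Lemma det_mx22 (F : comNzRingType) (h : 'M[F]_2) :
  \det h = h 0 0 * h 1 1 - h 0 1 * h 1 0.
Proof.
rewrite (expand_det_row _ 0) big_ord_recl big_ord1 /cofactor !det_mx11 !mxE.
by rewrite /= lift0_1 lift1_0 expr0 expr1 mul1r mulN1r mulrN.
Qed.

(** The quadratic formula gives two roots of the characteristic polynomial; their sum is the trace,
    so they do not both vanish. *)
Lemma nonzero_eigenvalue2 (F : numClosedFieldType) (h : 'M[F]_2) :
  \tr h != 0 -> exists2 l, l != 0 & \det (l%:M - h) = 0.
Proof.
move=> t0; pose t := \tr h; pose d := \det h; pose s := sqrtC (t ^+ 2 - 4 * d).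
have sE : s ^+ 2 = t ^+ 2 - 4 * d by rewrite sqrtCK.
have two0 : (2 : F) != 0 by rewrite pnatr_eq0.
have tE : t = h 0 0 + h 1 1 by exact: mxtrace2.
have dE : d = h 0 0 * h 1 1 - h 0 1 * h 1 0 by exact: det_mx22.
have rt l : 2 * l = t + s \/ 2 * l = t - s -> \det (l%:M - h) = 0.
  move=> hl; rewrite det_mx22 !mxE /= mulr1n mulr0n !sub0r.
  have : (2 * l - t) ^+ 2 = s ^+ 2.
    by case: hl => ->; rewrite addrAC ?addrK ?subrr ?add0r ?sqrrN // addrAC subrr add0r.
  rewrite sE dE tE => hh.
  apply: (mulfI two0); apply: (mulfI two0); rewrite !mulr0.
  by move/eqP: hh; rewrite -subr_eq0 => /eqP <-; ring.
have [l10|l10] := eqVneq (t + s) 0; last first.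
  exists ((t + s) / 2); first by rewrite mulf_neq0 ?invr_eq0.
  by apply: rt; left; rewrite mulrC divfK.
exists ((t - s) / 2); last by apply: rt; right; rewrite mulrC divfK.
rewrite mulf_neq0 ?invr_eq0 //; apply: contra t0 => /eqP l20.
have : 2 * t = 0 by rewrite -[RHS]addr0 -{1}l10 -l20; ring.
by move/eqP; rewrite mulf_eq0 (negPf two0).
Qed.

Section ClosedKernel.
Variables (R : realType) (A : cstarAlgType R).
Implicit Types x y : A.

(* No continuity of [f] is assumed.  If [y] in the kernel is close to [x], then
   [z = l^-1 star x (x - y)] is small and [f z = l^-1 f (star x x)], so the inverse
   of [1 - z] forbids every nonzero eigenvalue [l] of [f (star x x)]. *)
Lemma lrmorph_closed_kernel (f : {lrmorphism A -> mxC R 1}) :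
  star_preserving f -> closed_ideal (fun x => f x = 0).
Proof.
move=> fs; split.
- exact: raddf0.
- by move=> x y fx fy; rewrite raddfD /= fx fy addr0.
- by move=> a x fx; split; rewrite rmorphM /= fx ?mulr0 ?mul0r.
move=> x clx; apply/eqP/negPn/negP => fx0.
pose h : 'M[R[i]]_2 := f (star x * x).
have [|l l0 dl] := @nonzero_eigenvalue2 _ h.
  (* The trace of [f (star x * x)] is the squared Hilbert-Schmidt norm of [f x], hence nonzero when
     [f x] is. *)
  have -> : \tr h = \sum_i \sum_j `|f x j i| ^+ 2.
    rewrite /h rmorphM /= fs /mxtrace; apply: eq_bigr => i _.
    rewrite mxE; apply: eq_bigr => j _.
    by rewrite !mxE mulrC -sqr_normc.
  apply: contra fx0; rewrite psumr_eq0 => [/allP fx0|i _]; last first.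
    by apply: sumr_ge0 => j _; rewrite exprn_ge0.
  apply/eqP/matrixP => j i; rewrite mxE.
  have /fx0 : i \in index_enum 'I_2 by exact: mem_index_enum.
  rewrite psumr_eq0 => [/allP/(_ j)|k _]; last by rewrite exprn_ge0.
  by rewrite mem_index_enum => /(_ isT); rewrite expf_eq0 normr_eq0 /= => /eqP.
pose K := normc l^-1 * cnorm (star x).
have K0 : 0 <= K by rewrite mulr_ge0 ?normc_ge0 ?cnorm_ge0.
have [|y fy xy] := clx (K + 1)^-1; first by rewrite invr_gt0 ltr_wpDl.
pose z := l^-1 *: (star x * (x - y)).
have [|b zb] := @neumann _ _ z.
  rewrite cnormZ; apply: le_lt_trans (_ : K * cnorm (x - y) < _).
    by rewrite -mulrA ler_wpM2l ?normc_ge0 ?cnormM.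
  apply: le_lt_trans (_ : (K + 1) * cnorm (x - y) < _).
    by rewrite ler_wpM2r ?cnorm_ge0 // lerDl.
  by rewrite -ltr_pdivlMl ?mulr1 // ltr_wpDl.
have fz : f z = l^-1 *: h.
  have fxy : f (star x * y) = 0 by rewrite rmorphM /= fy mulr0.
  have fh : f (star x * (x - y)) = h by rewrite mulrBr raddfB /= fxy subr0.
  by rewrite linearZ /= fh.
have zb2 : (1 - l^-1 *: h : mxC R 1) * f b = 1.
  by rewrite -fz -(rmorph1 f) -rmorphB /= -rmorphM /= zb.
have : (l%:M - h) *m f b = l%:M.
  have -> : l%:M - h = l *: (1%:M - l^-1 *: h).
    by rewrite scalerBr scalerA divff // scale1r scalemx1.
  rewrite -scalemxAl; have -> : (1%:M - l^-1 *: h) *m f b = 1%:M by exact: zb2.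
  by rewrite scalemx1.
move/(congr1 determinant); rewrite det_mulmx dl mul0r det_scalar => /esym/eqP.
by rewrite expf_eq0 (negPf l0).
Qed.
End ClosedKernel.

(** * Quotients and density *)

Section ClosedSubalgebra.
Variables (R : realType) (A : cstarAlgType R) (n : nat) (u : 'M[A]_n).

(** The norm closure of the coordinate algebra. It is made into a C*-algebra of its own so that it
    can serve as a target in the universal property of C(O_n^+). *)
Definition coord_limit (x : A) : Prop :=
  forall e : R, 0 < e -> exists y : coord_alg u, cnorm (x - val y) < e.

Definition coord_limit_pred : {pred A} := [pred x | `[< coord_limit x >]].

Record closed_coord_alg :=
  ClosedCoord { closed_coord_val : A; _ : closed_coord_val \in coord_limit_pred }.
HB.instance Definition _ := [isSub for closed_coord_val].
HB.instance Definition _ := [Choice of closed_coord_alg by <:].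

Lemma coord_limit_coord (y : coord_alg u) : coord_limit (val y).
Proof. by move=> e e0; exists y; rewrite subrr cnorm0. Qed.

Fact coord_limit_closed : GRing.subsemialg_closed coord_limit_pred.
Proof.
split; rewrite ?inE; first by apply/asboolP; exact: (coord_limit_coord 1).
  split; first by apply/asboolP; exact: (coord_limit_coord 0).
  move=> x y /asboolP xP /asboolP yP; apply/asboolP => e e0.
  have [|x' hx] := xP (e / 2); first by lra.
  have [|y' hy] := yP (e / 2); first by lra.
  exists (x' + y'); have -> : val (x' + y') = val x' + val y' by [].
  rewrite opprD addrACA.
  by apply: le_lt_trans (cnormD _ _) _; lra.
- move=> c x /asboolP xP; apply/asboolP => e e0.
  have K0 : 0 < normc c + 1 by rewrite ltr_wpDl ?normc_ge0.
  have [|x' hx] := xP (e / (normc c + 1)); first by rewrite divr_gt0.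
  exists (c *: x'); have -> : val (c *: x') = c *: val x' by [].
  rewrite -scalerBr cnormZ.
  apply: le_lt_trans (_ : (normc c + 1) * cnorm (x - val x') < _).
    by rewrite ler_wpM2r ?cnorm_ge0 // lerDl.
  by rewrite mulrC -ltr_pdivlMr.
- move=> x y /asboolP xP /asboolP yP; apply/asboolP => e e0.
  have K0 : 0 < cnorm x + 1 by rewrite ltr_wpDl ?cnorm_ge0.
  (* The approximation [y'] is chosen first, because the precision required of [x'] depends on the
     norm of [y']. *)
  have [|y' hy] := yP (e / 2 / (cnorm x + 1)); first by rewrite !divr_gt0.
  have L0 : 0 < cnorm (val y') + 1 by rewrite ltr_wpDl ?cnorm_ge0.
  have [|x' hx] := xP (e / 2 / (cnorm (val y') + 1)); first by rewrite !divr_gt0.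
  exists (x' * y'); have -> : val (x' * y') = val x' * val y' by [].
  have -> : x * y - val x' * val y' = x * (y - val y') + (x - val x') * val y'.
    by rewrite mulrBr mulrBl addrA subrK.
  apply: le_lt_trans (cnormD _ _) _.
  have h1 : cnorm (x * (y - val y')) < e / 2.
    apply: le_lt_trans (cnormM _ _) _.
    apply: le_lt_trans (_ : (cnorm x + 1) * cnorm (y - val y') < _).
      by rewrite ler_wpM2r ?cnorm_ge0 // lerDl.
    by rewrite mulrC -ltr_pdivlMr.
  have h2 : cnorm ((x - val x') * val y') < e / 2.
    apply: le_lt_trans (cnormM _ _) _.
    apply: le_lt_trans (_ : cnorm (x - val x') * (cnorm (val y') + 1) < _).
      by rewrite ler_wpM2l ?cnorm_ge0 // lerDl.
    by rewrite -ltr_pdivlMr.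
  lra.
Qed.
HB.instance Definition _ := GRing.SubChoice_isSubAlgebra.Build R[i] A
  coord_limit_pred closed_coord_alg coord_limit_closed.

Fact closed_coord_star_subproof (x : closed_coord_alg) :
  star (val x) \in coord_limit_pred.
Proof.
apply/asboolP => e e0; have /asboolP/(_ e e0)[y hy] := valP x.
exists (star y); rewrite /= -starN -starD cnorm_starE.
exact: hy.
Qed.
Definition closed_coord_star (x : closed_coord_alg) : closed_coord_alg :=
  ClosedCoord (closed_coord_star_subproof x).
Fact closed_coord_starK x : closed_coord_star (closed_coord_star x) = x.
Proof. by apply: val_inj; rewrite /= starK. Qed.
Fact closed_coord_starD x y :
  closed_coord_star (x + y) = closed_coord_star x + closed_coord_star y.
Proof. by apply: val_inj; rewrite /= starD. Qed.
Fact closed_coord_starZ (c : R[i]) x :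
  closed_coord_star (c *: x) = c^* *: closed_coord_star x.
Proof. by apply: val_inj; rewrite /= starZ. Qed.
Fact closed_coord_starM x y :
  closed_coord_star (x * y) = closed_coord_star y * closed_coord_star x.
Proof. by apply: val_inj; rewrite /= starM. Qed.
HB.instance Definition _ := hasStar.Build R closed_coord_alg
  closed_coord_starK closed_coord_starD closed_coord_starZ closed_coord_starM.

Definition closed_coord_norm (x : closed_coord_alg) : R := cnorm (val x).
Fact closed_coord_norm0 x : closed_coord_norm x = 0 -> x = 0.
Proof. by move=> /cnorm0_eq0 x0; apply: val_inj. Qed.
Fact closed_coord_normD x y :
  closed_coord_norm (x + y) <= closed_coord_norm x + closed_coord_norm y.
Proof. exact: cnormD. Qed.
Fact closed_coord_normZ (c : R[i]) x :
  closed_coord_norm (c *: x) = normc c * closed_coord_norm x.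
Proof. exact: cnormZ. Qed.
Fact closed_coord_normM x y :
  closed_coord_norm (x * y) <= closed_coord_norm x * closed_coord_norm y.
Proof. exact: cnormM. Qed.
Fact closed_coord_norm_star x :
  closed_coord_norm (star x * x) = closed_coord_norm x ^+ 2.
Proof. exact: cnorm_star. Qed.
Fact closed_coord_complete (s : nat -> closed_coord_alg) :
  (forall e : R, 0 < e -> exists N, forall m k,
     (N <= m)%N -> (N <= k)%N -> closed_coord_norm (s m - s k) < e) ->
  exists l, forall e : R, 0 < e -> exists N, forall k,
     (N <= k)%N -> closed_coord_norm (s k - l) < e.
Proof.
move=> /(@cnorm_complete R A (fun k => val (s k)))[l hl].
have lP : l \in coord_limit_pred.
  apply/asboolP => e e0; have [|N hN] := hl (e / 2); first by lra.
  have [|y hy] := asboolP _ (valP (s N)) (e / 2); first by lra.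
  exists y; rewrite -[l - _](subrKA (val (s N))).
  apply: le_lt_trans (cnormD _ _) _.
  by have := hN N (leqnn _); rewrite cnormBC => h; lra.
by exists (ClosedCoord lP).
Qed.
HB.instance Definition _ := isCstar.Build R closed_coord_alg
  closed_coord_norm0 closed_coord_normD closed_coord_normZ closed_coord_normM
  closed_coord_norm_star closed_coord_complete.

End ClosedSubalgebra.

Lemma lrmorphism_of (K : pzRingType) (A B : lalgType K) (g : A -> B) :
  linear g -> monoid_morphism g -> exists f : {lrmorphism A -> B}, f =1 g.
Proof.
move=> gl gm.
pose gL := GRing.isLinear.Build _ _ _ _ g gl.
pose gM := GRing.isMonoidMorphism.Build _ _ g gm.
pose f : {lrmorphism A -> B} := HB.pack g gL gM.
by exists f.
Qed.

Section Density.
Variables (R : realType) (P A : cstarAlgType R) (n : nat).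
Variables (v : 'M[P]_n) (u : 'M[A]_n).

Lemma orthogonal_coords_map (p : {lrmorphism P -> A}) :
  star_preserving p -> (forall i j, p (v i j) = u i j) ->
  orthogonal_coords v -> orthogonal_coords u.
Proof.
move=> ps pu [sv v1 v2]; split.
- by move=> i j; rewrite -pu -ps sv.
- apply/matrixP => i j; have /matrixP/(_ i j)/(congr1 p) := v1.
  rewrite !mxE rmorph_sum rmorph_nat => <-; apply: eq_bigr => k _.
  by rewrite rmorphM /= !mxE !pu.
- apply/matrixP => i j; have /matrixP/(_ i j)/(congr1 p) := v2.
  rewrite !mxE rmorph_sum rmorph_nat => <-; apply: eq_bigr => k _.
  by rewrite rmorphM /= !mxE !pu.
Qed.

(* The universal morphism to the closure of the coordinates agrees with [p]
   by uniqueness, so that no continuity of [p] is needed. *)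
Lemma coord_alg_dense (p : {lrmorphism P -> A}) : is_free_orthogonal v ->
  star_preserving p -> surjective p -> (forall i j, p (v i j) = u i j) ->
  forall (x : A) (e : R), 0 < e ->
    exists y : coord_alg u, cnorm (x - val y) < e.
Proof.
move=> [ov univ] ps psurj pu x e e0.
have ou := orthogonal_coords_map ps pu ov.
have [su u1 u2] := ou.
have uP i j : u i j \in coord_limit_pred u.
  by apply/asboolP; exact: (coord_limit_coord (coord u i j)).
pose w : 'M[closed_coord_alg u]_n := \matrix_(i, j) ClosedCoord (uP i j).
have vsum (I : finType) (F : I -> closed_coord_alg u) :
  val (\sum_i F i) = \sum_i val (F i) by exact: raddf_sum.
have ow : orthogonal_coords w.
  split; first by move=> i j; apply: val_inj; rewrite !mxE /= su.
    apply/matrixP => i j; apply: val_inj; have /matrixP/(_ i j) := u1.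
    rewrite !mxE vsum rmorph_nat => <-; apply: eq_bigr => k _.
    by rewrite rmorphM /= !mxE.
  apply/matrixP => i j; apply: val_inj; have /matrixP/(_ i j) := u2.
  rewrite !mxE vsum rmorph_nat => <-; apply: eq_bigr => k _.
  by rewrite rmorphM /= !mxE.
have [f [fs fw] _] := univ _ w ow.
have [g _ guniq] := univ _ u ou.
have [||h hE] := @lrmorphism_of _ P A (val \o f).
- by move=> c y z; rewrite /= linearP.
- by split=> [|y z]; rewrite /= ?rmorph1 ?rmorphM.
have hs : star_preserving h by move=> y; rewrite !hE /= fs.
have hu i j : h (v i j) = u i j by rewrite hE /= fw mxE.
have [y <-] := psurj x; rewrite (guniq p ps pu) -(guniq h hs hu) hE.
by have /asboolP/(_ e e0) := valP (f y).
Qed.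

End Density.

Section Factor.
Variables (R : realType) (A B : cstarAlgType R) (n : nat).
Variables (u : 'M[A]_n) (v : 'M[B]_n) (X : A -> Prop).

(** The factor is computed on an arbitrary lift. Two lifts differ by an element of the closed ideal
    generated by [X], and the kernel of [f] is a closed ideal containing [X]. *)
Lemma quotient_factor (f : {lrmorphism A -> mxC R 1}) :
  is_quotient u v X -> star_preserving f -> (forall x, X x -> f x = 0) ->
  exists2 g : {lrmorphism B -> mxC R 1}, star_preserving g &
    forall i j, g (v i j) = f (u i j).
Proof.
move=> [p [ps psurj pu pker]] fs fX.
pose g y := f (projT1 (cid (psurj y))).
have gp x : g (p x) = f x.
  rewrite /g; case: cid => x' /= px'; apply/eqP; rewrite -subr_eq0 -raddfB.
  apply/eqP; apply: (pker _).1 (lrmorph_closed_kernel fs) fX.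
  by rewrite raddfB /= px' subrr.
have [||g' gg] := @lrmorphism_of _ B (mxC R 1) g.
- move=> c y1 y2; have [x1 <-] := psurj y1; have [x2 <-] := psurj y2.
  by rewrite -linearP !gp linearP.
- split; first by rewrite -(rmorph1 p) gp; exact: rmorph1.
  move=> y1 y2; have [x1 <-] := psurj y1; have [x2 <-] := psurj y2.
  by rewrite -rmorphM !gp; exact: rmorphM.
exists g' => [y|i j]; last by rewrite gg -pu gp.
by have [x <-] := psurj y; rewrite !gg -ps !gp fs.
Qed.

End Factor.

(** * Models by two-by-two matrices *)

Section Models.
Variable R : realType.

Definition conj_if (b : bool) (z : R[i]) : R[i] := if b then z^* else z.

Lemma conj_ifM b : {morph conj_if b : x y / x * y}.
Proof. by case: b => x y //=; rewrite rmorphM. Qed.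

Lemma conj_if_sum b (I : Type) (r : seq I) (Q : pred I) (F : I -> R[i]) :
  conj_if b (\sum_(i <- r | Q i) F i) = \sum_(i <- r | Q i) conj_if b (F i).
Proof. by case: b => //; exact: rmorph_sum. Qed.

Lemma conj_if_conj b z : conj_if b z^* = (conj_if b z)^*.
Proof. by case: b. Qed.

Lemma conj_if_nat b (k : nat) : conj_if b k%:R = k%:R.
Proof. by case: b => //; exact: conjc_nat. Qed.

(* The monomials of the half-liberated coordinates, evaluated at the point
   of the model with parameter U: the conjugates sit at the even places. *)
Definition alt n (U : 'M[R[i]]_n) k (i j : multi_index n k) : R[i] :=
  \prod_(a < k) conj_if (odd a) (U (i a) (j a)).

Definition unitary n (U : 'M[R[i]]_n) : Prop := U *m (map_mx conjc U)^T = 1%:M.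

Definition diag2 (z : R[i]) : mxC R 1 :=
  \matrix_(r, s) if r == s then conj_if (r == 1) z else 0.
Definition antidiag2 (z : R[i]) : mxC R 1 :=
  \matrix_(r, s) if r == s then 0 else conj_if (r == 1) z.

Lemma ord2P (r : 'I_2) : r = 0 \/ r = 1.
Proof. by case: r => [[|[|//]] hr]; [left|right]; apply/val_inj. Qed.

Lemma mxC2P (x y : mxC R 1) : x 0 0 = y 0 0 -> x 0 1 = y 0 1 ->
  x 1 0 = y 1 0 -> x 1 1 = y 1 1 -> x = y.
Proof.
move=> h00 h01 h10 h11; apply/matrixP => r s.
by case: (ord2P r) => ->; case: (ord2P s) => ->.
Qed.

Lemma mxC2M (x y : mxC R 1) r s : (x * y) r s = x r 0 * y 0 s + x r 1 * y 1 s.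
Proof. by rewrite mxE big_ord_recl big_ord1 lift0_1. Qed.

Lemma diag2E z : (diag2 z 0 0 = z) * (diag2 z 0 1 = 0) *
  (diag2 z 1 0 = 0) * (diag2 z 1 1 = z^*).
Proof. by rewrite !mxE. Qed.

Lemma antidiag2E z : (antidiag2 z 0 0 = 0) * (antidiag2 z 0 1 = z) *
  (antidiag2 z 1 0 = z^*) * (antidiag2 z 1 1 = 0).
Proof. by rewrite !mxE. Qed.

Let simp2 := (mxC2M, diag2E, antidiag2E, mulr0, mul0r, addr0, add0r).

Lemma antidiag2M z w : antidiag2 z * antidiag2 w = diag2 (z * w^*).
Proof. by apply: mxC2P; rewrite !simp2 // rmorphM /= conjcK. Qed.

Lemma diag2_antidiag2 z w : diag2 z * antidiag2 w = antidiag2 (z * w).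
Proof. by apply: mxC2P; rewrite !simp2 // rmorphM. Qed.

Lemma diag2_is_additive : {morph diag2 : x y / x + y}.
Proof.
by move=> x y; apply: mxC2P; rewrite ?[(diag2 _ + diag2 _) _ _]mxE !simp2 // rmorphD.
Qed.

Lemma diag2_1 : diag2 1 = 1.
Proof.
have -> : (1 : mxC R 1) = 1%:M by [].
by apply: mxC2P; rewrite !simp2 mxE ?conjc1.
Qed.

Lemma diag2_0 : diag2 0 = 0.
Proof. by apply: mxC2P; rewrite !simp2 mxE ?conjc0. Qed.

Lemma star_antidiag2 z : star (antidiag2 z) = antidiag2 z.
Proof.
by apply: mxC2P; rewrite [LHS]mxE [LHS]mxE !simp2 ?conjc0 ?conjcK.
Qed.

(** Reads [z] off both [diag2 z] and [antidiag2 z], so that one linear functional serves monomials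
    of even and of odd length. *)
Definition row_sum2 (x : mxC R 1) : R[i]^o := x 0 0 + x 0 1.
Fact row_sum2_linear : linear row_sum2.
Proof. by move=> c x y; rewrite /row_sum2 !mxE scalerDr addrACA. Qed.
HB.instance Definition _ := GRing.isLinear.Build R[i] (mxC R 1) R[i]^o *:%R
  row_sum2 row_sum2_linear.

Lemma prod_antidiag2 k (z : 'I_k -> R[i]) :
  \prod_(a < k) antidiag2 (z a) =
  (if odd k then antidiag2 else diag2) (\prod_(a < k) conj_if (odd a) (z a)).
Proof.
elim: k z => [|k IH] z; first by rewrite !big_ord0 /= diag2_1.
rewrite !big_ord_recr /= IH.
by case: (odd k); rewrite /= ?antidiag2M ?diag2_antidiag2.
Qed.

Lemma row_sum2_diag2 z : row_sum2 (diag2 z) = z.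
Proof. by rewrite /row_sum2 !simp2. Qed.

Lemma row_sum2_antidiag2 z : row_sum2 (antidiag2 z) = z.
Proof. by rewrite /row_sum2 !simp2. Qed.

(** Only linearity is asked of [chi]: after a factor of odd length the conjugations are exchanged,
    so [alt] is not multiplicative under concatenation of words. *)
Definition has_character (A : cstarAlgType R) n (u : 'M[A]_n) (U : 'M[R[i]]_n) :=
  exists chi : {linear A -> R[i]^o},
    forall k (i j : multi_index n k), chi (tensor_power u i j) = alt U i j.

Lemma character_of_morphism (A : cstarAlgType R) n (u : 'M[A]_n) (U : 'M[R[i]]_n)
    (f : {lrmorphism A -> mxC R 1}) :
  (forall i j, f (u i j) = antidiag2 (U i j)) -> has_character u U.
Proof.
move=> fu; exists (row_sum2 \o f : {linear A -> R[i]^o}) => k i j /=.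
rewrite /tensor_power rmorph_prod /=; under eq_bigr do rewrite fu.
by rewrite prod_antidiag2; case: (odd k); rewrite ?row_sum2_diag2 ?row_sum2_antidiag2.
Qed.

Lemma unitary_sym n (U : 'M[R[i]]_n) : unitary U -> (map_mx conjc U)^T *m U = 1%:M.
Proof. exact: mulmx1C. Qed.

(** The entries of [w *m w^T] are [diag2] of those of [U *m U^H], and the entries of [w^T *m w] are
    [diag2] of those of [U^H *m U] with the indices exchanged. So unitarity of [U] is orthogonality
    of [w]. *)
Lemma free_orthogonal_model (A : cstarAlgType R) n (v : 'M[A]_n) (U : 'M[R[i]]_n) :
  is_free_orthogonal v -> unitary U ->
  exists2 f : {lrmorphism A -> mxC R 1}, star_preserving f &
    forall i j, f (v i j) = antidiag2 (U i j).
Proof.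
move=> [_ univ] hU; pose w : 'M[mxC R 1]_n := \matrix_(i, j) antidiag2 (U i j).
have [|f [fs fw] _] := univ _ w.
  have sumd (I : finType) (F : I -> R[i]) :
      diag2 (\sum_i F i) = \sum_i diag2 (F i).
    by apply: (big_morph diag2 diag2_is_additive diag2_0).
  split; first by move=> i j; rewrite mxE star_antidiag2.
    apply/matrixP => i j; rewrite !mxE; under eq_bigr do rewrite !mxE antidiag2M.
    rewrite -sumd; have /matrixP/(_ i j) := hU; rewrite !mxE.
    under eq_bigr do rewrite !mxE; move=> ->.
    by case: (i == j); rewrite /= ?diag2_1 ?diag2_0.
  apply/matrixP => i j; rewrite !mxE; under eq_bigr do rewrite !mxE antidiag2M.
  rewrite -sumd; have /matrixP/(_ j i) := unitary_sym hU; rewrite !mxE.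
  under eq_bigr do rewrite !mxE mulrC; move=> ->.
  by rewrite eq_sym; case: (i == j); rewrite /= ?diag2_1 ?diag2_0.
by exists f => // i j; rewrite fw mxE.
Qed.

(** A triple product is [antidiag2 (x * y^* * z)], in which [x] and [z] can be exchanged. *)
Lemma half_commutators_model (A : cstarAlgType R) n (v : 'M[A]_n) (U : 'M[R[i]]_n)
    (f : {lrmorphism A -> mxC R 1}) :
  (forall i j, f (v i j) = antidiag2 (U i j)) ->
  forall x, half_commutators v x -> f x = 0.
Proof.
move=> fv x [a [b [c [[i [j ->]] [k [l ->]] [s [t ->]] ->]]]].
rewrite raddfB /= !rmorphM /= !fv !antidiag2M !diag2_antidiag2.
by apply/eqP; rewrite subr_eq0; apply/eqP; congr antidiag2; rewrite mulrC mulrA mulrAC.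
Qed.

Definition monomial n (U : 'M[R[i]]_n) : Prop :=
  forall i j k, j != k -> U i j * U i k = 0 /\ U j i * U k i = 0.

(** The product of two entries is [diag2 (z * w^* )], and [z * w^*] vanishes together with
    [z * w]. *)
Lemma cubic_relators_model (A : cstarAlgType R) n (v : 'M[A]_n) (U : 'M[R[i]]_n)
    (f : {lrmorphism A -> mxC R 1}) : monomial U ->
  (forall i j, f (v i j) = antidiag2 (U i j)) ->
  forall x, cubic_relators v x -> f x = 0.
Proof.
have m0 (z w : R[i]) : z * w = 0 -> z * w^* = 0.
  by move/eqP; rewrite mulf_eq0 -[w == 0]conjc_eq0 -mulf_eq0 => /eqP.
move=> mU fv x [i [j [k [jk [->|->]]]]]; rewrite rmorphM /= !fv antidiag2M m0 ?diag2_0 //.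
  exact: (mU _ _ _ jk).1.
exact: (mU _ _ _ jk).2.
Qed.

End Models.

(** * Characters and Tannaka-Krein duality *)

Section Projector.
Variable R : realType.
Local Notation C := R[i].

Lemma adjmxM m n p (M : 'M[C]_(m, n)) (N : 'M[C]_(n, p)) :
  (M *m N)^H = N^H *m M^H.
Proof. by rewrite map_mxM trmx_mul. Qed.

Lemma adjmxK m n (M : 'M[C]_(m, n)) : (M^H)^H = M.
Proof. by apply/matrixP => i j; rewrite !mxE conjcK. Qed.

Lemma mul_adjmx_eq0 n (v : 'rV[C]_n) : v *m v^H = 0 -> v = 0.
Proof.
move=> /matrixP/(_ 0 0); rewrite !mxE => vv; apply/rowP => i; rewrite mxE.
move: vv; under eq_bigr do rewrite !mxE -sqr_normc.
move/eqP; rewrite psumr_eq0 => [|j _]; last by rewrite exprn_ge0.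
move/allP/(_ i); rewrite mem_index_enum => /(_ isT).
by rewrite expf_eq0 normr_eq0 /= => /eqP.
Qed.

(** [Pi] is the orthogonal projection onto the span of a possibly infinite set of row vectors, in
    the form [B0^H (B0 B0^H)^-1 B0] for a basis [B0] of the span. The last clause says that whatever
    annihilates [S] annihilates [Pi]. *)
Lemma hermitian_projector_mx N (S : 'rV[C]_N -> Prop) :
  exists Pi : 'M[C]_N, [/\ Pi^H = Pi, forall s, S s -> s *m Pi = s &
    forall L : 'M[C]_N, (forall s, S s -> S (s *m L)) ->
      (forall s, S s -> S (s *m L^H)) -> Pi *m L = L *m Pi] /\
    forall c : 'cV[C]_N, (forall s, S s -> s *m c = 0) -> Pi *m c = 0.
Proof.
(* The span is the row space of a matrix of maximal rank among those killed by the annihilator of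
   [S]: a vector of [S] outside it could be added and would raise the rank. *)
pose Q r := `[< exists2 B : 'M[C]_N, \rank B = r &
  forall c : 'cV[C]_N, (forall s, S s -> s *m c = 0) -> B *m c = 0 >].
have Q0 : exists r, Q r.
  by exists 0; apply/asboolP; exists 0; rewrite ?mxrank0 // => c _; rewrite mul0mx.
have Qb r : Q r -> (r <= N)%N by move=> /asboolP[B <- _]; exact: rank_leq_row.
case: (ex_maxnP Q0 Qb) => r /asboolP[B Br BQ] rmax.
have SB s : S s -> (s <= B)%MS.
  move=> Ss; have : (\rank (B + s)%MS <= r)%N.
    apply: rmax; apply/asboolP; exists (B + s)%MS => // c hc.
    apply/sub_kermxP; rewrite addsmx_sub.
    by apply/andP; split; apply/sub_kermxP; [exact: BQ|exact: hc].
  rewrite -Br => h; apply: submx_trans (addsmxSr B s) _.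
  by rewrite -(geq_leqif (mxrank_leqif_sup (addsmxSl B s))).
have [B0 B0f B0B] : exists2 B0 : 'M_(\rank B, N), row_free B0 & (B0 :=: B)%MS.
  by exists (row_base B); [exact: row_base_free|exact: eq_row_base].
pose M := B0 *m B0^H.
have Mu : M \in unitmx.
  rewrite -row_free_unit; apply: inj_row_free => v vM.
  apply: (row_free_inj B0f); rewrite mul0mx.
  by apply: mul_adjmx_eq0; rewrite adjmxM mulmxA -(mulmxA v) -/M vM mul0mx.
pose Pi := B0^H *m invmx M *m B0; exists Pi.
have Pih : Pi^H = Pi.
  rewrite !adjmxM adjmxK mulmxA map_invmx trmx_inv.
  by suff -> : M^H = M by []; rewrite adjmxM adjmxK.
have Pis s : S s -> s *m Pi = s.
  move=> /SB; rewrite -B0B => /submxP[x ->].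
  by rewrite !mulmxA -[x *m _ *m _]mulmxA mulmxK.
have Pic (c : 'cV[C]_N) : (forall s, S s -> s *m c = 0) -> Pi *m c = 0.
  move=> hc; rewrite -(mulmxA _ B0 c).
  suff -> : B0 *m c = 0 by rewrite mulmx0.
  have /submxP[x ->] : (B0 <= B)%MS by rewrite B0B.
  by rewrite -mulmxA BQ // mulmx0.
clearbody Pi.
(* If [s] is in [S], then [s *m L] is in [S] and fixed by [Pi]; so the columns of [L *m Pi - L] are
   annihilated by [S], hence by [Pi]. *)
have PiL L : (forall s, S s -> S (s *m L)) -> Pi *m L *m Pi = Pi *m L.
  move=> SL; apply/eqP; rewrite -subr_eq0 -mulmxA -mulmxBr; apply/eqP/matrixP => i j.
  have /Pic/colP/(_ i) : forall s, S s -> s *m col j (L *m Pi - L) = 0.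
    by move=> s Ss; rewrite colE mulmxA mulmxBr mulmxA Pis ?subrr ?mul0mx //; exact: SL.
  by rewrite colE mulmxA -colE !mxE.
split=> //; split=> // L SL SLH.
(* The adjoint of the same identity for [L^H] is [Pi *m L *m Pi = L *m Pi], so both sides equal
   [Pi *m L *m Pi]. *)
rewrite -[LHS]PiL // -[RHS]adjmxK adjmxM Pih -(PiL _ SLH) !adjmxM Pih adjmxK.
by rewrite mulmxA.
Qed.

Lemma hermitian_projector (W : finType) (S : (W -> C) -> Prop) :
  exists Pi : W -> W -> C, [/\ forall w w', Pi w' w = (Pi w w')^*,
    forall s, S s -> forall w', \sum_w s w * Pi w w' = s w',
    forall L : W -> W -> C,
      (forall s, S s -> S (fun y => \sum_x s x * L x y)) ->
      (forall s, S s -> S (fun y => \sum_x s x * (L y x)^*)) ->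
      forall x y, \sum_z Pi x z * L z y = \sum_z L x z * Pi z y &
    forall c : W -> C, (forall s, S s -> \sum_w s w * c w = 0) ->
      forall w, \sum_w' Pi w w' * c w' = 0].
Proof.
pose S' (v : 'rV[C]_#|W|) := exists2 s, S s & forall w, v 0 (enum_rank w) = s w.
have sumW (F : 'I_#|W| -> C) : \sum_i F i = \sum_(w : W) F (enum_rank w).
  by rewrite (reindex (@enum_rank W)) //=; exists enum_val => ? _; rewrite ?enum_rankK ?enum_valK.
have [Pi [[Ph Pf PL] Pa]] := hermitian_projector_mx S'.
exists (fun w w' => Pi (enum_rank w) (enum_rank w')); split.
- by move=> w w'; rewrite -{1}Ph !mxE.
- move=> s Ss w'; pose v : 'rV[C]_#|W| := \row_i s (enum_val i).
  have /Pf/rowP/(_ (enum_rank w')) : S' v.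
    by exists s => // w; rewrite mxE enum_rankK.
  rewrite !mxE enum_rankK sumW => h; rewrite -[RHS]h; apply: eq_bigr => w _.
  by rewrite mxE enum_rankK.
- move=> L SL SLH x y.
  pose L' : 'M[C]_#|W| := \matrix_(i, j) L (enum_val i) (enum_val j).
  have S'P (L1 : 'M[C]_#|W|) (l1 : W -> W -> C) :
      (forall x z, L1 (enum_rank x) (enum_rank z) = l1 x z) ->
      (forall s, S s -> S (fun y => \sum_x s x * l1 x y)) ->
      forall v, S' v -> S' (v *m L1).
    move=> Ll Sl v [s Ss vs]; exists (fun y => \sum_x s x * l1 x y); first exact: Sl.
    by move=> w; rewrite mxE sumW; apply: eq_bigr => z _; rewrite vs Ll.
  have /matrixP/(_ (enum_rank x) (enum_rank y)) : Pi *m L' = L' *m Pi.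
    apply: PL; first by apply: (S'P _ L) => // z w; rewrite mxE !enum_rankK.
    by apply: (S'P _ (fun x y => (L y x)^*)) => // z w; rewrite !mxE !enum_rankK.
  have L'E z w : L' (enum_rank z) (enum_rank w) = L z w by rewrite mxE !enum_rankK.
  rewrite !mxE !sumW; under eq_bigr do rewrite L'E.
  by under [X in _ = X -> _]eq_bigr do rewrite L'E.
- move=> c hc w; pose c' : 'cV[C]_#|W| := \col_i c (enum_val i).
  have /Pa/colP/(_ (enum_rank w)) : forall s, S' s -> s *m c' = 0.
    move=> v [s Ss vs]; apply/colP => i; rewrite ord1 !mxE sumW -[RHS](hc s Ss).
    by apply: eq_bigr => w' _; rewrite vs mxE enum_rankK.
  rewrite !mxE sumW => h; rewrite -[RHS]h; apply: eq_bigr => w' _.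
  by rewrite mxE enum_rankK.
Qed.

End Projector.

(** * Noncommutative polynomials and maps out of the coordinate algebra *)

Section Words.
Variables (R : realType) (n : nat).
Local Notation C := R[i].

(* A noncommutative polynomial in the coordinates, as a list of monomials. *)
Definition word := seq ('I_n * 'I_n).
Definition ncpoly := seq (C * word).

Definition ncneg (s : ncpoly) : ncpoly := [seq (- cw.1, cw.2) | cw <- s].
Definition ncscale (c : C) (s : ncpoly) : ncpoly := [seq (c * cw.1, cw.2) | cw <- s].
Definition ncmul (s t : ncpoly) : ncpoly :=
  [seq (a.1 * b.1, a.2 ++ b.2) | a <- s, b <- t].

(** The multiplication is a parameter because the antipode evaluates words in the opposite
    algebra. *)
Definition word_eval (B : Type) (mul : B -> B -> B) (one : B)
  (w : 'I_n -> 'I_n -> B) (s : word) : B := foldr (fun p => mul (w p.1 p.2)) one s.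

Section Eval.
Variables (B : lmodType C) (mul : B -> B -> B) (one : B).
Variable w : 'I_n -> 'I_n -> B.

Local Notation word_eval := (word_eval mul one w).
Definition nceval (s : ncpoly) : B := \sum_(cw <- s) cw.1 *: word_eval cw.2.

Hypotheses (mulA : associative mul) (mul1 : left_id one mul).
Hypothesis mulPl : forall (c : C) x y z, mul (c *: x + y) z = c *: mul x z + mul y z.
Hypothesis mulPr : forall (c : C) x y z, mul z (c *: x + y) = c *: mul z x + mul z y.

Lemma word_eval_cat s t : word_eval (s ++ t) = mul (word_eval s) (word_eval t).
Proof. by elim: s => [|p s IH] /=; rewrite ?mul1 // IH mulA. Qed.

Lemma nceval_nil : nceval [::] = 0. Proof. exact: big_nil. Qed.

Lemma nceval_cons cw s : nceval (cw :: s) = cw.1 *: word_eval cw.2 + nceval s.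
Proof. exact: big_cons. Qed.

Lemma nceval_cat s t : nceval (s ++ t) = nceval s + nceval t.
Proof. exact: big_cat. Qed.

Lemma nceval_scale c s : nceval (ncscale c s) = c *: nceval s.
Proof.
rewrite /nceval big_map scaler_sumr; apply: eq_bigr => cw _.
by rewrite scalerA.
Qed.

Lemma nceval_neg s : nceval (ncneg s) = - nceval s.
Proof.
rewrite /nceval big_map -sumrN; apply: eq_bigr => cw _.
by rewrite scaleNr.
Qed.

Lemma mul_bilinear0l z : mul 0 z = 0.
Proof.
have := mulPl 1 0 0 z; rewrite !scale1r addr0 => h.
by apply: (@addrI _ (mul 0 z)); rewrite addr0.
Qed.

Lemma mul_bilinear0r z : mul z 0 = 0.
Proof.
have := mulPr 1 0 0 z; rewrite !scale1r addr0 => h.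
by apply: (@addrI _ (mul z 0)); rewrite addr0.
Qed.

Lemma nceval_mul s t : nceval (ncmul s t) = mul (nceval s) (nceval t).
Proof.
elim: s => [|a s IH]; first by rewrite /ncmul /= nceval_nil mul_bilinear0l.
rewrite /ncmul /= nceval_cat -/(ncmul s t) IH nceval_cons mulPl; congr (_ + _).
elim: t {IH} => [|b t IHt] /=; first by rewrite nceval_nil mul_bilinear0r scaler0.
rewrite !nceval_cons IHt mulPr word_eval_cat scalerDr /= !scalerA.
by [].
Qed.

End Eval.

Lemma word_eval_map (B B' : Type) (h : B -> B') mul one mul' one'
    (w : 'I_n -> 'I_n -> B) (w' : 'I_n -> 'I_n -> B') (s : word) :
  h one = one' -> (forall x y, h (mul x y) = mul' (h x) (h y)) ->
  (forall i j, h (w i j) = w' i j) ->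
  h (word_eval mul one w s) = word_eval mul' one' w' s.
Proof. by move=> h1 hM hw; elim: s => [|p s IH] //=; rewrite hM hw IH. Qed.

Lemma nceval_map (B B' : lmodType C) (h : B -> B') mul one mul' one'
    (w : 'I_n -> 'I_n -> B) (w' : 'I_n -> 'I_n -> B') (s : ncpoly) :
  linear h -> h one = one' -> (forall x y, h (mul x y) = mul' (h x) (h y)) ->
  (forall i j, h (w i j) = w' i j) ->
  h (nceval mul one w s) = nceval mul' one' w' s.
Proof.
move=> hl h1 hM hw; elim: s => [|cw s IH].
  rewrite !nceval_nil; apply: (@addrI _ (h 0)).
  by rewrite addr0 -[X in X + _]scale1r -hl scaler0 addr0.
by rewrite !nceval_cons hl IH (word_eval_map _ h1 hM hw).
Qed.

Section CoordRep.
Variables (A : starAlgType R) (u : 'M[A]_n).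
Local Notation eval := (nceval *%R 1 u).
Let mulPl (c : C) (x y z : A) : (c *: x + y) * z = c *: (x * z) + y * z.
Proof. by rewrite mulrDl scalerAl. Qed.
Let mulPr (c : C) (x y z : A) : z * (c *: x + y) = c *: (z * x) + z * y.
Proof. by rewrite mulrDr scalerAr. Qed.

Lemma star1 : star (1 : A) = 1.
Proof. by rewrite -[LHS]mulr1 -[X in _ * X]starK -starM mulr1 starK. Qed.

Lemma star_word (s : word) : (forall i j, star (u i j) = u i j) ->
  star (word_eval *%R 1 u s) = word_eval *%R 1 u (rev s).
Proof.
move=> su; elim: s => [|p s IH] /=; first exact: star1.
rewrite starM IH rev_cons -cats1 word_eval_cat; [|exact: mulrA|exact: mul1r].
by rewrite su /= mulr1.
Qed.

Lemma coord_generated_nceval (x : A) : (forall i j, star (u i j) = u i j) ->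
  coord_generated u x -> exists s, x = eval s.
Proof.
move=> su; elim=> [i j||c y _ [s ->]|y z _ [s ->] _ [t ->]|y z _ [s ->] _ [t ->]|y _ [s ->]].
- by exists [:: (1, [:: (i, j)])]; rewrite nceval_cons nceval_nil /= scale1r mulr1 addr0.
- by exists [:: (1, [::])]; rewrite nceval_cons nceval_nil /= scale1r addr0.
- by exists (ncscale c s); rewrite nceval_scale.
- by exists (s ++ t); rewrite nceval_cat.
- by exists (ncmul s t); rewrite nceval_mul //; [exact: mulrA|exact: mul1r].
- exists [seq (cw.1^*, rev cw.2) | cw <- s].
  rewrite /nceval big_map; elim: s => [|cw s IH]; first by rewrite !big_nil star0.
  by rewrite !big_cons starD starZ star_word // IH.
Qed.

End CoordRep.

Section Transfer.
Variables (A : starAlgType R) (u : 'M[A]_n).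
Variables (B : lmodType C) (mul : B -> B -> B) (one : B).
Variable w : 'I_n -> 'I_n -> B.
Hypothesis su : forall i j, star (u i j) = u i j.
Hypotheses (mulA : associative mul) (mul1 : left_id one mul).
Hypothesis mulr1 : right_id one mul.
Hypothesis mulPl : forall (c : C) x y z, mul (c *: x + y) z = c *: mul x z + mul y z.
Hypothesis mulPr : forall (c : C) x y z, mul z (c *: x + y) = c *: mul z x + mul z y.
Hypothesis wd : forall s, nceval *%R 1 u s = 0 -> nceval mul one w s = 0.

(** The coordinate algebra is the free algebra modulo the relations satisfied by [u]. By [wd] these
    also hold for [w], so the value of [g] can be computed from any polynomial representing the
    argument. Counit, antipode, comultiplication and inclusions are all obtained this way. *)
Lemma coord_transfer : exists g : coord_alg u -> B,
  [/\ linear g, g 1 = one, forall x y, g (x * y) = mul (g x) (g y) &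
      forall i j, g (coord u i j) = w i j].
Proof.
have rep (x : coord_alg u) : {s | val x = nceval *%R 1 u s}.
  apply: cid; apply: coord_generated_nceval => //.
  by apply/asboolP; exact: (valP x).
pose g x := nceval mul one w (sval (rep x)).
have gE x s : val x = nceval *%R 1 u s -> g x = nceval mul one w s.
  move=> xs; apply/eqP; rewrite -subr_eq0 -nceval_neg -nceval_cat; apply/eqP.
  apply: wd; rewrite nceval_cat nceval_neg -xs; case: (rep x) => t /= <-.
  exact: subrr.
exists g; split.
- move=> c x y; rewrite (@gE _ (ncscale c (sval (rep x)) ++ sval (rep y))).
    by rewrite nceval_cat nceval_scale.
  rewrite nceval_cat nceval_scale.
  by case: (rep x) => s /= <-; case: (rep y) => t /= <-.
- rewrite (@gE _ [:: (1, [::])]); rewrite nceval_cons nceval_nil /= addr0 scale1r //.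
- move=> x y; rewrite (@gE _ (ncmul (sval (rep x)) (sval (rep y)))) ?nceval_mul //.
  + by case: (rep x) => s /= <-; case: (rep y) => t /= <-.
  + exact: mulrA.
  + exact: mul1r.
  + by move=> *; rewrite mulrDl scalerAl.
  + by move=> *; rewrite mulrDr scalerAr.
- move=> i j; rewrite (@gE _ [:: (1, [:: (i, j)])]).
    by rewrite nceval_cons nceval_nil /= scale1r addr0 mulr1.
  by rewrite nceval_cons nceval_nil /= scale1r addr0 GRing.mulr1.
Qed.

End Transfer.

End Words.

Section Alt.
Variables (R : realType) (n : nat).
Local Notation C := R[i].
Implicit Types U V : 'M[C]_n.

Lemma sum_delta_l (I : finType) (V : lmodType C) (F : I -> V) i :
  \sum_j (i == j)%:R *: F j = F i.
Proof.
rewrite (bigD1 i) //= eqxx scale1r big1 ?addr0 // => j ji.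
by rewrite eq_sym (negPf ji) scale0r.
Qed.

Lemma sum_delta_r (I : finType) (V : lmodType C) (F : I -> V) i :
  \sum_j (j == i)%:R *: F j = F i.
Proof. by under eq_bigr do rewrite eq_sym; exact: sum_delta_l. Qed.

Lemma alt_mul U V k (i j : multi_index n k) :
  alt (U *m V) i j = \sum_h alt U i h * alt V h j.
Proof.
rewrite /alt; under eq_bigr do rewrite mxE conj_if_sum.
rewrite bigA_distr_bigA /=; apply: eq_bigr => h _.
by rewrite -big_split /=; apply: eq_bigr => a _; rewrite conj_ifM.
Qed.

Lemma alt_adj U k (i j : multi_index n k) : alt U^H i j = (alt U j i)^*.
Proof.
by rewrite /alt rmorph_prod /=; apply: eq_bigr => a _; rewrite !mxE conj_if_conj.
Qed.

Lemma prod_delta (I : finType) (T : eqType) (F : comNzRingType) (f g : I -> T) :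
  \prod_i (f i == g i)%:R = [forall i, f i == g i]%:R :> F.
Proof.
case: forallP => [h|/forallP]; first by rewrite big1 // => i _; rewrite h.
rewrite negb_forall => /existsP[i fi].
by rewrite (bigD1 i) //= (negPf fi) mul0r.
Qed.

Lemma forall_eq_ffunE (I : finType) (T : eqType) (f g : {ffun I -> T}) :
  [forall i, f i == g i] = (f == g).
Proof.
apply/forallP/eqP => [h|-> i //].
by apply/ffunP => i; apply/eqP.
Qed.

Lemma alt1 k (i j : multi_index n k) : alt 1%:M i j = (i == j)%:R :> C.
Proof.
rewrite -forall_eq_ffunE -prod_delta; apply: eq_bigr => a _.
by rewrite !mxE conj_if_nat.
Qed.

Lemma altN U k (i j : multi_index n k) : alt (- U) i j = (-1) ^+ k * alt U i j.
Proof.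
have -> : (-1 : C) ^+ k = \prod_(a < k) (-1) by rewrite prodr_const card_ord.
rewrite /alt -big_split; apply: eq_bigr => a _ /=.
by rewrite mxE mulN1r /conj_if; case: odd; rewrite ?rmorphN.
Qed.

Definition alt_intertwines (G : 'M[C]_n -> Prop) k l
    (t : multi_index n l -> multi_index n k -> C) : Prop :=
  forall U, G U -> forall i j,
    \sum_i' t j i' * alt U i' i = \sum_j' alt U j j' * t j' i.

(** [groupM] and [group_adj] make spans of group values stable under translations and their
    adjoints, as [hermitian_projector] requires. [groupN] puts [-1] in the group, which excludes
    intertwiners with [k + l] odd. *)
Record matrix_group (G : 'M[C]_n -> Prop) : Prop := MatrixGroup {
  group_unitary : forall U, G U -> unitary U;
  group1 : G 1%:M;
  groupM : forall U V, G U -> G V -> G (U *m V);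
  group_adj : forall U, G U -> G U^H;
  group_conj : forall U, G U -> G (map_mx conjc U);
  groupN : forall U, G U -> G (- U)
}.

End Alt.

Section Homs.
Variables (R : realType) (n : nat) (A : starAlgType R) (u : 'M[A]_n).
Local Notation C := R[i].
Local Notation tens k := {ffun multi_index n k -> R[i]^o}.

Lemma hom_of_coeffs k l (t : multi_index n l -> multi_index n k -> C) :
  exists T : 'Hom(tens k, tens l), forall i j, T (basis_tensor R i) j = t j i.
Proof.
pose f (x : tens k) : tens l := \sum_i x i *: \sum_j t j i *: basis_tensor R j.
have fl : linear f.
  move=> c x y; rewrite /f scaler_sumr -big_split; apply: eq_bigr => i _ /=.
  by rewrite !ffunE scalerDl scalerA.
pose fL := GRing.isLinear.Build _ _ _ _ f fl.
pose F : {linear tens k -> tens l} := HB.pack f fL.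
exists (linfun F) => i j; rewrite lfunE /= /f.
under eq_bigr do rewrite ffunE.
rewrite sum_delta_r sum_ffunE; under eq_bigr do rewrite !ffunE.
rewrite (bigD1 j) //= eqxx [X in _ + X]big1 ?addr0; first exact: mulr1.
by move=> j' /negPf jj; rewrite eq_sym jj; exact: mulr0.
Qed.

Lemma span_intertwines (D : diagram_family) k l (T : 'Hom(tens k, tens l)) :
  (forall p, p \in D k l -> intertwines u (T_ R n p)) ->
  T \in <<[seq T_ R n p | p in D k l]>>%VS -> intertwines u T.
Proof.
move=> hD; set X := [seq _ | _ in _] => /(@coord_span _ _ _ (in_tuple X)) ->.
move=> i j; under eq_bigr do rewrite sum_lfunE sum_ffunE scaler_suml.
under [RHS]eq_bigr do rewrite sum_lfunE sum_ffunE scaler_suml.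
rewrite exchange_big [RHS]exchange_big; apply: eq_bigr => a _ /=.
have /mapP[p pD ->] : X`_a \in X by exact: mem_nth.
have {}pD : p \in D k l by rewrite mem_enum in pD.
under eq_bigr do rewrite scale_lfunE ffunE -scalerA.
under [RHS]eq_bigr do rewrite scale_lfunE ffunE -scalerA.
by rewrite -!scaler_sumr hD.
Qed.

End Homs.

Section WordIndices.
Variables (R : realType) (n : nat).
Local Notation C := R[i].

Definition word_row (w : word n) : multi_index n (size w) :=
  [ffun a => (tnth (in_tuple w) a).1].
Definition word_col (w : word n) : multi_index n (size w) :=
  [ffun a => (tnth (in_tuple w) a).2].

Lemma word_eval_prod (B : pzRingType) (v : 'I_n -> 'I_n -> B) (w : word n) :
  word_eval *%R 1 v w = \prod_(a < size w) v (word_row w a) (word_col w a).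
Proof.
transitivity (\prod_(p <- w) v p.1 p.2).
  by elim: w => [|p w IH]; rewrite ?big_nil ?big_cons //= IH.
rewrite big_tnth.
by apply: eq_bigr => a _; rewrite !ffunE.
Qed.

Definition alt_word (U : 'M[C]_n) (w : word n) : C := alt U (word_row w) (word_col w).

Definition alt_poly (U : 'M[C]_n) (s : ncpoly R n) : C :=
  \sum_(cw <- s) cw.1 * alt_word U cw.2.

(* The monomials of length less than [K], by length, rows and columns. *)
Definition bounded_word K : finType := {k : 'I_K & (multi_index n k * multi_index n k)%type}.

Definition bword K (k : 'I_K) (i j : multi_index n k) : bounded_word K :=
  Tagged (fun k : 'I_K => (multi_index n k * multi_index n k)%type) (i, j).

Lemma bword_neq K (k k' : 'I_K) (i j : multi_index n k) (i' j' : multi_index n k') :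
  k != k' -> (bword i j == bword i' j') = false.
Proof. by move=> kk; apply: contraNF kk => /eqP/(congr1 tag)/= ->. Qed.

Lemma bounded_coeffs K (s : ncpoly R n) :
  (forall cw, cw \in s -> (size cw.2 < K)%N) ->
  exists d : bounded_word K -> C,
    forall (V : lmodType C) (ev : forall k, multi_index n k -> multi_index n k -> V),
    \sum_(cw <- s) cw.1 *: ev (size cw.2) (word_row cw.2) (word_col cw.2) =
    \sum_(x : bounded_word K) d x *: ev (tag x) (tagged x).1 (tagged x).2.
Proof.
elim: s => [|[c w] s IH] sK.
  exists (fun=> 0) => V ev; rewrite big_nil big1 // => x _.
  by rewrite scale0r.
have [|d hd] := IH; first by move=> cw cws; apply: sK; rewrite inE cws orbT.
have wK : (size w < K)%N by apply: (sK (c, w)); rewrite mem_head.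
pose x0 := @bword K (Ordinal wK) (word_row w) (word_col w).
exists (fun x => (x0 == x)%:R * c + d x) => V ev.
rewrite big_cons hd; under [RHS]eq_bigr do rewrite scalerDl -scalerA.
by rewrite big_split /= sum_delta_l.
Qed.

Lemma sum_bounded_word K (V : nmodType) (F : bounded_word K -> V) :
  \sum_x F x = \sum_(k < K) \sum_i \sum_j
    F (@bword K k i j).
Proof.
transitivity (\sum_(k < K) \sum_(ij : multi_index n k * multi_index n k)
  F (Tagged (fun k : 'I_K => (multi_index n k * multi_index n k)%type) ij)).
  by rewrite sig_big_dep; apply: eq_bigr => -[k ij] _.
apply: eq_bigr => k _; rewrite pair_big; apply: eq_bigr => -[i j] _.
by [].
Qed.

End WordIndices.

Section Duality.
Variables (R : realType) (n : nat) (A : cstarAlgType R) (u : 'M[A]_n).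
Local Notation C := R[i].
Local Notation tens k := {ffun multi_index n k -> R[i]^o}.
Variables (G : 'M[C]_n -> Prop) (D : diagram_family).
Hypothesis hG : matrix_group G.
Hypothesis hchi : forall U, G U -> has_character u U.
Hypothesis hT : forall k l p, p \in D k l -> intertwines u (T_ R n p).
Hypothesis hF : forall k l (T : 'Hom(tens k, tens l)),
  alt_intertwines G (fun j i => T (basis_tensor R i) j) ->
  T \in <<[seq T_ R n p | p in D k l]>>%VS.

Lemma character_nceval U s : G U -> nceval *%R 1 u s = 0 -> alt_poly U s = 0.
Proof.
move=> /hchi[chi hchiU] /(congr1 chi); rewrite linear0 => <-.
rewrite /nceval linear_sum; apply: eq_bigr => -[c w] _ /=.
by rewrite linearZ /= word_eval_prod hchiU.
Qed.

Lemma duality_Hom_spanned : Hom_spanned_by u D.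
Proof.
move=> k l T; split; last by apply: span_intertwines => p; exact: hT.
move=> hT'; apply: hF => U GU i j; have [chi hc] := hchi GU.
have := congr1 chi (hT' i j); rewrite !linear_sum.
under eq_bigr do rewrite linearZ /= hc.
under [X in _ = X -> _]eq_bigr do rewrite linearZ /= hc.
by move=> h; apply: etrans h _; apply: eq_bigr => j' _; exact: mulrC.
Qed.

(** The passage from the group to the algebra: by [hF] an intertwiner of the group lies in the span
    of the [T_ p], and by [hT] these intertwine the coordinates. *)
Lemma alt_intertwines_coords k l (t : multi_index n l -> multi_index n k -> C) :
  alt_intertwines G t -> forall i j,
  \sum_i' t j i' *: tensor_power u i' i = \sum_j' t j' i *: tensor_power u j j'.
Proof.
move=> ht; have [T Tt] := hom_of_coeffs t.
have : intertwines u T.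
  apply: (@span_intertwines _ _ _ _ D); first by move=> p; exact: hT.
  by apply: hF => U GU i j; under eq_bigr do rewrite Tt; rewrite ht //;
    apply: eq_bigr => j' _; rewrite Tt.
move=> h i j; have := h i j; under eq_bigr do rewrite Tt.
by under [X in _ = X -> _]eq_bigr do rewrite Tt.
Qed.

Lemma tensor_power_sum_delta k (i j : multi_index n k) :
  \sum_h (h == j)%:R *: tensor_power u i h = tensor_power u i j.
Proof. exact: sum_delta_r. Qed.

(* [r] below is the vector of all monomials of length less than [K].  The
   orthogonal projection onto the span of its values over the group commutes
   with the group, hence its coefficients are intertwiners, also over the
   algebra, where it fixes [r] as well. *)
Lemma alt_faithful K (d : bounded_word n K -> C) :
  (forall U, G U -> \sum_x d x * alt U (tagged x).1 (tagged x).2 = 0) ->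
  \sum_x d x *: tensor_power u (tagged x).1 (tagged x).2 = 0.
Proof.
move=> s0.
have scE (a b : C) : a *: (b : C^o) = a * b by [].
pose rU U (x : bounded_word n K) : C := alt U (tagged x).1 (tagged x).2.
pose r (x : bounded_word n K) : A := tensor_power u (tagged x).1 (tagged x).2.
rewrite -[LHS]/(\sum_x d x *: r x).
pose S (f : bounded_word n K -> C) := exists2 U, G U & f = rU U.
have Sd f : S f -> \sum_x f x * d x = 0.
  move=> [U GU ->]; rewrite -[RHS](s0 U GU).
  by apply: eq_bigr => x _; rewrite mulrC.
have [Pi [Ph Pf PL Pa]] := hermitian_projector S.
(* The matrix of left translation: it acts on the row index alone and carries the vector [rU V] to
   [rU (U *m V)]. *)
pose L U (y x : bounded_word n K) : C :=
  \sum_p alt U (tagged x).1 p * (y == @bword n K (tag x) p (tagged x).2)%:R.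
have sumL U (f : bounded_word n K -> C) x : \sum_y f y * L U y x =
    \sum_p alt U (tagged x).1 p * f (@bword n K (tag x) p (tagged x).2).
  under eq_bigr do rewrite mulr_sumr; rewrite exchange_big; apply: eq_bigr => p _ /=.
  rewrite -[RHS](sum_delta_r (V := C^o)
    (fun y => alt U (tagged x).1 p * f y) (@bword n K (tag x) p (tagged x).2)).
  by apply: eq_bigr => y _; rewrite scE; ring.
have Lrow U k i j (f : bounded_word n K -> C) : \sum_x L U (@bword n K k i j) x * f x =
    \sum_p alt U p i * f (@bword n K k p j).
  rewrite sum_bounded_word (bigD1 k) //= [X in _ + X]big1 ?addr0; last first.
    move=> k' kk'; rewrite big1 // => i' _; rewrite big1 // => j' _.
    rewrite /L /= big1 ?mul0r // => p _.
    by rewrite bword_neq ?mulr0 // eq_sym.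
  apply: eq_bigr => p _; rewrite -(sum_delta_l (V := C^o)
    (fun j' => alt U p i * f (@bword n K k p j')) j).
  apply: eq_bigr => j' _; rewrite /L /=.
  have -> : \sum_p0 alt U p p0 * (@bword n K k i j == @bword n K k p0 j')%:R =
      \sum_p0 (i == p0)%:R *: ((j == j')%:R *: (alt U p p0 : C^o)).
    apply: eq_bigr => p0 _; rewrite /bword eq_Tagged /= xpair_eqE.
    by rewrite mulrC scalerA -natrM mulnb.
  by rewrite sum_delta_l -[_ *: alt _ _ _]/(_ * _) -mulrA.
have SL U f : G U -> S f -> S (fun x => \sum_y f y * L U y x).
  move=> GU [V GV ->]; exists (U *m V); first exact: groupM.
  by apply: functional_extensionality_dep => x; rewrite sumL /rU alt_mul.
have Ladj U x y : (L U y x)^* = L U^H x y.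
  case: x y => [k [i j]] [k' [i' j']]; rewrite /L /= rmorph_sum /=.
  have [kk|kk] := eqVneq k' k; last first.
    rewrite !big1 // => p _; first by rewrite bword_neq ?mulr0 // eq_sym.
    by rewrite bword_neq ?mulr0 //; exact: conjc0.
  case: _ / kk i j => i j.
  transitivity ((alt U i i' : C)^* * (j == j')%:R).
    rewrite (bigD1 i') //= big1 ?addr0 => [|p pi'].
      by rewrite eq_Tagged /= xpair_eqE eqxx /= rmorphM rmorph_nat eq_sym.
    rewrite eq_Tagged /= xpair_eqE eq_sym (negPf pi') mulr0.
    exact: conjc0.
  rewrite (bigD1 i) //= [X in _ + X]big1 ?addr0 => [|p pi].
    by rewrite eq_Tagged /= xpair_eqE eqxx /= alt_adj.
  by rewrite eq_Tagged /= xpair_eqE eq_sym (negPf pi) mulr0.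
(* With the column indices [j] and [q] frozen, commutation of [Pi] with the translations is an
   intertwining relation between the powers [k] and [k']. *)
have slice k j k' q : alt_intertwines G (fun (p : multi_index n (k' : 'I_K))
    (i : multi_index n (k : 'I_K)) => Pi (@bword n K k i j) (@bword n K k' p q)).
  move=> U GU i p.
  have := PL (L U) (fun f => SL U f GU) _ (@bword n K k i j) (@bword n K k' p q).
  rewrite sumL Lrow /= => -> //.
    by apply: eq_bigr => i' _; rewrite mulrC.
  move=> f Sf; suff -> : (fun y => \sum_x f x * (L U y x)^*) =
      (fun y => \sum_x f x * L U^H x y).
    by apply: SL => //; exact: group_adj.
  apply: functional_extensionality_dep => y; apply: eq_bigr => x _.
  by congr (_ * _); exact: Ladj.
have rPi y : r y = \sum_x Pi x y *: r x.
  case: y => k' [p q]; rewrite {1}/r /= -tensor_power_sum_delta.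
  (* At the identity matrix the vector of monomials consists of Kronecker deltas, and [Pi] fixes it.
     This expresses a delta through the slices of [Pi]. *)
  have dl h : (h == q)%:R = \sum_k \sum_j \sum_i (i == j)%:R *
      Pi (@bword n K k i j) (@bword n K k' h q) :> C.
    rewrite -alt1 -[LHS]/(rU 1%:M (@bword n K k' h q)) -Pf; last by exists 1%:M; first exact: group1.
    rewrite sum_bounded_word; apply: eq_bigr => k _; rewrite exchange_big.
    by apply: eq_bigr => j _; apply: eq_bigr => i _; rewrite /rU /= alt1.
  under [LHS]eq_bigr do rewrite dl scaler_suml.
  rewrite exchange_big [RHS]sum_bounded_word; apply: eq_bigr => k _ /=.
  rewrite [RHS]exchange_big; under [LHS]eq_bigr do rewrite scaler_suml.
  rewrite [LHS]exchange_big; apply: eq_bigr => j _ /=.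
  under [LHS]eq_bigr do rewrite scaler_suml.
  rewrite [LHS]exchange_big /=.
  under [LHS]eq_bigr => i _ do (under eq_bigr do rewrite -scalerA; rewrite -scaler_sumr).
  rewrite sum_delta_r; apply: esym.
  exact: (alt_intertwines_coords (@slice k j k' q) j p).
under eq_bigr do rewrite rPi scaler_sumr.
rewrite exchange_big big1 // => x _; under eq_bigr do rewrite scalerA.
by rewrite -scaler_suml; under eq_bigr do rewrite mulrC; rewrite Pa ?scale0r.
Qed.

End Duality.

Section CoordAlgebra.
Variables (R : realType) (A : starAlgType R) (n : nat) (u : 'M[A]_n).
Local Notation C := R[i].

Lemma coord_ind (Q : coord_alg u -> Prop) :
  (forall i j, Q (coord u i j)) -> Q 1 -> (forall (c : C) x, Q x -> Q (c *: x)) ->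
  (forall x y, Q x -> Q y -> Q (x + y)) -> (forall x y, Q x -> Q y -> Q (x * y)) ->
  (forall x, Q x -> Q (star x)) -> forall x, Q x.
Proof.
move=> Qu Q1 QZ QD QM QS x.
have mem z : coord_generated u z -> z \in coord_pred u by move=> h; apply/asboolP.
suff h z : coord_generated u z -> forall y, val y = z -> Q y.
  by apply: (h (val x)) => //; apply/asboolP; exact: (valP x).
elim=> {x z}.
- by move=> i j y yz; rewrite (_ : y = coord u i j) //; exact: val_inj.
- by move=> y yz; rewrite (_ : y = 1) //; exact: val_inj.
- move=> c x /mem xP IH y yz; rewrite (_ : y = c *: CoordAlg xP); last exact: val_inj.
  by apply: QZ; exact: IH.
- move=> x x' /mem xP IH /mem xP' IH' y yz.
  rewrite (_ : y = CoordAlg xP + CoordAlg xP'); last exact: val_inj.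
  by apply: QD; [exact: IH|exact: IH'].
- move=> x x' /mem xP IH /mem xP' IH' y yz.
  rewrite (_ : y = CoordAlg xP * CoordAlg xP'); last exact: val_inj.
  by apply: QM; [exact: IH|exact: IH'].
- move=> x /mem xP IH y yz; rewrite (_ : y = star (CoordAlg xP)); last exact: val_inj.
  by apply: QS; exact: IH.
Qed.

Lemma coord_star_preserving (B : starAlgType R) (f : {lrmorphism coord_alg u -> B}) :
  (forall i j, star (u i j) = u i j) ->
  (forall i j, star (f (coord u i j)) = f (coord u i j)) -> star_preserving f.
Proof.
move=> su sf; apply: coord_ind.
- by move=> i j; rewrite sf; congr (f _); apply: val_inj; exact: su.
- by rewrite star1 rmorph1 star1.
- by move=> c x fx; rewrite starZ !linearZ starZ /= fx.
- by move=> x y fx fy; rewrite starD !raddfD starD /= fx fy.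
- by move=> x y fx fy; rewrite starM !rmorphM starM /= fx fy.
- by move=> x fx; rewrite starK fx starK.
Qed.

Lemma val_nceval s :
  val (nceval *%R 1 (coord u) s) = nceval *%R 1 u s.
Proof. by apply: (nceval_map (h := val)). Qed.

End CoordAlgebra.

Section Inclusion.
Variables (R : realType) (A B : starAlgType R) (n : nat) (u : 'M[A]_n) (v : 'M[B]_n).

Lemma qincluded_relations :
  (forall i j, star (u i j) = u i j) -> (forall i j, star (v i j) = v i j) ->
  (forall s, nceval *%R 1 v s = 0 -> nceval *%R 1 u s = 0) -> qincluded u v.
Proof.
move=> su sv wd.
have [] := @coord_transfer R n B v (coord_alg u) *%R 1 (coord u) sv (@mulrA _) (@mul1r _) (@mulr1 _).
- by move=> c x y z; rewrite mulrDl scalerAl.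
- by move=> c x y z; rewrite mulrDr scalerAr.
- by move=> s /wd us; apply: val_inj; rewrite val_nceval us.
move=> g [gl g1 gM gu].
have [||f fg] := @lrmorphism_of _ _ _ g; [exact: gl|by split|].
have fu i j : f (coord v i j) = coord u i j by rewrite fg gu.
have fs : star_preserving f.
  by apply: coord_star_preserving => // i j; rewrite fu; apply: val_inj; exact: su.
exists f; split => //; apply: coord_ind.
- by move=> i j; exists (coord v i j).
- by exists 1; rewrite rmorph1.
- by move=> c _ [y <-]; exists (c *: y); rewrite linearZ.
- by move=> _ _ [x <-] [y <-]; exists (x + y); rewrite raddfD.
- by move=> _ _ [x <-] [y <-]; exists (x * y); rewrite rmorphM.
- by move=> _ [y <-]; exists (star y); rewrite fs.
Qed.

End Inclusion.

Section TensorFacts.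
Variables (R : realType) (A : starAlgType R).
Local Notation C := R[i].
Local Notation AA := (tensor A A).

Lemma pureM (a b c d : A) : pure a b * pure c d = pure (a * c) (b * d) :> AA.
Proof.
apply: tensorP => f.
have -> : teval f (pure a b * pure c d) = teval (bform_mull f a b) (pure c d).
  rewrite tevalMr [RHS]/teval /tensor_eval; apply: eq_bigr => cd _.
  by rewrite teval_pure.
by rewrite !teval_pure.
Qed.

Lemma teval_sum f (I : Type) (r : seq I) (F : I -> AA) :
  teval f (\sum_(i <- r) F i) = \sum_(i <- r) teval f (F i).
Proof. exact: (big_morph (teval f) (tevalD f) (teval0 f)). Qed.

End TensorFacts.

Section TensorStar.
Variables (R : realType) (A : starAlgType R).
Local Notation C := R[i].
Local Notation AA := (tensor A A).
Implicit Types (f : bilinear_form A A) (x y z : AA).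

Lemma bform_suml f (I : finType) (c : I -> C) (F : I -> A) b :
  f (\sum_i c i *: F i) b = \sum_i c i * f (F i) b.
Proof.
have f0 : f 0 b = 0 by rewrite -(scale0r 0) bformZl mul0r.
by elim/big_rec2: _ => // i y1 y2 _ <-; rewrite bform_linearl.
Qed.

Lemma bform_sumr f (I : finType) (c : I -> C) (F : I -> A) a :
  f a (\sum_i c i *: F i) = \sum_i c i * f a (F i).
Proof.
have f0 : f a 0 = 0 by rewrite -(scale0r 0) bformZr mul0r.
by elim/big_rec2: _ => // i y1 y2 _ <-; rewrite bform_linearr.
Qed.

Lemma tensor_scaleAl (c : C) x y : c *: (x * y) = (c *: x) * y.
Proof.
apply: tensorP => f; rewrite tevalZ !tevalMr mulr_sumr.
by apply: eq_bigr => cd _; rewrite tevalZ.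
Qed.

Lemma tensor_scaleAr (c : C) x y : c *: (x * y) = x * (c *: y).
Proof.
apply: tensorP => f; rewrite tevalZ !tevalMl mulr_sumr.
by apply: eq_bigr => cd _; rewrite tevalZ.
Qed.

Lemma pure_prod k (a b : 'I_k -> A) :
  \prod_i pure (a i) (b i) = pure (\prod_i a i) (\prod_i b i) :> AA.
Proof.
elim: k a b => [|k IH] a b; first by rewrite !big_ord0.
by rewrite !big_ord_recl IH pureM.
Qed.

Lemma tensorS_D x y : tensorS (x + y) = tensorS x + tensorS y.
Proof. by apply: tensorP => f; rewrite tevalD !tevalS tevalD rmorphD. Qed.

Lemma tensorS_Z (c : C) x : tensorS (c *: x) = c^* *: tensorS x.
Proof. by apply: tensorP => f; rewrite tevalZ !tevalS tevalZ rmorphM. Qed.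

Lemma tensorS_pure (a b : A) : tensorS (pure a b) = pure (star a) (star b).
Proof.
by apply: tensorP => f; rewrite tevalS !teval_pure /= conjcK.
Qed.

Lemma tensorE x : x = \sum_(ab <- repr x) pure ab.1 ab.2.
Proof.
by apply: tensorP => f; rewrite teval_sum; apply: eq_bigr => ab _; rewrite teval_pure.
Qed.

Lemma tensorS_sum (I : Type) (r : seq I) (F : I -> AA) :
  tensorS (\sum_(i <- r) F i) = \sum_(i <- r) tensorS (F i).
Proof.
apply: (big_morph (@tensorS R A A) tensorS_D).
by have := tensorS_Z 0 0; rewrite conjC0 !scale0r.
Qed.

Lemma tensorS_M x y : tensorS (x * y) = tensorS y * tensorS x.
Proof.
rewrite [in LHS](tensorE x) [in LHS](tensorE y) [in RHS](tensorE x) [in RHS](tensorE y).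
rewrite mulr_suml !tensorS_sum mulr_sumr; apply: eq_bigr => ab _.
rewrite mulr_sumr mulr_suml tensorS_sum; apply: eq_bigr => cd _.
by rewrite pureM !tensorS_pure pureM !starM.
Qed.

Lemma tensorS_K x : tensorS (tensorS x) = x.
Proof.
rewrite [RHS]tensorE [in LHS](tensorE x) !tensorS_sum; apply: eq_bigr => ab _.
by rewrite !tensorS_pure !starK.
Qed.

End TensorStar.

(** A pseudo-inverse [Q] of the matrix [M] of [F] satisfies [M Q M = M]; this separates the two
    variables. *)
Lemma rank_factorization (R : fieldType) (W : finType) (F : W -> W -> R) :
  exists Q : W -> W -> R,
    forall x y, F x y = \sum_z \sum_z' F x z * Q z z' * F z' y.
Proof.
pose M : 'M[R]_#|W| := \matrix_(i, j) F (enum_val i) (enum_val j).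
have MQ : M *m pinvmx M *m M = M by rewrite mulmxKpV.
exists (fun z z' => pinvmx M (enum_rank z) (enum_rank z')) => x y.
have sumW (K : 'I_#|W| -> R) : \sum_i K i = \sum_(w : W) K (enum_rank w).
  by rewrite (reindex (@enum_rank W)) //=; exists enum_val => ? _; rewrite ?enum_rankK ?enum_valK.
have ME z w : M (enum_rank z) (enum_rank w) = F z w by rewrite mxE !enum_rankK.
rewrite -ME -{1}MQ mxE sumW exchange_big; apply: eq_bigr => z' _.
rewrite mxE sumW ME mulr_suml; apply: eq_bigr => z _.
by rewrite ME.
Qed.

(** * Counit, antipode and comultiplication *)

Section Hopf.
Variables (R : realType) (n : nat) (A : cstarAlgType R) (u : 'M[A]_n).
Local Notation C := R[i].
Local Notation tens k := {ffun multi_index n k -> R[i]^o}.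
Variables (G : 'M[C]_n -> Prop) (D : diagram_family).
Hypothesis su : forall i j, star (u i j) = u i j.
Hypothesis hG : matrix_group G.
Hypothesis hchi : forall U, G U -> has_character u U.
Hypothesis hT : forall k l p, p \in D k l -> intertwines u (T_ R n p).
Hypothesis hF : forall k l (T : 'Hom(tens k, tens l)),
  alt_intertwines G (fun j i => T (basis_tensor R i) j) ->
  T \in <<[seq T_ R n p | p in D k l]>>%VS.

Local Notation cu := (coord u).

Definition coord_mon k (i j : multi_index n k) : coord_alg u :=
  \prod_(a < k) cu (i a) (j a).

Lemma val_coord_mon k (i j : multi_index n k) : val (coord_mon i j) = tensor_power u i j.
Proof. by rewrite /coord_mon rmorph_prod. Qed.

Lemma coord_faithful K (d : bounded_word n K -> C) :
  (forall U, G U -> \sum_x d x * alt U (tagged x).1 (tagged x).2 = 0) ->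
  \sum_x d x *: coord_mon (tagged x).1 (tagged x).2 = 0.
Proof.
move=> /(alt_faithful hG hT hF) h; apply: val_inj.
rewrite raddf_sum [RHS]raddf0 -[RHS]h; apply: eq_bigr => x _.
by rewrite -val_coord_mon.
Qed.

Lemma alt_poly_bounded K s (d : bounded_word n K -> C) U : (forall (V : lmodType C)
    (ev : forall k, multi_index n k -> multi_index n k -> V),
    \sum_(cw <- s) cw.1 *: ev (size cw.2) (word_row cw.2) (word_col cw.2) =
    \sum_(x : bounded_word n K) d x *: ev (tag x) (tagged x).1 (tagged x).2) ->
  alt_poly U s = \sum_x d x * alt U (tagged x).1 (tagged x).2.
Proof. by move=> /(_ C^o (fun k i j => alt U i j)). Qed.

Lemma ncpoly_bounded (s : ncpoly R n) : exists K (d : bounded_word n K -> C),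
  forall (V : lmodType C) (ev : forall k, multi_index n k -> multi_index n k -> V),
    \sum_(cw <- s) cw.1 *: ev (size cw.2) (word_row cw.2) (word_col cw.2) =
    \sum_(x : bounded_word n K) d x *: ev (tag x) (tagged x).1 (tagged x).2.
Proof.
exists (\max_(cw <- s) size cw.2).+1; apply: bounded_coeffs => cw cws.
by rewrite ltnS; exact: leq_bigmax_seq.
Qed.

(** The counit is evaluation at the identity matrix, where conjugation has no effect on the entries.
    Unlike at a general matrix, the result is multiplicative. *)
Lemma counit_exists : exists eps : {lrmorphism coord_alg u -> C^o},
  star_preserving eps /\ forall i j, eps (cu i j) = (i == j)%:R.
Proof.
have [] := @coord_transfer R n A u C^o *%R 1 (fun i j => (i == j)%:R) su
  (@mulrA _) (@mul1r _) (@mulr1 _).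
- by move=> c x y z; rewrite mulrDl scalerAl.
- by move=> c x y z; rewrite mulrDr scalerAr.
- move=> s us; rewrite -[RHS](character_nceval hchi (group1 hG) us).
  apply: eq_bigr => cw _; congr (_ * _); rewrite word_eval_prod.
  by apply: eq_bigr => a _; rewrite mxE conj_if_nat.
move=> g [gl g1 gM gu].
have [||f fg] := @lrmorphism_of _ _ _ g; [exact: gl|by split|].
exists f; split; last by move=> i j; rewrite fg gu.
by apply: coord_star_preserving => // i j; rewrite fg gu; exact: conjc_nat.
Qed.

(** A word in the transposed coordinates, multiplied in the opposite order, is the star of a
    monomial with rows and columns exchanged. A relation at [U^H], conjugated, is therefore the
    relation needed at [U]. *)
Lemma antipode_exists : exists S : {linear coord_alg u -> coord_alg u},
  [/\ S 1 = 1, forall x y, S (x * y) = S y * S x &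
      forall i j, S (cu i j) = cu j i].
Proof.
have [] := @coord_transfer R n A u (coord_alg u) (fun x y => y * x) 1
  (fun i j => cu j i) su.
- by move=> x y z; rewrite mulrA.
- exact: mulr1.
- exact: mul1r.
- by move=> c x y z; rewrite mulrDr scalerAr.
- by move=> c x y z; rewrite mulrDl scalerAl.
- move=> s us; have [K [d hd]] := ncpoly_bounded s.
  have wordE w : word_eval (fun x y => y * x) 1 (fun i j => cu j i) w =
      star (coord_mon (word_col w) (word_row w)).
    have -> : coord_mon (word_col w) (word_row w) = word_eval *%R 1 (fun i j => cu j i) w.
      by rewrite word_eval_prod.
    elim: w => [|p w IH] /=; first by rewrite star1.
    by rewrite IH starM; congr (_ * _); apply: val_inj; rewrite /= su.
  rewrite /nceval; under eq_bigr do rewrite wordE.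
  rewrite (hd _ (fun k i j => star (coord_mon j i))).
  pose swap (x : bounded_word n K) : bounded_word n K := bword (tagged x).2 (tagged x).1.
  have swapK : involutive swap by case=> k [i j].
  rewrite (reindex_inj (inv_inj swapK)) /=.
  transitivity (star (\sum_x (d (swap x))^* *: coord_mon (tagged x).1 (tagged x).2)).
    rewrite star_sum; apply: eq_bigr => x _.
    by rewrite starZ /=; congr (_ *: _); case: x => k [i j]; apply: esym; exact: conjcK.
  rewrite coord_faithful ?star0 // => U GU.
  transitivity (alt_poly U^H s)^*; last first.
    rewrite (character_nceval hchi (group_adj hG GU) us); exact: conjc0.
  rewrite (alt_poly_bounded _ hd) (reindex_inj (inv_inj swapK)) rmorph_sum.
  apply: eq_bigr => -[k [i j]] _; rewrite rmorphM /= alt_adj; congr (_ * _).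
  by apply: esym; exact: conjcK.
move=> g [gl g1 gM gu].
pose gL := GRing.isLinear.Build _ _ _ _ g gl.
pose S : {linear coord_alg u -> coord_alg u} := HB.pack g gL.
by exists S.
Qed.

(* For a bilinear form f, factoring the matrix of the values of f on monomials
   through the functionals f(., y) and f(x, .) allows applying the
   faithfulness of the model to one tensor factor at a time. *)
Lemma comultiplication_relation K (d : bounded_word n K -> C) :
  (forall U, G U -> \sum_x d x * alt U (tagged x).1 (tagged x).2 = 0) ->
  forall f : bilinear_form (coord_alg u) (coord_alg u),
  \sum_x d x * \sum_h f (coord_mon (tagged x).1 h) (coord_mon h (tagged x).2) = 0.
Proof.
move=> d0 f.
pose mon (x : bounded_word n K) := coord_mon (tagged x).1 (tagged x).2.
have [Q fQ] := rank_factorization (fun x y => f (mon x) (mon y)).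
have left V z : G V -> \sum_x d x *
    \sum_h f (coord_mon (tagged x).1 h) (mon z) * alt V h (tagged x).2 = 0.
  (* The second tensor factor is evaluated at a fixed [V], which leaves a polynomial in the first.
     Its value at [U] is the value of the given relation at [U *m V]. *)
  move=> GV; pose e (y : bounded_word n K) : C :=
    \sum_j d (bword (tagged y).1 j) * alt V (tagged y).2 j.
  have e0 : \sum_y e y *: mon y = 0.
    apply: coord_faithful => U GU; rewrite -[RHS](d0 (U *m V)); last exact: groupM.
    rewrite !sum_bounded_word; apply: eq_bigr => k _; apply: eq_bigr => i _ /=.
    under [RHS]eq_bigr do rewrite alt_mul mulr_sumr.
    rewrite [RHS]exchange_big; apply: eq_bigr => h _; rewrite /e /= mulr_suml.
    by apply: eq_bigr => j _; ring.
  have := bform_suml f e mon (mon z); rewrite e0 => fe.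
  have f0 : f 0 (mon z) = 0 by rewrite -(scale0r 0) bformZl mul0r.
  rewrite -[RHS]f0 fe !sum_bounded_word; apply: eq_bigr => k _; apply: eq_bigr => i _ /=.
  under [RHS]eq_bigr do rewrite /e /= mulr_suml.
  rewrite [RHS]exchange_big; apply: eq_bigr => j _; rewrite mulr_sumr.
  by apply: eq_bigr => h _; rewrite /mon /=; ring.
(* Now the first factor is contracted with the functional [f(., mon z)]; [left] says that the
   polynomial remaining in the second factor vanishes at every [V]. *)
pose e z (y : bounded_word n K) : C :=
  \sum_i d (bword i (tagged y).2) * f (coord_mon i (tagged y).1) (mon z).
have e0 z : \sum_y e z y *: mon y = 0.
  apply: coord_faithful => V GV; rewrite -[RHS](left V z GV).
  rewrite !sum_bounded_word; apply: eq_bigr => k _ /=; rewrite exchange_big.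
  under [RHS]eq_bigr do under eq_bigr do rewrite mulr_sumr.
  rewrite [RHS]exchange_big; apply: eq_bigr => j _ /=.
  rewrite [RHS]exchange_big; apply: eq_bigr => h _; rewrite /e /= mulr_suml.
  by apply: eq_bigr => i _; ring.
transitivity (\sum_z \sum_z' Q z z' * f (mon z') (\sum_y e z y *: mon y)).
  have fQ' k (i j h h' : multi_index n (k : 'I_K)) : f (coord_mon i h) (coord_mon h' j) =
      \sum_z \sum_z' f (coord_mon i h) (mon z) * Q z z' * f (mon z') (coord_mon h' j).
    by have := fQ (@bword n K k i h) (@bword n K k h' j).
  transitivity (\sum_x \sum_z \sum_z' \sum_h d x * (f (coord_mon (tagged x).1 h) (mon z)
      * Q z z' * f (mon z') (coord_mon h (tagged x).2))).
    apply: eq_bigr => x _; under eq_bigr do rewrite fQ'.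
    rewrite exchange_big mulr_sumr; apply: eq_bigr => z _.
    by rewrite exchange_big mulr_sumr; apply: eq_bigr => z' _; rewrite mulr_sumr.
  rewrite exchange_big; apply: eq_bigr => z _; rewrite exchange_big.
  apply: eq_bigr => z' _; rewrite bform_sumr mulr_sumr !sum_bounded_word.
  apply: eq_bigr => k _ /=; rewrite exchange_big.
  under eq_bigr do rewrite exchange_big.
  rewrite exchange_big; apply: eq_bigr => h _; apply: eq_bigr => j _.
  rewrite /e /= mulr_suml mulr_sumr; apply: eq_bigr => i _; rewrite /mon /=; ring.
rewrite big1 // => z _; rewrite big1 // => z' _.
by rewrite e0 -(scale0r 0) bformZr mul0r mulr0.
Qed.

Lemma comultiplication_exists :
  exists Delta : {lrmorphism coord_alg u -> tensor (coord_alg u) (coord_alg u)},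
    (forall x, Delta (star x) = tensorS (Delta x)) /\
    (forall i j, Delta (cu i j) = \sum_k pure (cu i k) (cu k j)).
Proof.
pose w i j : tensor (coord_alg u) (coord_alg u) := \sum_k pure (cu i k) (cu k j).
have [] := @coord_transfer R n A u (tensor (coord_alg u) (coord_alg u)) *%R 1 w su
  (@mulrA _) (@mul1r _) (@mulr1 _).
- by move=> c x y z; rewrite mulrDl tensor_scaleAl.
- by move=> c x y z; rewrite mulrDr tensor_scaleAr.
- move=> s us; have [K [d hd]] := ncpoly_bounded s.
  have wordE k (i j : multi_index n k) : \prod_(a < k) w (i a) (j a) =
      \sum_(h : multi_index n k) pure (coord_mon i h) (coord_mon h j).
    rewrite /w bigA_distr_bigA /=; apply: eq_bigr => h _.
    by rewrite pure_prod.
  apply: tensorP => f; rewrite teval0.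
  have d0 U : G U -> \sum_x d x * alt U (tagged x).1 (tagged x).2 = 0.
    by move=> GU; rewrite -(alt_poly_bounded _ hd) (character_nceval hchi GU us).
  rewrite -[RHS](comultiplication_relation d0 f) /nceval teval_sum.
  rewrite -(hd C^o (fun k i j => \sum_h f (coord_mon i h) (coord_mon h j))).
  apply: eq_bigr => cw _; rewrite tevalZ word_eval_prod wordE teval_sum.
  by congr (_ * _); apply: eq_bigr => h _; rewrite teval_pure.
move=> g [gl g1 gM gu].
pose gL := GRing.isLinear.Build _ _ _ _ g gl.
pose gMM := GRing.isMonoidMorphism.Build _ _ g (conj g1 gM).
pose Delta : {lrmorphism coord_alg u -> tensor (coord_alg u) (coord_alg u)} :=
  HB.pack g gL gMM.
have gZ (c : C) x : g (c *: x) = c *: g x by exact: (linearZ_LR Delta).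
have gD x y : g (x + y) = g x + g y by exact: (raddfD Delta).
exists Delta; split => //=; apply: coord_ind.
- move=> i j; rewrite (_ : star (cu i j) = cu i j) /=; last by apply: val_inj; exact: su.
  rewrite gu tensorS_sum; apply: eq_bigr => k _; rewrite tensorS_pure.
  by congr pure; apply: val_inj; rewrite /= su.
- by rewrite star1 g1; apply: tensorP => f; rewrite -[1]/(pure 1 1) tensorS_pure star1.
- by move=> c x gx; rewrite starZ !gZ tensorS_Z gx.
- by move=> x y gx gy; rewrite starD !gD tensorS_D gx gy.
- by move=> x y gx gy; rewrite starM !gM tensorS_M gx gy.
- by move=> x gx; rewrite starK gx tensorS_K.
Qed.

Lemma duality_Hopf_maps : has_Hopf_maps u.
Proof.
by split; [exact: comultiplication_exists|exact: counit_exists|exact: antipode_exists].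
Qed.

End Hopf.

(** * Schur-Weyl duality for the unitary group *)

Lemma poly_nat_roots (K : numDomainType) (q : {poly K}) :
  (forall k : nat, q.[k%:R] = 0) -> q = 0.
Proof.
move=> q0; apply: contraTeq isT => qn0.
pose rs : seq K := [seq k%:R | k <- iota 0 (size q)].
have := max_poly_roots qn0 (rs := rs).
rewrite size_map size_iota ltnn => h; apply: h.
  by apply/allP => _ /mapP[k _ ->]; apply/rootP.
by rewrite map_inj_uniq ?iota_uniq // => a b /eqP; rewrite eqr_nat => /eqP.
Qed.

(** Ryser's formula: the signed sum over sets of rows keeps only the maps [f] from columns to rows
    that reach every row, that is, the permutations. It acts below as polarization, turning
    symmetrized products into combinations of powers. *)
Lemma ryser_permanent (K : comNzRingType) m (x : 'I_m -> 'I_m -> K) :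
  \sum_(e : {ffun 'I_m -> bool}) (\prod_a (if e a then 1 else -1)) *
    \prod_b \sum_a (e a)%:R * x a b = \sum_(s : 'S_m) \prod_b x (s b) b.
Proof.
have distr (e : {ffun 'I_m -> bool}) : \prod_b \sum_a (e a)%:R * x a b =
    \sum_(f : {ffun 'I_m -> 'I_m}) (\prod_b (e (f b))%:R) * \prod_b x (f b) b.
  by rewrite bigA_distr_bigA; apply: eq_bigr => f _; rewrite -big_split.
under eq_bigr do rewrite distr mulr_sumr.
rewrite exchange_big /=.
have coef (f : {ffun 'I_m -> 'I_m}) :
    \sum_(e : {ffun 'I_m -> bool}) (\prod_a (if e a then 1 else -1)) *
      \prod_b (e (f b))%:R = (injectiveb f)%:R :> K.
  pose g a (e : bool) : K := (if e then 1 else -1) * \prod_(b | f b == a) e%:R.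
  transitivity (\sum_(e : {ffun 'I_m -> bool}) \prod_a g a (e a)).
    apply: eq_bigr => e _; rewrite /g big_split; congr (_ * _).
    rewrite (partition_big f xpredT) //=; apply: eq_bigr => a _.
    by apply: eq_bigr => b /eqP ->.
  rewrite -bigA_distr_bigA /=.
  have gE a : \sum_(e : bool) g a e = [exists b, f b == a]%:R.
    rewrite big_bool /g /= mul1r big1 // mulN1r.
    case: existsP => [[b fb]|nb]; first by rewrite (bigD1 b) //= mul0r subr0.
    by rewrite big_pred0 ?subrr // => b; apply/negP => fb; apply: nb; exists b.
  under eq_bigr do rewrite gE.
  have [/injectiveP fi|nfi] := boolP (injectiveb f).
    rewrite big1 // => a _.
    have [h _ fh] := injF_bij fi.
    by rewrite (_ : [exists b, f b == a]) //; apply/existsP; exists (h a); rewrite fh.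
  have /existsP[a na] : [exists a, ~~ [exists b, f b == a]].
    rewrite -negb_forall; apply: contra nfi => /forallP fs.
    have /image_injP fi : #|image f predT| == #|'I_m|.
      apply/eqP/eq_card => a; have /existsP[b /eqP <-] := fs a.
      by rewrite image_f.
    by apply/injectiveP => a b; exact: fi.
  by rewrite (bigD1 a) //= (negPf na) mul0r.
under eq_bigr => f _ do (under eq_bigr do rewrite mulrA; rewrite -mulr_suml coef).
rewrite (bigID (fun f : {ffun _} => injectiveb f)) /= [X in _ + X]big1 ?addr0; last first.
  by move=> f /negPf ->; rewrite mul0r.
rewrite (reindex (val : 'S_m -> {ffun 'I_m -> 'I_m})) /=; last first.
  exists (insubd (1%g : 'S_m)) => f; first by rewrite valKd.
  by move=> fi; rewrite insubdK.
apply: eq_big => s; first exact: (valP s).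
by move=> si; rewrite si mul1r; apply: eq_bigr => b _; rewrite -pvalE.
Qed.

Section SchurWeyl.
Variables (R : realType) (n m : nat).
Local Notation C := R[i].
Local Notation I := (multi_index n m).

(** The coefficients of the [m]-th tensor power of [A]. The ring is arbitrary since they are also
    taken over [{poly C}], where identities are extended from the unitary group. *)
Definition power_coeff (K : comNzRingType) (A : 'M[K]_n) (i j : I) : K := \prod_a A (i a) (j a).

Lemma power_coeff_map (K L : comNzRingType) (f : {rmorphism K -> L}) (A : 'M[K]_n) i j :
  f (power_coeff A i j) = power_coeff (map_mx f A) i j.
Proof. by rewrite rmorph_prod; apply: eq_bigr => a _; rewrite mxE. Qed.

Lemma power_coeffZ (K : comNzRingType) (c : K) (A : 'M[K]_n) i j :
  power_coeff (c *: A) i j = c ^+ m * power_coeff A i j.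
Proof.
rewrite /power_coeff; under eq_bigr do rewrite mxE.
by rewrite big_split /= prodr_const card_ord.
Qed.

Definition commutator (K : comNzRingType) (t : I -> I -> K) (A : 'M[K]_n) i j : K :=
  \sum_h (t i h * power_coeff A h j - power_coeff A i h * t h j).

Lemma commutator_map (K L : comNzRingType) (f : {rmorphism K -> L})
    (t : I -> I -> K) (A : 'M[K]_n) i j :
  f (commutator t A i j) = commutator (fun i j => f (t i j)) (map_mx f A) i j.
Proof.
rewrite rmorph_sum; apply: eq_bigr => h _.
by rewrite rmorphB !rmorphM /= !power_coeff_map.
Qed.

Lemma commutatorZ (K : comNzRingType) (c : K) (t : I -> I -> K) (A : 'M[K]_n) i j :
  commutator t (c *: A) i j = c ^+ m * commutator t A i j.
Proof.
rewrite /commutator mulr_sumr; apply: eq_bigr => h _; rewrite !power_coeffZ.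
by rewrite mulrBr !mulrA [t i h * _]mulrC.
Qed.

Section Cayley.
Variable t : I -> I -> C.
Hypothesis ht : forall U, unitary U -> forall i j, commutator t U i j = 0.

Let tP i j : {poly C} := (t i j)%:P.

Lemma eval_tP z : (fun i j => horner_eval z (tP i j)) = t.
Proof. by apply: funext => i; apply: funext => j; exact: hornerC. Qed.

Lemma unitary_cayley (X : 'M[C]_n) : X^H = - X -> 1%:M - X \in unitmx ->
  unitary ((1%:M + X) *m invmx (1%:M - X)).
Proof.
move=> XH u; rewrite /unitary map_mxM map_invmx trmx_mul trmx_inv.
have -> : (1%:M - X)^H = 1%:M + X.
  by rewrite !raddfB /= map_mx1 trmx1 XH opprK.
have -> : (1%:M + X)^H = 1%:M - X.
  by rewrite !raddfD /= map_mx1 trmx1 XH.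
have u' : 1%:M + X \in unitmx.
  have -> : 1%:M + X = (1%:M - X)^H by rewrite !raddfB /= map_mx1 trmx1 XH opprK.
  by rewrite unitmx_tr map_unitmx.
have cm : (1%:M + X) *m (1%:M - X) = (1%:M - X) *m (1%:M + X).
  by rewrite mulmxDl !mulmxBr mulmxBl !mulmxDr !mul1mx !mulmx1 opprD !addrA subrK addrK.
have cm' : (1%:M + X) *m invmx (1%:M - X) = invmx (1%:M - X) *m (1%:M + X).
  by rewrite -[in RHS](mulmxK u (1%:M + X)) cm !mulmxA mulVmx // mul1mx.
by rewrite cm' mulmxA -(mulmxA _ (1%:M + X)) mulmxV // mulmx1 mulVmx.
Qed.

(** Clears the denominator of the Cayley transform: the commutator is homogeneous of degree [m], and
    with the adjugate in place of the inverse it is polynomial in [X]. *)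
Lemma commutator_adj (X : 'M[C]_n) i j : \det (1%:M - X) != 0 ->
  commutator t ((1%:M + X) *m \adj (1%:M - X)) i j =
  \det (1%:M - X) ^+ m * commutator t ((1%:M + X) *m invmx (1%:M - X)) i j.
Proof.
move=> d0; have u : 1%:M - X \in unitmx by rewrite unitmxE unitfE.
rewrite -commutatorZ; congr commutator.
by rewrite /invmx u scalemxAr scalerA divff // scale1r.
Qed.

(* [X = X1 + 'i X2] with [X1], [X2] skew-hermitian: a polynomial identity on the
   unitaries, Cayley transforms of [X1 + r X2] for [r] real, passes to [r = 'i]. *)
Lemma commutator_cayley (X : 'M[C]_n) i j : \det (1%:M - X) != 0 ->
  commutator t ((1%:M + X) *m invmx (1%:M - X)) i j = 0.
Proof.
move=> d0; pose c : C := 'i%R.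
have i0 : c != 0 by rewrite neq0Ci.
have ci : conjc c = - c by exact: conjCi.
clearbody c; pose X1 := 2^-1 *: (X - X^H); pose X2 := (2 * c)^-1 *: (X + X^H).
have two0 : (2 : C) != 0 by rewrite pnatr_eq0.
have XE : X = X1 + c *: X2.
  rewrite /X1 /X2 scalerA invfM mulrCA divff // mulr1 -scalerDr.
  by rewrite addrACA addNr addr0 -mulr2n -[X *+ 2]scaler_nat scalerA mulVf // scale1r.
have conj2 : conjc (2^-1 : C) = 2^-1 by rewrite fmorphV rmorph_nat.
have adjZ (z : C) (Y : 'M[C]_n) : (z *: Y)^H = conjc z *: Y^H by rewrite map_mxZ linearZ.
have adjK : (X^H)^H = X by exact: adjmxK.
have adjD (Y Z : 'M[C]_n) : (Y + Z)^H = Y^H + Z^H by rewrite map_mxD linearD.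
have adjN (Y : 'M[C]_n) : (- Y)^H = - Y^H by rewrite map_mxN linearN.
have X1H : X1^H = - X1.
  by rewrite adjZ conj2 adjD adjN adjK -scalerN opprB addrC.
have X2H : X2^H = - X2.
  by rewrite adjZ fmorphV rmorphM rmorph_nat /= ci adjD adjK addrC mulrN invrN scaleNr.
pose Xp : 'M[{poly C}]_n := map_mx polyC X1 + 'X *: map_mx polyC X2.
pose B := (1%:M + Xp) *m \adj (1%:M - Xp).
(* The extra determinant makes [q] vanish by itself wherever [1%:M - Y] is singular, so that
   [commutator_adj] is called only with a nonzero determinant. *)
pose q := commutator tP B i j * \det (1%:M - Xp).
have evX z : map_mx (horner_eval z) Xp = X1 + z *: X2.
  by apply/matrixP => a b; rewrite !mxE /horner_eval !hornerE.
have ev1 z : map_mx (horner_eval z) (1%:M - Xp) = 1%:M - (X1 + z *: X2).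
  by rewrite map_mxB map_mx1 evX.
have evq z : q.[z] = commutator t ((1%:M + (X1 + z *: X2)) *m
    \adj (1%:M - (X1 + z *: X2))) i j * \det (1%:M - (X1 + z *: X2)).
  rewrite -[LHS]/(horner_eval z q) rmorphM /= commutator_map -det_map_mx ev1.
  rewrite eval_tP; congr (commutator _ _ _ _ * _).
  by rewrite map_mxM map_mxD map_mx1 map_mx_adj ev1 evX.
have q0 : q = 0.
  apply: poly_nat_roots => k; rewrite evq; set Y := X1 + _.
  have [->|dY] := eqVneq (\det (1%:M - Y)) 0; first by rewrite mulr0.
  rewrite commutator_adj // ht ?mulr0 ?mul0r //; apply: unitary_cayley.
    by rewrite /Y adjD X1H adjZ X2H conjc_nat scalerN opprD.
  by rewrite unitmxE unitfE.
have := evq c; rewrite q0 horner0 -XE => /esym/eqP.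
by rewrite mulf_eq0 (negPf d0) orbF commutator_adj // mulf_eq0 expf_eq0 (negPf d0) andbF => /eqP.
Qed.

(** A matrix [Y] with [1%:M + Y] invertible is the Cayley transform of
    [(Y - 1%:M) *m invmx (1%:M + Y)]. A general [A] is reached through [A + z%:M]: the commutator is
    polynomial in [z], and the exceptional [z] are roots of a monic characteristic polynomial. *)
Lemma commutator_all (A : 'M[C]_n) i j : commutator t A i j = 0.
Proof.
have two0 : (2 : C) != 0 by rewrite pnatr_eq0.
have gen (Y : 'M[C]_n) : \det (1%:M + Y) != 0 -> commutator t Y i j = 0.
  move=> d0; have u : 1%:M + Y \in unitmx by rewrite unitmxE unitfE.
  pose X := (Y - 1%:M) *m invmx (1%:M + Y).
  have h1 : 1%:M - X = 2 *: invmx (1%:M + Y).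
    rewrite -[X in X - _](mulmxV u) -mulmxBl opprB addrACA subrr addr0.
    by rewrite -mulr2n -[_ *+ 2]scaler_nat -scalemxAl mul1mx.
  have h2 : 1%:M + X = (2 *: Y) *m invmx (1%:M + Y).
    rewrite -[X in X + _](mulmxV u) -mulmxDl addrC addrA subrK.
    by rewrite -mulr2n scaler_nat.
  have h3 : (1%:M + X) *m invmx (1%:M - X) = Y.
    have u3 : 1%:M - X \in unitmx by rewrite h1 unitmxZ ?unitfE // unitmx_inv.
    apply: (canLR (mulmxK u3)); rewrite h1 h2 -scalemxAr -scalemxAl.
    by [].
  by rewrite -h3 commutator_cayley // h1 detZ mulf_neq0 ?expf_neq0 // det_inv invr_eq0.
pose Ap : 'M[{poly C}]_n := map_mx polyC A + 'X%:M.
have evA z : map_mx (horner_eval z) Ap = A + z%:M.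
  by apply/matrixP => a b; rewrite !mxE /horner_eval !hornerE hornerMn hornerX.
have evc z : (commutator tP Ap i j).[z] = commutator t (A + z%:M) i j.
  rewrite -[LHS]/(horner_eval z _) commutator_map evA.
  by rewrite eval_tP.
have evd z : (\det (1%:M + Ap)).[z] = \det (1%:M + (A + z%:M)).
  by rewrite -[LHS]/(horner_eval z _) -det_map_mx map_mxD map_mx1 evA.
have : commutator tP Ap i j * \det (1%:M + Ap) = 0.
  apply: poly_nat_roots => k; rewrite hornerM evc evd.
  have [->|dY] := eqVneq (\det (1%:M + (A + k%:R%:M))) 0; first by rewrite mulr0.
  by rewrite gen ?mul0r.
have dn0 : \det (1%:M + Ap) != 0.
  have -> : \det (1%:M + Ap) = char_poly (- (1%:M + A)).
    rewrite /char_poly /char_poly_mx; congr (\det _).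
    by rewrite map_mxN opprK map_mxD map_mx1 addrA addrC.
  exact/monic_neq0/char_poly_monic.
move/eqP; rewrite mulf_eq0 (negPf dn0) orbF => /eqP c0.
by have := evc 0; rewrite c0 horner0 raddf0 addr0.
Qed.

End Cayley.
End SchurWeyl.

(** A row vector lies in the row space of a matrix as soon as it is killed by the cokernel, whose
    columns are solutions of the given equations. *)
Lemma span_of_annihilator (K : fieldType) (J W : finType) (F : J -> W -> K) (t : W -> K) :
  (forall c : W -> K, (forall j, \sum_w F j w * c w = 0) -> \sum_w t w * c w = 0) ->
  exists c : J -> K, forall w, t w = \sum_j c j * F j w.
Proof.
move=> ht.
have sumE (T : finType) (f : 'I_#|T| -> K) : \sum_i f i = \sum_(w : T) f (enum_rank w).
  by rewrite (reindex (@enum_rank T)) //=; exists enum_val => ? _; rewrite ?enum_rankK ?enum_valK.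
pose B : 'M[K]_(#|J|, #|W|) := \matrix_(i, j) F (enum_val i) (enum_val j).
pose v : 'rV[K]_#|W| := \row_j t (enum_val j).
have /submxP[x vx] : (v <= B)%MS.
  rewrite submxE; apply/eqP/matrixP => a i; rewrite !mxE sumE.
  under eq_bigr do rewrite [v _ _]mxE enum_rankK.
  apply: (ht (fun w => cokermx B (enum_rank w) i)) => j.
  have /matrixP/(_ (enum_rank j) i) := mulmx_coker B; rewrite mxE [RHS]mxE sumE => h.
  by rewrite -[RHS]h; apply: eq_bigr => w _; rewrite [B _ _]mxE !enum_rankK.
exists (fun j => x 0 (enum_rank j)) => w.
have /matrixP/(_ 0 (enum_rank w)) := vx; rewrite !mxE enum_rankK => ->.
by rewrite sumE; apply: eq_bigr => j _; rewrite mxE !enum_rankK.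
Qed.

Section SchurWeyl.
Variables (R : realType) (n m : nat).
Local Notation C := R[i].
Local Notation I := (multi_index n m).

Definition perm_index (s : 'S_m) (i : I) : I := [ffun a => i (s a)].

Lemma perm_indexM s s' i : perm_index s (perm_index s' i) = perm_index (s * s')%g i.
Proof. by apply/ffunP => a; rewrite !ffunE permM. Qed.

Lemma perm_index1 i : perm_index 1%g i = i.
Proof. by apply/ffunP => a; rewrite ffunE perm1. Qed.

Lemma perm_indexK s : cancel (perm_index s) (perm_index s^-1%g).
Proof. by move=> i; rewrite perm_indexM mulVg perm_index1. Qed.

Lemma perm_indexKV s : cancel (perm_index s^-1%g) (perm_index s).
Proof. by move=> i; rewrite perm_indexM mulgV perm_index1. Qed.

Lemma perm_index_eq s i j : (perm_index s i == j) = (i == perm_index s^-1%g j).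
Proof. by apply/eqP/eqP => [<-|->]; rewrite ?perm_indexK ?perm_indexKV. Qed.

Variable t : I -> I -> C.
Hypothesis ht : forall U, unitary U -> forall i j, commutator t U i j = 0.

(** Averaging over permutations writes [m!] times [M] as a combination of the symmetrized matrix
    units [Z p q]. Ryser's formula makes each of them a combination of tensor powers of the matrices
    [A p q e], sums of the matrix units at [(p a, q a)] over [a] in [e], and [t] commutes with all
    tensor powers. *)
Lemma commute_invariant (M : I -> I -> C) :
  (forall s i j, M (perm_index s i) (perm_index s j) = M i j) ->
  forall i j, \sum_h t i h * M h j = \sum_h M i h * t h j.
Proof.
move=> hM.
pose Z (p q i j : I) : C := \sum_(s : 'S_m) \prod_b ((p (s b) == i b)%:R * (q (s b) == j b)%:R).
pose A (p q : I) (e : {ffun 'I_m -> bool}) : 'M[C]_n :=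
  \matrix_(x, y) \sum_a (e a)%:R * ((p a == x)%:R * (q a == y)%:R).
pose sg (e : {ffun 'I_m -> bool}) : C := \prod_a (if e a then 1 else -1).
have ZE p q i j : Z p q i j = \sum_e sg e * power_coeff (A p q e) i j.
  rewrite /Z -(ryser_permanent (fun a b => (p a == i b)%:R * (q a == j b)%:R)).
  by apply: eq_bigr => e _; congr (_ * _); apply: eq_bigr => b _; rewrite mxE.
have Zcomm p q i j : \sum_h (t i h * Z p q h j - Z p q i h * t h j) = 0.
  transitivity (\sum_e sg e * commutator t (A p q e) i j); last first.
    by rewrite big1 // => e _; rewrite commutator_all ?mulr0.
  rewrite /commutator; under [RHS]eq_bigr do rewrite mulr_sumr.
  rewrite [RHS]exchange_big; apply: eq_bigr => h _ /=.
  rewrite !ZE mulr_sumr mulr_suml -sumrB; apply: eq_bigr => e _.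
  by rewrite mulrBr; congr (_ - _); ring.
have MZ i j : (m`!)%:R * M i j = \sum_p \sum_q M p q * Z p q i j.
  transitivity (\sum_(s : 'S_m) \sum_p \sum_q (perm_index s p == i)%:R *:
      ((perm_index s q == j)%:R *: (M p q : C^o))).
    transitivity (\sum_(s : 'S_m) M i j).
      by rewrite sumr_const card_Sn mulr_natl.
    apply: eq_bigr => s _; under eq_bigr do rewrite -scaler_sumr.
    under eq_bigr do rewrite perm_index_eq; rewrite sum_delta_r.
    under eq_bigr do rewrite perm_index_eq; rewrite sum_delta_r.
    by rewrite -[RHS](hM s) !perm_indexKV.
  rewrite exchange_big; apply: eq_bigr => p _; rewrite exchange_big.
  apply: eq_bigr => q _ /=; rewrite mulr_sumr; apply: eq_bigr => s _.
  rewrite big_split /= !prod_delta [RHS]mulrC -[RHS]/(_ *: (_ : C^o)) -scalerA.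
  by congr ((nat_of_bool _)%:R *: ((nat_of_bool _)%:R *: _)); rewrite -forall_eq_ffunE; apply: eq_forallb => a; rewrite ffunE.
move=> i j; have f0 : (m`!)%:R != 0 :> C by rewrite pnatr_eq0 -lt0n fact_gt0.
apply: (mulfI f0); apply/eqP; rewrite -subr_eq0 -mulrBr -sumrB mulr_sumr; apply/eqP.
transitivity (\sum_p \sum_q M p q * \sum_h (t i h * Z p q h j - Z p q i h * t h j)).
  under [RHS]eq_bigr do under eq_bigr do rewrite mulr_sumr.
  under [RHS]eq_bigr do rewrite exchange_big; rewrite [RHS]exchange_big.
  apply: eq_bigr => h _ /=; rewrite mulrBr mulrCA MZ [X in _ - X]mulrA MZ.
  rewrite mulr_sumr mulr_suml -sumrB; apply: eq_bigr => p _.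
  rewrite mulr_sumr mulr_suml -sumrB; apply: eq_bigr => q _.
  ring.
by rewrite big1 // => p _; rewrite big1 // => q _; rewrite Zcomm mulr0.
Qed.

(* The orthogonal projection onto the span of the permutation operators commutes
   with them, so its slices are invariant and commute with [t]; hence
   it fixes [t], as it fixes the identity. *)
Theorem schur_weyl :
  exists c : 'S_m -> C, forall i j, t i j = \sum_s c s * (i == perm_index s j)%:R.
Proof.
pose P (s : 'S_m) (x : I * I) : C := (x.1 == perm_index s x.2)%:R.
pose S (f : I * I -> C) := exists s, f = P s.
have [Pi [Ph Pf PL Pa]] := hermitian_projector S.
have inv s j q : forall (i p : I), Pi (perm_index s i, j) (perm_index s p, q) = Pi (i, j) (p, q).
  move=> i p; pose L (y x : I * I) : C := (y == (perm_index s x.1, x.2))%:R.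
  have sumL f x : \sum_y f y * L y x = f (perm_index s x.1, x.2).
    by under eq_bigr do rewrite mulrC; exact: (sum_delta_r (V := C^o)).
  have sumL' f x : \sum_y f y * (L x y)^* = f (perm_index s^-1%g x.1, x.2).
    rewrite -[RHS](sum_delta_r (V := C^o) f); apply: eq_bigr => y _.
    rewrite mulrC /L /= rmorph_nat; congr (_%:R *: (_ : C^o)).
    case: x y => x1 x2 [y1 y2] /=.
    by rewrite !xpair_eqE [x1 == _]eq_sym perm_index_eq [x2 == _]eq_sym.
  have := PL L _ _ (perm_index s i, j) (p, q).
  rewrite sumL /= => ->.
  - have := sumL' (fun y => Pi y (p, q)) (perm_index s i, j).
    rewrite /= perm_indexK => <-; apply: eq_bigr => y _.
    by rewrite mulrC /L rmorph_nat.
  - move=> _ [s' ->]; exists (s^-1 * s')%g; apply: funext => x.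
    by rewrite sumL /P /= perm_index_eq perm_indexM.
  - move=> _ [s' ->]; exists (s * s')%g; apply: funext => x.
    by rewrite sumL' /P /= perm_index_eq invgK perm_indexM.
have tPi y : \sum_x t x.1 x.2 * Pi x y = t y.1 y.2.
  have one h : (h == y.2)%:R = \sum_a Pi (a, a) (h, y.2).
    have S1 : S (P 1%g) by exists 1%g.
    have <- : P 1%g (h, y.2) = (h == y.2)%:R by rewrite /P /= perm_index1.
    rewrite -(Pf _ S1).
    transitivity (\sum_b \sum_a (a == b)%:R *: (Pi (a, b) (h, y.2) : C^o)).
      rewrite exchange_big pair_big; apply: eq_bigr => -[a b] _ /=.
      by rewrite /P /= perm_index1.
    by apply: eq_bigr => b _; rewrite sum_delta_r.
  transitivity (\sum_h t y.1 h * (h == y.2)%:R); last first.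
    under eq_bigr do rewrite mulrC.
    exact: (sum_delta_r (V := C^o) (fun h => t y.1 h)).
  under [RHS]eq_bigr do rewrite one mulr_sumr.
  rewrite [RHS]exchange_big.
  transitivity (\sum_a \sum_h t h a * Pi (h, a) y).
    by rewrite exchange_big pair_big; apply: eq_bigr => -[h a] _.
  apply: eq_bigr => a _ /=.
  have := commute_invariant (M := fun h p => Pi (p, a) (h, y.2)) _ y.1 a.
  rewrite (surjective_pairing y) => ->; first by apply: eq_bigr => h _; rewrite mulrC.
  by move=> s i j; exact: inv.
have [|c hc] := @span_of_annihilator C _ _ P (fun x => t x.1 x.2) _.
  move=> c hc; under eq_bigr do rewrite -tPi mulr_suml.
  rewrite exchange_big big1 // => x _.
  under eq_bigr do rewrite -mulrA; rewrite -mulr_sumr Pa ?mulr0 //.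
  by move=> _ [s ->]; exact: hc.
by exists c => i j; rewrite (hc (i, j)).
Qed.

End SchurWeyl.

(** * Intertwiners attached to partitions *)

Section Points.
Variables k l : nat.

Lemma label_bounds (x : point k l) : (0 < label x <= k + l)%N.
Proof. by case: x => [a|b] /=; [have := ltn_ord a|have := ltn_ord b]; lia. Qed.

Lemma label_inj : injective (@label k l).
Proof.
move=> [a|a] [b|b] /= h; [congr inl| | |congr inr]; try apply: val_inj => /=.
- by case: h.
- by have := ltn_ord a; have := ltn_ord b; lia.
- by have := ltn_ord a; have := ltn_ord b; lia.
- by have := ltn_ord a; have := ltn_ord b; lia.
Qed.

Definition label_point (c : 'I_(k + l)) : point k l :=
  match split c with inl a => inl a | inr b => inr (rev_ord b) end.

Lemma label_label_point c : label (label_point c) = c.+1.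
Proof.
rewrite /label_point; case: splitP => [a ->|b ->] //=.
have := ltn_ord b; lia.
Qed.

Hypothesis ekl : ~~ odd (k + l).
Local Notation m := ((k + l)./2).

Lemma odd_point_subproof (c : 'I_m) : (c.*2 < k + l)%N.
Proof. by have := ltn_ord c; lia. Qed.

Lemma even_point_subproof (c : 'I_m) : (c.*2.+1 < k + l)%N.
Proof. by have := ltn_ord c; move: ekl; lia. Qed.

Definition odd_point (c : 'I_m) : point k l := label_point (Ordinal (odd_point_subproof c)).
Definition even_point (c : 'I_m) : point k l := label_point (Ordinal (even_point_subproof c)).

Lemma label_odd_point c : label (odd_point c) = c.*2.+1.
Proof. by rewrite label_label_point. Qed.

Lemma label_even_point c : label (even_point c) = c.*2.+2.
Proof. by rewrite label_label_point. Qed.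

Lemma odd_point_inj : injective odd_point.
Proof.
by move=> c d /(congr1 (@label k l)); rewrite !label_odd_point => h; apply: val_inj => /=; lia.
Qed.

Lemma even_point_inj : injective even_point.
Proof.
by move=> c d /(congr1 (@label k l)); rewrite !label_even_point => h; apply: val_inj => /=; lia.
Qed.

Lemma pointP x : (exists c, x = odd_point c) \/ (exists c, x = even_point c).
Proof.
have := label_bounds x => /andP[x0 xkl].
have h : ((label x).-1./2 < m)%N by lia.
have [ox|ex] := boolP (odd (label x)); [left|right]; exists (Ordinal h); apply: label_inj.
  by rewrite label_odd_point /=; lia.
by rewrite label_even_point /=; lia.
Qed.

Lemma big_nat_double (A : pzRingType) (N : nat) (F : nat -> A) :
  \prod_(0 <= c < N.*2) F c = \prod_(0 <= c < N) (F c.*2 * F c.*2.+1).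
Proof.
elim: N => [|N IH]; first by rewrite !big_nil.
by rewrite doubleS !big_nat_recr //= IH mulrA.
Qed.

Lemma prod_label_point (A : pzRingType) (F : point k l -> A) :
  \prod_(c < k + l) F (label_point c) = \prod_(c < m) (F (odd_point c) * F (even_point c)).
Proof.
pose G (c : nat) : A := oapp (fun c : 'I_(k + l) => F (label_point c)) 1 (insub c).
have GE (c : nat) (h : (c < k + l)%N) : G c = F (label_point (Ordinal h)).
  by rewrite /G insubT.
transitivity (\prod_(0 <= c < m.*2) G c).
  rewrite (_ : m.*2 = k + l)%N; last by move: ekl; lia.
  by rewrite big_mkord; apply: eq_bigr => -[c h] _; rewrite GE.
rewrite big_nat_double big_mkord; apply: eq_bigr => c _.
by rewrite (GE _ (odd_point_subproof c)) (GE _ (even_point_subproof c)).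
Qed.

Lemma perm_odd_points :
  perm_eq [seq odd_point c | c <- enum 'I_m] [seq x <- enum (point k l) | odd (label x)].
Proof.
apply: uniq_perm; first by rewrite map_inj_uniq ?enum_uniq //; exact: odd_point_inj.
  by rewrite filter_uniq ?enum_uniq.
move=> x; rewrite mem_filter mem_enum andbT; apply/mapP/idP => [[c _ ->]|ox].
  by rewrite label_odd_point /= odd_double.
case: (pointP x) => -[c xc]; first by exists c; rewrite ?mem_enum.
by move: ox; rewrite xc label_even_point /= odd_double.
Qed.

Lemma perm_even_points :
  perm_eq [seq even_point c | c <- enum 'I_m] [seq x <- enum (point k l) | ~~ odd (label x)].
Proof.
apply: uniq_perm; first by rewrite map_inj_uniq ?enum_uniq //; exact: even_point_inj.
  by rewrite filter_uniq ?enum_uniq.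
move=> x; rewrite mem_filter mem_enum andbT; apply/mapP/idP => [[c _ ->]|ox].
  by rewrite label_even_point /= odd_double.
case: (pointP x) => -[c xc]; last by exists c; rewrite ?mem_enum.
by move: ox; rewrite xc label_odd_point /= odd_double.
Qed.

End Points.

Section JointIndex.
Variables (n k l : nat).

Definition joint_index := {ffun point k l -> 'I_n}.
Implicit Types phi psi : joint_index.

Definition join_index (i : multi_index n k) (j : multi_index n l) : joint_index :=
  [ffun x => index_at i j x].
Definition upper_index phi : multi_index n k := [ffun a => phi (inl a)].
Definition lower_index phi : multi_index n l := [ffun b => phi (inr b)].

Lemma joint_indexK phi : join_index (upper_index phi) (lower_index phi) = phi.
Proof. by apply/ffunP => -[a|b]; rewrite !ffunE /= ffunE. Qed.

Lemma upper_indexK i j : upper_index (join_index i j) = i.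
Proof. by apply/ffunP => a; rewrite !ffunE. Qed.

Lemma lower_indexK i j : lower_index (join_index i j) = j.
Proof. by apply/ffunP => b; rewrite !ffunE. Qed.

Lemma sum_joint_index (V : nmodType) (F : joint_index -> V) :
  \sum_phi F phi = \sum_i \sum_j F (join_index i j).
Proof.
rewrite pair_big (reindex (fun ij : multi_index n k * multi_index n l => join_index ij.1 ij.2)) //=.
exists (fun phi => (upper_index phi, lower_index phi)) => [[i j]|phi] _ /=.
  by rewrite upper_indexK lower_indexK.
exact: joint_indexK.
Qed.

Definition block_constant (p : diagram k l) phi : bool :=
  [forall B in p, forall x in B, forall y in B, phi x == phi y].

Lemma deltaE (p : diagram k l) i j : delta p i j = block_constant p (join_index i j).
Proof.
apply: eq_forallb => B; congr (_ ==> _); apply: eq_forallb => x; congr (_ ==> _).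
by apply: eq_forallb => y; rewrite !ffunE.
Qed.

Lemma block_constantP (p : diagram k l) phi :
  reflect (forall B x y, B \in p -> x \in B -> y \in B -> phi x = phi y)
    (block_constant p phi).
Proof.
apply: (iffP forallP) => [h B x y Bp Bx By|h B].
  by have := h B; rewrite Bp => /forallP/(_ x); rewrite Bx => /forallP/(_ y); rewrite By => /eqP.
apply/implyP => Bp; apply/forallP => x; apply/implyP => Bx; apply/forallP => y.
by apply/implyP => By; rewrite (h B x y).
Qed.

End JointIndex.

Section HalfCommutation.
Variables (T : eqType) (A : pzRingType) (U : T -> A).
Hypothesis hU : forall x y z, U x * U y * U z = U z * U y * U x.

Let g (xy : T * T) : A := U xy.1 * U xy.2.

(** Two exchanges of outer letters: [a b c d = c b a d = c d a b]. *)
Lemma half_comm_pairs a b : g a * g b = g b * g a.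
Proof.
by rewrite /g !mulrA hU -!mulrA; congr (_ * _); rewrite !mulrA hU.
Qed.

Lemma half_comm_swap x y x' y' : g (x, y') * g (x', y) = g (x, y) * g (x', y').
Proof. by rewrite /g /= -!mulrA; congr (_ * _); rewrite !mulrA hU. Qed.

Lemma prod_pairs_perm s s' : perm_eq s s' -> \prod_(a <- s) g a = \prod_(a <- s') g a.
Proof.
elim: s s' => [|a s IH] s' ss'; first by move: ss'; rewrite perm_sym => /perm_nilP ->.
have a_s' : a \in s' by rewrite -(perm_mem ss') mem_head.
case/splitPr: a_s' ss' => s1 s2; rewrite perm_sym perm_catC /= perm_cons perm_catC perm_sym.
move=> /IH e; rewrite big_cons e !big_cat big_cons /= (mulrA (g a)) (mulrA _ (g a)).
congr (_ * _).
elim: s1 {e} => [|b s1 IH1]; first by rewrite big_nil mulr1 mul1r.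
by rewrite big_cons (mulrA (g a)) half_comm_pairs -mulrA IH1 (mulrA (g b)).
Qed.

(* The odd letters can be permuted among themselves, and so can the even ones. *)
Lemma half_comm_prod (s s' : seq (T * T)) :
  perm_eq (unzip1 s) (unzip1 s') -> perm_eq (unzip2 s) (unzip2 s') ->
  \prod_(a <- s) g a = \prod_(a <- s') g a.
Proof.
elim: s s' => [|[x y] s IH] s' h1 h2.
  by case: s' h1 {h2} => // a s'; rewrite perm_sym => /perm_nilP.
have [y' xy'] : exists y', (x, y') \in s'.
  have : x \in unzip1 s' by rewrite -(perm_mem h1) mem_head.
  by case/mapP => -[x' y'] xy' ->; exists y'.
have e' := perm_to_rem xy'.
rewrite (prod_pairs_perm e').
have {}h1 : perm_eq (unzip1 s) (unzip1 (rem (x, y') s')).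
  rewrite -(perm_cons x); apply: perm_trans h1 _.
  by have := perm_map fst e'.
have {}h2 : perm_eq (y :: unzip2 s) (y' :: unzip2 (rem (x, y') s')).
  apply: perm_trans h2 _; by have := perm_map snd e'.
move: (rem _ _) h1 h2 => r h1 h2 {e' xy' s'}.
have [yy'|yy'] := eqVneq y y'.
  by rewrite !big_cons -yy' (IH r) //; move: h2; rewrite yy' perm_cons.
(* When [x] has another companion [y'] in [s'], the letter [y] is found in a further pair, and the
   two even letters are exchanged by [half_comm_swap]. *)
have [x2 xy2] : exists x2, (x2, y) \in r.
  have : y \in y' :: unzip2 r by rewrite -(perm_mem h2) mem_head.
  by rewrite inE (negPf yy') => /mapP[[x2 y2] x2r ->]; exists x2.
have e' := perm_to_rem xy2; rewrite !big_cons (prod_pairs_perm e') big_cons.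
rewrite (IH ((x2, y') :: rem (x2, y) r)).
- by rewrite big_cons (mulrA (g (x, y))) (mulrA (g (x, y'))) half_comm_swap.
- by apply: perm_trans h1 _; have := perm_map fst e'.
rewrite -(perm_cons y); apply: perm_trans h2 _ => /=.
have e2 : perm_eq (unzip2 r) (y :: unzip2 (rem (x2, y) r)) by have := perm_map snd e'.
apply: perm_trans (_ : perm_eq _ (y' :: y :: unzip2 (rem (x2, y) r))) _.
  by rewrite perm_cons.
by rewrite (perm_catCA [:: y'] [:: y]).
Qed.

End HalfCommutation.

Section TensorPower.
Variables (R : realType) (n : nat) (A : starAlgType R) (u : 'M[A]_n).
Hypothesis ou : orthogonal_coords u.

Let su : forall i j, star (u i j) = u i j. Proof. by case: ou. Qed.

Definition cons_index k (x : 'I_n) (i : multi_index n k) : multi_index n k.+1 :=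
  [ffun a => oapp i x (unlift ord0 a)].

Lemma sum_cons_index k (V : nmodType) (F : multi_index n k.+1 -> V) :
  \sum_i F i = \sum_i \sum_x F (cons_index x i).
Proof.
rewrite pair_big (reindex (fun ix : multi_index n k * 'I_n => cons_index ix.2 ix.1)) //=.
exists (fun i : multi_index n k.+1 => ([ffun a => i (lift ord0 a)], i ord0)).
  move=> [i x] _ /=; congr pair; last by rewrite ffunE unlift_none.
  by apply/ffunP => a; rewrite !ffunE liftK.
move=> i _; apply/ffunP => a; rewrite ffunE /=.
by case: unliftP => [b ->|->] //=; rewrite ffunE.
Qed.

(** The star reverses the product, so the two first letters meet in the middle, where the relation
    [u^T *m u = 1] contracts them. *)
Lemma tensor_power_orthonormal k (i j : multi_index n k) :
  \sum_h star (tensor_power u h i) * tensor_power u h j = (i == j)%:R.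
Proof.
have [_ _ uu] := ou.
rewrite -forall_eq_ffunE; elim: k i j => [|k IH] i j.
  have -> : [forall a, i a == j a] by apply/forallP => -[].
  rewrite (eq_bigr (fun=> 1)); last by move=> h _; rewrite /tensor_power !big_ord0 star1 mulr1.
  by rewrite sumr_const card_ffun !card_ord expn0.
rewrite sum_cons_index /tensor_power.
pose r (h : multi_index n k.+1) : multi_index n k := [ffun a => h (lift ord0 a)].
have tpS x h (i' : multi_index n k.+1) : \prod_(a < k.+1) u (cons_index x h a) (i' a) =
    u x (i' ord0) * tensor_power u h (r i').
  rewrite big_ord_recl !ffunE unlift_none /=; congr (_ * _).
  by apply: eq_bigr => a _; rewrite !ffunE liftK.
under eq_bigr => h _.
  under eq_bigr do rewrite !tpS starM su !mulrA -[_ * u _ _ * u _ _]mulrA.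
  rewrite -mulr_suml -mulr_sumr.
  have -> : \sum_x u x (i ord0) * u x (j ord0) = (i ord0 == j ord0)%:R.
    have /matrixP/(_ (i ord0) (j ord0)) := uu; rewrite !mxE => <-.
    by apply: eq_bigr => x _; rewrite !mxE.
  over.
have -> : [forall a, i a == j a] = (i ord0 == j ord0) && [forall a, r i a == r j a].
  apply/forallP/andP => [h|[h0 /forallP h] a].
    by split => //; apply/forallP => a; rewrite !ffunE.
  by case: (unliftP ord0 a) => [b ->|->] //; have := h b; rewrite !ffunE.
case: (i ord0 == j ord0); last by rewrite big1 // => h _; rewrite mulr0 mul0r.
by under eq_bigr do rewrite mulr1; rewrite IH.
Qed.

End TensorPower.

Lemma prod_bool (A : pzRingType) (I : finType) (b : I -> bool) :
  \prod_i (b i)%:R = [forall i, b i]%:R :> A.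
Proof.
have -> : \prod_i (b i)%:R = (\prod_i nat_of_bool (b i))%N%:R :> A.
  by apply: (big_rec2 (fun x y => x = y%:R)) => // i y1 y2 _ ->; rewrite natrM.
congr (_%:R); case: forallP => [h|/forallP]; first by rewrite big1 // => i _; rewrite h.
by rewrite negb_forall => /existsP[i bi]; rewrite (bigD1 i) //= (negPf bi) mul0n.
Qed.

Lemma filter_flatten_partition (T : finType) (p : {set {set T}}) (P : pred T) :
  partition p [set: T] ->
  perm_eq (flatten [seq [seq x <- enum B | P x] | B : {set T} <- enum p])
    [seq x <- enum T | P x].
Proof.
move=> pp; apply/seq.permP => a; rewrite count_flatten -map_comp.
rewrite sumnE big_map big_enum /=.
transitivity (\sum_(B in p) \sum_(x in B | P x && a x) 1)%N.
  apply: eq_bigr => B _; rewrite -sum1_count big_filter_cond big_enum_cond.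
  by [].
rewrite -(set_partition_big_cond _ pp) -sum1_count big_filter_cond big_enum_cond.
by apply: eq_bigl => x; rewrite !inE.
Qed.

Lemma mem_zip (T : eqType) (s t : seq T) a : a \in zip s t -> a.1 \in s /\ a.2 \in t.
Proof.
elim: s t => [|x s IH] [|y t] //=; rewrite !inE => /orP[/eqP -> /=|/IH[-> ->]].
  by rewrite !eqxx.
by rewrite !orbT.
Qed.

Lemma prod_enumT (A : pzRingType) (T : finType) (F : T -> A) :
  \prod_(x <- enum T) F x = \prod_x F x.
Proof. by rewrite [index_enum _]unlock enumT. Qed.

Lemma prod_enum_val (A : pzRingType) (T : finType) (B : {set T}) (F : T -> A) (x0 : T) :
  \prod_(x <- enum B) F x = \prod_(j < #|B|) F (enum_val j).
Proof.
rewrite (big_nth x0) -cardE big_mkord; apply: eq_bigr => j _.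
by rewrite (enum_val_nth x0).
Qed.

Lemma size_filter_enum (T : finType) (B : {set T}) (P : pred T) :
  size [seq x <- enum B | P x] = #|[set x in B | P x]|.
Proof.
rewrite size_filter -sum1_count big_enum_cond -sum1_card.
by apply: eq_bigl => x; rewrite !inE.
Qed.

Section FixedVector.
Variables (R : realType) (n : nat) (A : starAlgType R) (u : 'M[A]_n).
Hypothesis ou : orthogonal_coords u.
Hypothesis hcomm : forall i j k l s t,
  u i j * u k l * u s t = u s t * u k l * u i j.
Variables (k l : nat) (p : diagram k l).
Hypothesis pE : p \in E_h k l.

Definition odds (B : {set point k l}) := [seq x <- enum B | odd (label x)].
Definition evens (B : {set point k l}) := [seq x <- enum B | ~~ odd (label x)].

(** The contribution of one block to [fixed_vector], with [x] the common value of [psi] on it. Any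
    matching of odd with even legs would do; [zip] takes the one given by enumeration. *)
Definition block_sum (phi : joint_index n k l) (B : {set point k l}) : A :=
  \sum_x \prod_(a <- zip (odds B) (evens B)) (u (phi a.1) x * u (phi a.2) x).

Hypothesis hblock : forall phi B, B \in p ->
  block_sum phi B = [forall x in B, forall y in B, phi x == phi y]%:R.

Let pp : partition p [set: point k l]. Proof. by case/in_E_hP: pE. Qed.

Lemma size_odds B : B \in p -> size (odds B) = size (evens B).
Proof.
move=> Bp; have [_ /(_ B Bp) /eqP] := in_E_hP _ pE; rewrite -balancedE => /eqP h.
by rewrite /odds /evens !size_filter_enum h.
Qed.

(** In label order odd and even legs alternate. Half-commutation permutes the odd legs among
    themselves and the even legs among themselves, so balanced blocks can be gathered one after the
    other. *)
Lemma prod_blocks (phi psi : joint_index n k l) :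
  \prod_(c < k + l) u (phi (label_point c)) (psi (label_point c)) =
  \prod_(B <- enum p) \prod_(a <- zip (odds B) (evens B))
    (u (phi a.1) (psi a.1) * u (phi a.2) (psi a.2)).
Proof.
have ekl := E_h_even pE; pose U x := u (phi x) (psi x).
rewrite (prod_label_point ekl U).
transitivity (\prod_(a <- [seq (odd_point ekl c, even_point ekl c) | c <- enum 'I_((k + l)./2)])
    (U a.1 * U a.2)).
  by rewrite big_map prod_enumT.
rewrite (@half_comm_prod _ _ U _ _ (flatten [seq zip (odds B) (evens B) | B <- enum p])).
- by rewrite big_flatten big_map.
- by move=> x y z; exact: hcomm.
- have -> : unzip1 (flatten [seq zip (odds B) (evens B) | B <- enum p]) =
      flatten [seq odds B | B <- enum p].
    rewrite /unzip1 map_flatten -map_comp; congr flatten.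
    apply/eq_in_map => B; rewrite mem_enum => Bp /=.
    by rewrite -/(unzip1 _) unzip1_zip // size_odds.
  rewrite perm_sym; apply: perm_trans (filter_flatten_partition _ pp) _.
  by rewrite perm_sym /unzip1 -map_comp; exact: perm_odd_points.
- have -> : unzip2 (flatten [seq zip (odds B) (evens B) | B <- enum p]) =
      flatten [seq evens B | B <- enum p].
    rewrite /unzip2 map_flatten -map_comp; congr flatten.
    apply/eq_in_map => B; rewrite mem_enum => Bp /=.
    by rewrite -/(unzip2 _) unzip2_zip // size_odds.
  rewrite perm_sym; apply: perm_trans (filter_flatten_partition _ pp) _.
  by rewrite perm_sym /unzip2 -map_comp; exact: perm_even_points.
Qed.

(* Rotating all points to one row, in the order of the labels, turns the
   intertwining relation for [T_ p] into the invariance of a vector. *)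
Lemma fixed_vector (phi : joint_index n k l) :
  \sum_psi (block_constant p psi)%:R *:
    \prod_(c < k + l) u (phi (label_point c)) (psi (label_point c)) =
  (block_constant p phi)%:R.
Proof.
have /choice[r rP] : forall j : 'I_#|p|, exists x, x \in (enum_val j : {set point k l}).
  move=> j; apply/set0Pn.
  by apply: (partition_neq0 pp); exact: enum_valP.
have /choice[idx idxP] : forall x, exists j : 'I_#|p|, x \in (enum_val j : {set point k l}).
  move=> x; have : x \in cover p by rewrite (cover_partition pp) inE.
  by case/bigcupP => B Bp Bx; exists (enum_rank_in Bp B); rewrite enum_rankK_in.
have idx_eq x j : x \in (enum_val j : {set _}) -> idx x = j.
  move=> xj; apply: enum_val_inj.
  rewrite -(def_pblock (partition_trivIset pp) (enum_valP (idx x)) (idxP x)).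
  exact: (def_pblock (partition_trivIset pp) (enum_valP j) xj).
pose G (B : {set point k l}) x : A :=
  \prod_(a <- zip (odds B) (evens B)) (u (phi a.1) x * u (phi a.2) x).
transitivity (\sum_(psi : joint_index n k l | block_constant p psi)
    \prod_(j < #|p|) G (enum_val j) (psi (r j))).
  rewrite [RHS]big_mkcond; apply: eq_bigr => psi _.
  have [bc|_] := boolP (block_constant p psi); last by rewrite scale0r.
  rewrite scale1r prod_blocks (prod_enum_val _ _ set0); apply: eq_bigr => j _.
  rewrite /G !big_seq; apply: eq_bigr => a /mem_zip[a1 a2].
  have const x : x \in (enum_val j : {set _}) -> psi x = psi (r j).
    by move=> xj; apply: (block_constantP _ _ bc (enum_val j)) => //; exact: enum_valP.
  by rewrite !const //; [move: a2|move: a1]; rewrite mem_filter mem_enum => /andP[].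
(* Block-constant indices are parametrized by functions on the set of blocks, through [idx] (the
   block of a point) and [r] (a point in each block); the sum then factors over the blocks. *)
rewrite (reindex (fun f : {ffun 'I_#|p| -> 'I_n} => [ffun x => f (idx x)] : joint_index n k l)) /=;
  last first.
  exists (fun psi => [ffun j => psi (r j)]) => [f _|psi bc].
    by apply/ffunP => j; rewrite !ffunE (idx_eq _ j).
  apply/ffunP => x; rewrite !ffunE.
  by apply: (block_constantP _ _ bc (enum_val (idx x))) => //; exact: enum_valP.
transitivity (\sum_(f : {ffun 'I_#|p| -> 'I_n}) \prod_(j < #|p|) G (enum_val j) (f j)).
  apply: eq_big => [f|f _].
    apply/block_constantP => B x y Bp Bx By; rewrite !ffunE.
    rewrite (idx_eq x (enum_rank_in Bp B)) ?(idx_eq y (enum_rank_in Bp B)) ?enum_rankK_in //.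
  by apply: eq_bigr => j _; rewrite ffunE (idx_eq _ j).
rewrite -(bigA_distr_bigA (fun j x => G (enum_val j) x)) /=.
under eq_bigr do rewrite -/(block_sum phi _) hblock ?enum_valP //.
rewrite prod_bool; congr (nat_of_bool _)%:R.
apply/forallP/forallP => [h B|h j].
  by apply/implyP => Bp; have := h (enum_rank_in Bp B); rewrite enum_rankK_in.
by have := h (enum_val j); rewrite enum_valP.
Qed.

(** Clockwise labels run through the lower row from right to left, which is the order produced by
    the star of a monomial in self-adjoint letters. *)
Lemma prod_label_split (i i' : multi_index n k) (j j' : multi_index n l) :
  \prod_(c < k + l) u (join_index i j (label_point c)) (join_index i' j' (label_point c)) =
  tensor_power u i i' * star (tensor_power u j j').
Proof.
have [su _ _] := ou; rewrite big_split_ord; congr (_ * _).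
  by apply: eq_bigr => a _; rewrite /label_point (unsplitK (inl a)) !ffunE.
rewrite /tensor_power.
have -> : star (\prod_(a < l) u (j a) (j' a)) = \prod_(a < l) u (j (rev_ord a)) (j' (rev_ord a)).
  elim: l j j' => [|l' IH] j1 j2; first by rewrite !big_ord0 star1.
  rewrite big_ord_recl starM su [RHS]big_ord_recr /=; congr (_ * _).
    pose r (h : multi_index n l'.+1) : multi_index n l' := [ffun a => h (lift ord0 a)].
    rewrite (eq_bigr (fun a => u (r j1 a) (r j2 a))); last by move=> a _; rewrite !ffunE.
    rewrite IH; apply: eq_bigr => a _; rewrite !ffunE.
    have -> : lift ord0 (rev_ord a) = rev_ord (widen_ord (leqnSn l') a).
      by apply: val_inj => /=; rewrite /bump /=; have := ltn_ord a; lia.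
    by [].
  have -> : rev_ord (@ord_max l') = ord0 by apply: val_inj => /=; lia.
  by [].
by apply: eq_bigr => a _; rewrite /label_point (unsplitK (inr a)) !ffunE.
Qed.

(** Frobenius reciprocity. The star of the fixed-vector identity writes [delta p i1 j] as a sum of
    terms with right factor [star (tensor_power u i1 i')]; multiplying by [tensor_power u i1 i] and
    summing over [i1] removes it by orthonormality. *)
Lemma partition_intertwines : intertwines u (T_ R n p).
Proof.
have [su _ _] := ou.
move=> i j; under eq_bigr do rewrite T_basis sum_ffunE.
have TE i' j' : (\sum_j0 (delta p i' j0)%:R *: basis_tensor R j0) j' =
    (delta p i' j')%:R :> R[i].
  rewrite sum_ffunE; under eq_bigr do rewrite !ffunE.
  rewrite (bigD1 j') //= eqxx big1 ?addr0; first exact: mulr1.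
  by move=> j0 jj; rewrite eq_sym (negPf jj); exact: mulr0.
under eq_bigr do rewrite -sum_ffunE TE.
under [RHS]eq_bigr do rewrite T_basis TE.
have fix1 i1 : \sum_i' \sum_j' (delta p i' j')%:R *:
    (tensor_power u j j' * star (tensor_power u i1 i')) = (delta p i1 j)%:R.
  have := fixed_vector (join_index i1 j); rewrite sum_joint_index => /(congr1 star).
  rewrite !star_sum deltaE => h.
  have -> : (block_constant p (join_index i1 j))%:R =
      star (block_constant p (join_index i1 j))%:R :> A.
    by case: block_constant; rewrite ?star1 ?star0.
  rewrite -h; apply: eq_bigr => i' _; rewrite star_sum; apply: eq_bigr => j' _.
  by rewrite starZ deltaE prod_label_split starM starK; case: block_constant;
    rewrite ?conjC1 ?conjC0.
transitivity (\sum_i1 (delta p i1 j)%:R * tensor_power u i1 i).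
  by apply: eq_bigr => i1 _; case: delta; rewrite ?scale1r ?mul1r ?scale0r ?mul0r.
under [LHS]eq_bigr do rewrite -fix1 mulr_suml.
rewrite [LHS]exchange_big.
transitivity (\sum_i' (i' == i)%:R *: \sum_j' (delta p i' j')%:R *: tensor_power u j j');
  last exact: sum_delta_r.
apply: eq_bigr => i' _; under eq_bigr do rewrite mulr_suml.
rewrite exchange_big scaler_sumr; apply: eq_bigr => j' _ /=.
under eq_bigr do rewrite -scalerAl -mulrA.
rewrite -scaler_sumr -mulr_sumr tensor_power_orthonormal //.
by case: (i' == i); rewrite ?mulr1 ?scale1r // mulr0 scaler0 scale0r.
Qed.

End FixedVector.

Section BlockSums.
Variables (R : realType) (n : nat) (A : starAlgType R) (u : 'M[A]_n).
Hypothesis ou : orthogonal_coords u.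
Hypothesis hcomm : forall i j k l s t,
  u i j * u k l * u s t = u s t * u k l * u i j.

Lemma mem_odds k l (B : {set point k l}) x : (x \in odds B) = (x \in B) && odd (label x).
Proof. by rewrite mem_filter mem_enum andbC. Qed.

Lemma mem_evens k l (B : {set point k l}) x : (x \in evens B) = (x \in B) && ~~ odd (label x).
Proof. by rewrite mem_filter mem_enum andbC. Qed.

Lemma row_orthogonal i j : \sum_x u i x * u j x = (i == j)%:R.
Proof.
have [_ /matrixP/(_ i j)] := ou; rewrite !mxE => <- _.
by apply: eq_bigr => x _; rewrite mxE.
Qed.

Lemma all_zip_block k l (p : diagram k l) (B : {set point k l})
    (phi : joint_index n k l) a s : p \in E_h k l -> B \in p ->
  zip (odds B) (evens B) = a :: s ->
  all (fun b => (phi b.1 == phi a.1) && (phi b.2 == phi a.1)) (a :: s) =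
  [forall x in B, forall y in B, phi x == phi y].
Proof.
move=> pE Bp zE; have sz := size_odds pE Bp.
have aB : a.1 \in B.
  have /mem_zip[] : a \in zip (odds B) (evens B) by rewrite zE mem_head.
  by rewrite mem_odds => /andP[].
apply/allP/forallP => [h x|h b].
  have const y : y \in B -> phi y = phi a.1.
    move=> By; have [oy|ey] := boolP (odd (label y)).
      have : y \in unzip1 (zip (odds B) (evens B)) by rewrite unzip1_zip ?sz // mem_odds By.
      by rewrite zE => /mapP[b /h /andP[/eqP bb _] ->].
    have : y \in unzip2 (zip (odds B) (evens B)) by rewrite unzip2_zip ?sz // mem_evens By.
    by rewrite zE => /mapP[b /h /andP[_ /eqP bb] ->].
  apply/implyP => Bx; apply/forallP => y; apply/implyP => By.
  by rewrite (const x) // (const y).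
rewrite -zE => /mem_zip[]; rewrite mem_odds mem_evens => /andP[B1 _] /andP[B2 _].
have := h b.1; rewrite B1 => /forallP/(_ a.1); rewrite aB /= => ->.
by have := h b.2; rewrite B2 => /forallP/(_ a.1); rewrite aB.
Qed.

Lemma zip_block_cons k l (p : diagram k l) (B : {set point k l}) :
  p \in E_h k l -> B \in p -> exists a s, zip (odds B) (evens B) = a :: s.
Proof.
move=> pE Bp; have sz := size_odds pE Bp.
have [pp _] := in_E_hP _ pE; have /set0Pn[x Bx] := partition_neq0 pp Bp.
have [ox|ex] := boolP (odd (label x)).
  have : x \in odds B by rewrite mem_odds Bx.
  by case: (odds B) sz => // y s; case: (evens B) => // z t _ _; exists (y, z), (zip s t).
have : x \in evens B by rewrite mem_evens Bx.
by case: (evens B) sz => // y s; case: (odds B) => // z t _ _; exists (z, y), (zip t s).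
Qed.

(** A block of a pairing yields a single pair, so its [block_sum] is an entry of [u *m u^T]. *)
Lemma E_o_intertwines k l p : p \in E_o k l -> intertwines u (T_ R n p).
Proof.
move=> /in_E_oP[pE p2]; apply: partition_intertwines => // phi B Bp.
have [a [s zE]] := zip_block_cons pE Bp.
rewrite -(all_zip_block phi pE Bp zE) /block_sum zE.
have -> : s = [::].
  have := congr1 size zE; rewrite size1_zip ?(size_odds pE Bp) //= => sE.
  have := p2 B Bp; rewrite card_odd_even -!size_filter_enum -/(odds B) -/(evens B).
  rewrite (size_odds pE Bp) sE.
  by case: s {zE sE} => //= b s; rewrite !addSn addnS.
under eq_bigr do rewrite big_seq1.
by rewrite row_orthogonal /= eqxx andbT eq_sym.
Qed.

Section Cubic.
Hypothesis hcub : forall i j k, j != k -> u i j * u i k = 0 /\ u j i * u k i = 0.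

Lemma cubic_col r s x : u r x * u s x = (r == s)%:R * (u r x * u r x).
Proof.
have [->|rs] := eqVneq r s; first by rewrite mul1r.
by rewrite mul0r; exact: (hcub x rs).2.
Qed.

(** Multiplication by [1], written as the sum of the squares in row [r], leaves only the term in
    column [x]. *)
Lemma cubic_cube r x : u r x * (u r x * u r x) = u r x.
Proof.
rewrite -[RHS]mulr1 -(_ : \sum_y u r y * u r y = 1); last by rewrite row_orthogonal eqxx.
rewrite mulr_sumr (bigD1 x) //= big1 ?addr0 // => y yx.
by rewrite mulrA (hcub r _).1 ?mul0r // eq_sym.
Qed.

Lemma cubic_idem r x : u r x * u r x * (u r x * u r x) = u r x * u r x.
Proof. by rewrite -mulrA cubic_cube. Qed.

(** The squares of the entries of one column are mutually orthogonal idempotents, so a product of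
    pairs collapses to one square, or to 0 if two rows differ. *)
Lemma cubic_word (T : Type) (phi : T -> 'I_n) x (a : T * T) (s : seq (T * T)) :
  \prod_(b <- a :: s) (u (phi b.1) x * u (phi b.2) x) =
  (all (fun b => (phi b.1 == phi a.1) && (phi b.2 == phi a.1)) (a :: s))%:R *
    (u (phi a.1) x * u (phi a.1) x).
Proof.
elim: s a => [|b s IH] a.
  by rewrite big_seq1 cubic_col /= eqxx andbT eq_sym.
rewrite big_cons IH cubic_col /= !eqxx /=.
have [e1|_] := eqVneq (phi a.1) (phi a.2); last by rewrite !mul0r.
rewrite mul1r.
have [e2|ne2] := eqVneq (phi b.1) (phi a.1).
  rewrite e2 /=; case: (_ && _) => /=; last by rewrite !mul0r mulr0.
  by rewrite !mul1r cubic_idem.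
rewrite /= mul0r; case: (_ && _) => /=; last by rewrite mul0r mulr0.
rewrite mul1r -mulrA (mulrA _ (u (phi b.1) x)) (cubic_col (phi a.1) (phi b.1)).
by rewrite [phi a.1 == phi b.1]eq_sym (negPf ne2) !mul0r mulr0.
Qed.

(** By [cubic_word] a block of any size contributes a sum of squares along one row, which is 1. *)
Lemma E_h_intertwines k l p : p \in E_h k l -> intertwines u (T_ R n p).
Proof.
move=> pE; apply: partition_intertwines => // phi B Bp.
have [a [s zE]] := zip_block_cons pE Bp.
rewrite -(all_zip_block phi pE Bp zE) /block_sum zE.
under eq_bigr do rewrite cubic_word.
by rewrite -mulr_sumr row_orthogonal eqxx mulr1.
Qed.

End Cubic.
End BlockSums.

(** * Invariants of the parameter groups *)

Lemma perm_extension (T : finType) (S : {set T}) (f : T -> T) :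
  {in S &, injective f} -> exists s : {perm T}, {in S, forall x, s x = f x}.
Proof.
have [m] := ubnP #|S|; elim: m S => // m IH S Sm fi.
have [->|/set0Pn[x Sx]] := eqVneq S set0; first by exists 1%g => x; rewrite inE.
have [||s sf] := IH (S :\ x).
- by have := cardsD1 x S; rewrite Sx; lia.
- by move=> y z /setD1P[_ Sy] /setD1P[_ Sz]; exact: fi.
(* The transposition corrects the value at [x]; it moves neither [s x] for other points of [S] nor
   their images under [f], by injectivity. *)
exists (s * tperm (s x) (f x))%g => y Sy; have [->|yx] := eqVneq y x.
  by rewrite permM tpermL.
have sy : s y = f y by apply: sf; rewrite !inE yx.
rewrite permM tpermD ?sy // -?sy ?(inj_eq perm_inj) 1?eq_sym // sy.
by apply: contra yx => /eqP fxy; apply/eqP; apply: fi.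
Qed.

Section Spans.
Variables (R : realType) (n : nat).
Local Notation C := R[i].
Local Notation tens k := {ffun multi_index n k -> R[i]^o}.
Variables k l : nat.

Lemma hom_ext (T T' : 'Hom(tens k, tens l)) :
  (forall i j, T (basis_tensor R i) j = T' (basis_tensor R i) j) -> T = T'.
Proof.
move=> TT; apply/lfunP => x.
have -> : x = \sum_i x i *: basis_tensor R i.
  apply/ffunP => j; rewrite sum_ffunE; under eq_bigr do rewrite !ffunE.
  rewrite (bigD1 j) //= eqxx big1 ?addr0; first exact: esym (mulr1 _).
  by move=> i ij; rewrite eq_sym (negPf ij); exact: mulr0.
rewrite !linear_sum; apply: eq_bigr => i _; rewrite !linearZ; congr (_ *: _).
by apply/ffunP => j; exact: TT.
Qed.

Lemma T_coeff (p : diagram k l) i j : T_ R n p (basis_tensor R i) j = (delta p i j)%:R :> C.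
Proof.
rewrite T_basis sum_ffunE; under eq_bigr do rewrite !ffunE.
rewrite (bigD1 j) //= eqxx big1 ?addr0; first exact: mulr1.
by move=> j0 jj; rewrite eq_sym (negPf jj); exact: mulr0.
Qed.

Lemma mem_span_T (D : {set diagram k l}) (J : finType) (c : J -> C)
    (p : J -> diagram k l) (T : 'Hom(tens k, tens l)) :
  (forall a, p a \in D) ->
  (forall i j, T (basis_tensor R i) j = \sum_a c a * (delta (p a) i j)%:R) ->
  T \in <<[seq T_ R n q | q in D]>>%VS.
Proof.
move=> pD Tc; have -> : T = \sum_a c a *: T_ R n (p a).
  apply: hom_ext => i j; rewrite Tc sum_lfunE sum_ffunE; apply: eq_bigr => a _.
  by rewrite scale_lfunE ffunE T_coeff.
apply: memv_suml => a _; apply: memvZ; apply: memv_span.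
by apply/imageP; exists (p a).
Qed.

Definition joint_coeff (t : multi_index n l -> multi_index n k -> C)
  (phi : joint_index n k l) : C := t (lower_index phi) (upper_index phi).

(** The matrix [-1] acts by [(-1) ^+ k] on one side and [(-1) ^+ l] on the other. *)
Lemma alt_intertwines_odd (G : 'M[C]_n -> Prop) (t : multi_index n l -> multi_index n k -> C) :
  G (- 1%:M) -> odd (k + l) -> alt_intertwines G t -> forall i j, t j i = 0.
Proof.
move=> G1 okl ht i j; have := ht _ G1 i j.
under eq_bigr do rewrite altN alt1 mulrCA.
under [X in _ = X -> _]eq_bigr do rewrite altN alt1 -mulrA.
rewrite -!mulr_sumr.
have -> : \sum_i' t j i' * (i' == i)%:R = t j i.
  by under eq_bigr do rewrite mulrC; exact: (sum_delta_r (V := C^o)).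
rewrite (sum_delta_l (V := C^o) (fun j' => t j' i)).
rewrite -(signr_odd _ k) -(signr_odd _ l) => /eqP; rewrite -subr_eq0 -mulrBl mulf_eq0 => /orP[|/eqP //].
rewrite oddD in okl; case: (odd k) (odd l) okl => -[] //= _.
  by rewrite expr1 expr0 -opprD oppr_eq0 -mulr2n pnatr_eq0.
by rewrite expr1 expr0 opprK -mulr2n pnatr_eq0.
Qed.

(** Unitarity moves the upper factor to the other side, conjugated. The upper position [a], counted
    from 0, has label [a + 1] and the label of a lower position has its parity, so conjugates sit
    exactly at the odd labels. *)
Lemma alt_intertwines_invariant (G : 'M[C]_n -> Prop)
    (t : multi_index n l -> multi_index n k -> C) U : ~~ odd (k + l) ->
  unitary U -> G U -> alt_intertwines G t -> forall phi,
  joint_coeff t phi = \sum_psi joint_coeff t psi *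
    \prod_x conj_if (odd (label x)) (U (phi x) (psi x)).
Proof.
move=> ekl uU GU ht phi.
have prodE (psi : joint_index n k l) : \prod_x conj_if (odd (label x)) (U (phi x) (psi x)) =
    (alt U (upper_index phi) (upper_index psi))^* *
    alt U (lower_index phi) (lower_index psi).
  rewrite big_sumType /alt rmorph_prod; congr (_ * _); apply: eq_bigr => a _ /=.
    rewrite !ffunE /conj_if; case: (odd a) => //=.
    by apply: esym; exact: conjcK.
  rewrite !ffunE; congr conj_if; have := ltn_ord a; lia.
under eq_bigr do rewrite prodE.
rewrite sum_joint_index /joint_coeff.
under eq_bigr do under eq_bigr do rewrite upper_indexK lower_indexK.
set i := upper_index phi; set j := lower_index phi.
transitivity (\sum_i' (\sum_h t j h * alt U h i') * (alt U i i')^*).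
  under eq_bigr do rewrite mulr_suml; rewrite exchange_big /=.
  transitivity (\sum_h (h == i)%:R *: (t j h : C^o)); first by rewrite sum_delta_r.
  have adjE i' : Num.conj (alt U i i') = alt U^H i' i by rewrite alt_adj.
  apply: eq_bigr => h _; under eq_bigr do rewrite -mulrA adjE.
  rewrite -mulr_sumr -alt_mul uU alt1.
  by rewrite mulrC.
apply: eq_bigr => i' _; rewrite ht // mulr_suml; apply: eq_bigr => j' _.
ring.
Qed.

End Spans.

Section PairingOfPermutation.
Variables (k l : nat).
Hypothesis ekl : ~~ odd (k + l).
Local Notation m := ((k + l)./2).

Lemma half_index_subproof (x : point k l) : ((label x).-1./2 < m)%N.
Proof. by have := label_bounds x; lia. Qed.

Definition half_index (x : point k l) : 'I_m := Ordinal (half_index_subproof x).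

Lemma half_odd_point c : half_index (odd_point ekl c) = c.
Proof. by apply: val_inj => /=; rewrite label_odd_point; lia. Qed.

Lemma half_even_point c : half_index (even_point ekl c) = c.
Proof. by apply: val_inj => /=; rewrite label_even_point; lia. Qed.

(** Each string is named by its odd end: the even point [c] is joined to the odd point [s c]. *)
Definition pairing_class (s : 'S_m) (x : point k l) : 'I_m :=
  if odd (label x) then half_index x else s (half_index x).

Lemma pairing_class_odd s c : pairing_class s (odd_point ekl c) = c.
Proof. by rewrite /pairing_class label_odd_point /= odd_double half_odd_point. Qed.

Lemma pairing_class_even s c : pairing_class s (even_point ekl c) = s c.
Proof. by rewrite /pairing_class label_even_point /= odd_double half_even_point. Qed.

Definition perm_pairing (s : 'S_m) : diagram k l :=
  preim_partition (pairing_class s) [set: point k l].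

Lemma perm_pairing_block s B : B \in perm_pairing s ->
  exists c, B = [set odd_point ekl (s c); even_point ekl c].
Proof.
move=> /imsetP[x _ ->].
have [c xc] : exists c, pairing_class s x = s c.
  by exists (s^-1%g (pairing_class s x)); rewrite permKV.
exists c; apply/setP => y; rewrite !inE /= xc eq_sym.
case: (pointP ekl y) => -[d ->].
  rewrite pairing_class_odd (inj_eq (@odd_point_inj k l ekl)) orbC.
  by rewrite (negPf (_ : odd_point ekl d != even_point ekl c)) //; apply/eqP => /(congr1 (@label k l));
    rewrite label_odd_point label_even_point; lia.
rewrite pairing_class_even (inj_eq perm_inj) (inj_eq (@even_point_inj k l ekl)).
by rewrite (negPf (_ : even_point ekl d != odd_point ekl (s c))) //; apply/eqP => /(congr1 (@label k l));
  rewrite label_odd_point label_even_point; lia.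
Qed.

Lemma odd_even_point c d : odd_point ekl c != even_point ekl d.
Proof.
by apply/eqP => /(congr1 (@label k l)); rewrite label_odd_point label_even_point; lia.
Qed.

Lemma perm_pairing_E_o s : perm_pairing s \in E_o k l.
Proof.
apply/in_E_oP; split; last first.
  by move=> B /perm_pairing_block[c ->]; rewrite cards2 odd_even_point.
apply/in_E_hP; split; first exact: preim_partitionP.
move=> B /perm_pairing_block[c ->]; rewrite /total_weight big_setU1 ?inE ?odd_even_point //=.
by rewrite big_set1 /weight label_odd_point label_even_point /= !odd_double expr1 expr0 addNr.
Qed.

Lemma perm_pairing_constant n s (phi : joint_index n k l) :
  block_constant (perm_pairing s) phi =
  [forall c, phi (even_point ekl c) == phi (odd_point ekl (s c))].
Proof.
apply/block_constantP/forallP => [h c|h B x y Bp].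
  apply/eqP; apply: (h [set y in [set: point k l] |
      pairing_class s (even_point ekl c) == pairing_class s y]).
  - by apply: imset_f; rewrite inE.
  - by rewrite !inE eqxx.
  - by rewrite !inE pairing_class_odd pairing_class_even eqxx.
have [c ->] := perm_pairing_block Bp.
by rewrite !inE => /orP[/eqP ->|/eqP ->] /orP[/eqP ->|/eqP ->]; rewrite ?(eqP (h c)).
Qed.

End PairingOfPermutation.

Lemma power_coeffM (R : realType) n m (U V : 'M[R[i]]_n) (i j : multi_index n m) :
  power_coeff (U *m V) i j = \sum_h power_coeff U i h * power_coeff V h j.
Proof.
rewrite /power_coeff; under eq_bigr do rewrite mxE.
by rewrite bigA_distr_bigA /=; apply: eq_bigr => h _; rewrite -big_split.
Qed.

Lemma power_coeff1 (R : realType) n m (i j : multi_index n m) :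
  power_coeff (1%:M : 'M[R[i]]_n) i j = (i == j)%:R.
Proof. by rewrite -forall_eq_ffunE -prod_delta; apply: eq_bigr => a _; rewrite mxE. Qed.

Section UnitaryInvariants.
Variables (R : realType) (n k l : nat).
Local Notation C := R[i].
Local Notation tens k := {ffun multi_index n k -> R[i]^o}.
Local Notation m := ((k + l)./2).

Section Even.
Hypothesis ekl : ~~ odd (k + l).

Definition merge_index (al be : multi_index n m) : joint_index n k l :=
  [ffun x => if odd (label x) then al (half_index ekl x) else be (half_index ekl x)].

Lemma merge_odd al be c : merge_index al be (odd_point ekl c) = al c.
Proof. by rewrite ffunE label_odd_point /= odd_double half_odd_point. Qed.

Lemma merge_even al be c : merge_index al be (even_point ekl c) = be c.
Proof. by rewrite ffunE label_even_point /= odd_double half_even_point. Qed.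

Definition odd_index (phi : joint_index n k l) : multi_index n m :=
  [ffun c => phi (odd_point ekl c)].
Definition even_index (phi : joint_index n k l) : multi_index n m :=
  [ffun c => phi (even_point ekl c)].

Lemma merge_indexK phi : merge_index (odd_index phi) (even_index phi) = phi.
Proof.
apply/ffunP => x; case: (pointP ekl x) => -[c ->]; first by rewrite merge_odd ffunE.
by rewrite merge_even ffunE.
Qed.

Lemma sum_merge_index (V : nmodType) (F : joint_index n k l -> V) :
  \sum_phi F phi = \sum_be \sum_al F (merge_index al be).
Proof.
rewrite pair_big (reindex (fun ba : multi_index n m * multi_index n m =>
  merge_index ba.2 ba.1)) //=.
exists (fun phi => (even_index phi, odd_index phi)) => [[be al]|phi] _ /=.
  congr pair; apply/ffunP => c; first by rewrite ffunE merge_even.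
  by rewrite ffunE merge_odd.
exact: merge_indexK.
Qed.

Lemma prod_odd_even (F : point k l -> C) :
  \prod_x F x = (\prod_c F (odd_point ekl c)) * \prod_c F (even_point ekl c).
Proof.
rewrite (bigID (fun x => odd (label x))) /=; congr (_ * _).
  rewrite -big_filter [X in filter _ X]unlock -enumT -(perm_big _ (perm_odd_points ekl)) big_map.
  by rewrite big_enum.
rewrite -big_filter [X in filter _ X]unlock -enumT -(perm_big _ (perm_even_points ekl)) big_map.
by rewrite big_enum.
Qed.

(** Separating the legs by parity gathers the conjugated factors. The coefficients become a matrix
    [tau], with even legs as rows and odd legs as columns, commuting with the tensor powers of all
    unitaries; the permutations given by [schur_weyl] are the pairings in [E_o]. *)
Lemma unitary_invariant_span (T : 'Hom(tens k, tens l)) :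
  alt_intertwines (@unitary R n) (fun j i => T (basis_tensor R i) j) ->
  T \in <<[seq T_ R n p | p in E_o k l]>>%VS.
Proof.
set t := (fun j i => _) => ht.
pose tau (be al : multi_index n m) : C := joint_coeff t (merge_index al be).
have tauE U (be al : multi_index n m) : unitary U -> tau be al =
    \sum_be' \sum_al' tau be' al' * (Num.conj (power_coeff U al al') * power_coeff U be be').
  move=> uU; rewrite /tau (alt_intertwines_invariant ekl uU uU ht) sum_merge_index.
  apply: eq_bigr => be' _; apply: eq_bigr => al' _; congr (_ * _).
  rewrite prod_odd_even rmorph_prod; congr (_ * _); apply: eq_bigr => c _.
    by rewrite !merge_odd label_odd_point /= odd_double.
  by rewrite !merge_even label_even_point /= odd_double.
have [|c tc] := @schur_weyl R n m tau.
  move=> U uU be al.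
  rewrite /commutator sumrB; apply/eqP; rewrite subr_eq0; apply/eqP.
  under [LHS]eq_bigr do rewrite (tauE U be _ uU) mulr_suml.
  rewrite [LHS]exchange_big; apply: eq_bigr => be' _ /=.
  under [LHS]eq_bigr do rewrite mulr_suml.
  rewrite [LHS]exchange_big /=.
  transitivity (\sum_al' (al' == al)%:R *: (power_coeff U be be' * tau be' al' : C^o));
    last exact: sum_delta_r.
  apply: eq_bigr => al' _; rewrite -power_coeff1 -(unitary_sym uU) power_coeffM.
  rewrite -[RHS]/(_ * _) mulr_suml; apply: eq_bigr => h _.
  have -> : power_coeff U^H al' h = Num.conj (power_coeff U h al').
    by rewrite /power_coeff rmorph_prod; apply: eq_bigr => a _; rewrite !mxE.
  by ring.
apply: (@mem_span_T _ _ _ _ _ _ c (perm_pairing ekl)); first exact: perm_pairing_E_o.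
move=> i j; have -> : T (basis_tensor R i) j = joint_coeff t (join_index i j).
  by rewrite /joint_coeff upper_indexK lower_indexK.
rewrite -[join_index i j]merge_indexK -/(tau _ _) tc; apply: eq_bigr => s _.
rewrite deltaE perm_pairing_constant; congr (_ * (nat_of_bool _)%:R).
by rewrite -forall_eq_ffunE; apply: eq_forallb => a; rewrite !ffunE.
Qed.

End Even.

Lemma unitary_intertwiner_span (T : 'Hom(tens k, tens l)) :
  alt_intertwines (@unitary R n) (fun j i => T (basis_tensor R i) j) ->
  T \in <<[seq T_ R n p | p in E_o k l]>>%VS.
Proof.
have [okl|ekl] := boolP (odd (k + l)); last exact: unitary_invariant_span.
move=> ht; suff -> : T = 0 by exact: mem0v.
apply: hom_ext => i j; rewrite lfunE /= ffunE.
apply: (alt_intertwines_odd _ okl ht).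
by rewrite /unitary map_mxN map_mx1 linearN /= trmx1 mulNmx mul1mx opprK.
Qed.

End UnitaryInvariants.

(** * Monomial unitaries: permutation matrices and the torus *)

Section PermMatrices.
Variables (R : realType) (n : nat).
Local Notation C := R[i].

Definition permutation_matrix (s : 'S_n) : 'M[C]_n := \matrix_(i, j) (i == s j)%:R.

Lemma permutation_matrix_unitary s : unitary (permutation_matrix s).
Proof.
apply/matrixP => i j; rewrite !mxE.
transitivity (\sum_x (x == s^-1%g i)%:R *: ((j == s x)%:R : C^o)).
  apply: eq_bigr => x _; rewrite !mxE rmorph_nat; congr ((nat_of_bool _)%:R * _).
  by apply/eqP/eqP => [->|->]; rewrite ?permK ?permKV.
by rewrite sum_delta_r permKV eq_sym.
Qed.

Lemma permutation_matrix_monomial s : monomial (permutation_matrix s).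
Proof.
move=> i j h jh; rewrite !mxE; split.
  have [->|_] := eqVneq i (s j); last by rewrite mul0r.
  by rewrite (inj_eq perm_inj) (negPf jh) mulr0.
have [ji|_] := eqVneq j (s i); last by rewrite mul0r.
by rewrite -ji eq_sym (negPf jh) mulr0.
Qed.

Definition torus_matrix (z : 'I_n -> C) : 'M[C]_n := \matrix_(i, j) ((i == j)%:R * z j).

Lemma torus_matrix_unitary z : (forall x, z x * Num.conj (z x) = 1) -> unitary (torus_matrix z).
Proof.
move=> z1; apply/matrixP => i j; rewrite !mxE.
transitivity (\sum_x (i == x)%:R *: ((j == x)%:R : C^o)).
  apply: eq_bigr => x _; rewrite !mxE rmorphM rmorph_nat.
  by rewrite mulrACA z1 mulr1.
by rewrite sum_delta_l eq_sym.
Qed.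

Lemma torus_matrix_monomial z : monomial (torus_matrix z).
Proof.
move=> i j h jh; rewrite !mxE; split.
  have [->|_] := eqVneq i j; last by rewrite !mul0r.
  by rewrite (negPf jh) mul0r mulr0.
have [ji|_] := eqVneq j i; last by rewrite !mul0r.
have [hi|_] := eqVneq h i; last by rewrite mul0r mulr0.
by move: jh; rewrite ji hi eqxx.
Qed.

Definition monomial_unitary (U : 'M[C]_n) : Prop := unitary U /\ monomial U.

Lemma unitary_matrix_group : matrix_group (@unitary R n).
Proof.
split => //.
- by rewrite /unitary map_mx1 trmx1 mulmx1.
- move=> U V uU uV; rewrite /unitary adjmxM mulmxA -(mulmxA U) uV mulmx1.
  exact: uU.
- by move=> U /unitary_sym uU; rewrite /unitary adjmxK.
- move=> U uU; rewrite /unitary; have := congr1 (map_mx conjc) uU.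
  rewrite map_mxM map_mx1 => h; rewrite -[RHS]h; congr (_ *m _).
  by apply/matrixP => i j; rewrite !mxE.
- by move=> U uU; rewrite /unitary map_mxN linearN /= mulNmx mulmxN opprK.
Qed.

Lemma monomial_matrix_group : matrix_group monomial_unitary.
Proof.
have uG := unitary_matrix_group.
have cc (z : C) : (conjc z == 0) = (z == 0) by exact: conjc_eq0.
have mconj (U : 'M[C]_n) : monomial U -> monomial (map_mx conjc U).
  move=> mU i j h jh; rewrite !mxE -!rmorphM /=.
  by rewrite (mU i j h jh).1 (mU i j h jh).2 !conjc0.
split.
- by move=> U [].
- split; first exact: (group1 uG).
  move=> i j h jh; rewrite !mxE; split.
    have [->|_] := eqVneq i j; last by rewrite mul0r.
    by rewrite (negPf jh) mulr0.
  have [ji|_] := eqVneq j i; last by rewrite mul0r.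
  have [hi|_] := eqVneq h i; last by rewrite mulr0.
  by move: jh; rewrite ji hi eqxx.
- move=> U V [uU mU] [uV mV]; split; first exact: (groupM uG).
  move=> i j h jh; rewrite !mxE !mulr_suml; split; apply: big1 => x _.
    rewrite mulr_sumr big1 // => y _; have [->|xy] := eqVneq x y.
      by rewrite mulrACA (mV y j h jh).1 mulr0.
    by rewrite mulrACA (mU i x y xy).1 mul0r.
  rewrite mulr_sumr big1 // => y _; have [->|xy] := eqVneq x y.
    by rewrite mulrACA (mU y j h jh).2 mul0r.
  by rewrite mulrACA (mV i x y xy).2 mulr0.
- move=> U [uU mU]; split; first exact: (group_adj uG).
  have e a b : U^H a b = map_mx conjc U b a by rewrite mxE.
  by move=> i j h jh; rewrite !e; split; [exact: (mconj U mU i j h jh).2|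
    exact: (mconj U mU i j h jh).1].
- move=> U [uU mU]; split; [exact: (group_conj uG)|exact: mconj].
- move=> U [uU mU]; split; first exact: (groupN uG).
  move=> i j h jh; rewrite !mxE !mulrNN.
  exact: mU.
Qed.

End PermMatrices.

Section UnitCircle.
Variable K : numClosedFieldType.

(* The Cayley transforms [(1 + r i) / (1 - r i)], with [r] a natural number, are
   enough points of the circle to make this a polynomial identity. *)
Lemma unit_circle_torsion d :
  (forall z : K, z * Num.conj z = 1 -> z ^+ d = 1) -> d = 0%N.
Proof.
move=> zd; apply/eqP; rewrite -leqn0 leqNgt; apply/negP => d0.
pose c : K := 'i%R; have c0 : c != 0 by rewrite neq0Ci.
have c2 : c * c = -1 by rewrite -expr2 sqrCi.
have cc : Num.conj c = - c by exact: conjCi.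
pose q : {poly K} := (1 + c *: 'X) ^+ d - (1 - c *: 'X) ^+ d.
have evq z : q.[z] = (1 + c * z) ^+ d - (1 - c * z) ^+ d by rewrite /q !hornerE.
have q0 : q = 0.
  apply: poly_nat_roots => r; rewrite evq; set x := c * r%:R.
  have xx : x * x = - (r ^ 2)%:R by rewrite /x mulrACA c2 natrX expr2 mulN1r.
  have ne (s : K) : s = x \/ s = - x -> 1 + s != 0.
    move=> hs; apply/eqP => h; have : (1 + s) * (1 - s) = 0 by rewrite h mul0r.
    have ss : s * s = - (r ^ 2)%:R by case: hs => ->; rewrite ?mulrNN xx.
    have -> : (1 + s) * (1 - s) = 1 - s * s by ring.
    by rewrite ss opprK -[1]/(1%:R) -natrD add1n => /eqP; rewrite pnatr_eq0.
  have n1 : 1 + x != 0 by apply: ne; left.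
  have n2 : 1 - x != 0 by apply: ne; right.
  have xc : Num.conj x = - x by rewrite /x rmorphM /= cc rmorph_nat mulNr.
  have := zd ((1 + x) / (1 - x)).
  rewrite expr_div_n rmorphM fmorphV /= rmorphB rmorphD rmorph1 /= xc opprK.
  have -> : (1 + x) / (1 - x) * ((1 - x) / (1 + x)) = 1 by field; apply/andP.
  move=> /(_ erefl).
  by move/(congr1 ( *%R^~ ((1 - x) ^+ d))); rewrite divfK ?expf_neq0 // mul1r => ->; rewrite subrr.
(* At this point the first power is zero and the second is [2 ^+ d], so [q] is not the zero
   polynomial. *)
have := evq (- c^-1); rewrite q0 horner0 mulrN divff // subrr opprK expr0n.
rewrite eqn0Ngt d0 /= sub0r => /eqP; rewrite eq_sym oppr_eq0 expf_eq0 d0 /=.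
by rewrite -mulr2n pnatr_eq0.
Qed.

Lemma unit_circle_exponents a b :
  (forall z : K, z * Num.conj z = 1 -> z ^+ a * Num.conj z ^+ b = 1) -> a = b.
Proof.
wlog ab : a b / (a <= b)%N => [hw h|h].
  case: (leqP a b) => [ab|/ltnW ba]; first exact: hw.
  apply/esym/hw => // z z1; have := h (Num.conj z); rewrite conjCK mulrC => /(_ z1).
  by rewrite mulrC.
apply/eqP; rewrite eqn_leq ab /= -subn_eq0; apply/eqP/unit_circle_torsion => z z1.
have := h (Num.conj z); rewrite conjCK [Num.conj z * z]mulrC => /(_ z1).
by rewrite -(subnK ab) addnC exprD mulrA -exprMn [Num.conj z * z]mulrC z1 expr1n mul1r addKn.
Qed.

End UnitCircle.

Section MonomialInvariants.
Variables (R : realType) (n k l : nat).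
Local Notation C := R[i].
Local Notation tens k := {ffun multi_index n k -> R[i]^o}.
Implicit Types phi psi : joint_index n k l.

(** As a set of pairs, so that coarser kernels are larger sets. *)
Definition index_kernel phi : {set point k l * point k l} :=
  [set xy | phi xy.1 == phi xy.2].

Definition kernel_partition phi : diagram k l :=
  preim_partition phi [set: point k l].

Lemma kernel_partition_constant phi psi :
  block_constant (kernel_partition phi) psi = (index_kernel phi \subset index_kernel psi).
Proof.
apply/block_constantP/subsetP => [h [x y]|h B x y /imsetP[z _ ->]].
  rewrite !inE /= => /eqP xy.
  rewrite (h [set w in [set: point k l] | phi x == phi w] x y) ?inE ?xy ?eqxx //.
  by rewrite -xy; apply/imsetP; exists x; rewrite ?inE.
rewrite !inE => /eqP zx /eqP zy; apply/eqP.
by have := h (x, y); rewrite !inE /= -zx -zy eqxx => ->.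
Qed.

Definition balanced_index phi : Prop := forall v, total_weight [set x | phi x == v] = 0.

Lemma kernel_partition_E_h phi : balanced_index phi -> kernel_partition phi \in E_h k l.
Proof.
move=> bp; apply/in_E_hP; split; first exact: preim_partitionP.
move=> B /imsetP[x _ ->]; rewrite -[RHS](bp (phi x)); congr total_weight.
by apply/setP => y; rewrite !inE eq_sym.
Qed.

(** Each level set of [psi] is a disjoint union of level sets of [phi]. *)
Lemma balanced_coarser phi psi : balanced_index phi ->
  index_kernel phi \subset index_kernel psi -> balanced_index psi.
Proof.
move=> bp /subsetP sub v; rewrite /total_weight.
rewrite (partition_big phi xpredT) //=; apply: big1 => w _.
have [x0 /andP[vx0 wx0]|none] := pickP (fun x => (x \in [set x | psi x == v]) && (phi x == w));
  last by rewrite big_pred0.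
rewrite -[RHS](bp w); apply: eq_bigl => x; rewrite !inE andbC.
have [xw|//] := eqVneq (phi x) w.
have := sub (x0, x); rewrite !inE /= (eqP wx0) xw eqxx => /(_ isT) /eqP <-.
by move: vx0; rewrite inE => ->.
Qed.

Section Annihilator.
Variable c : joint_index n k l -> C.
Hypothesis c0 : forall p, p \in E_h k l ->
  \sum_psi (block_constant p psi)%:R * c psi = 0.

(* Subtracting the classes of strictly coarser kernels from the relation given by
   the partition [kernel_partition phi] leaves the class of [phi]. *)
Lemma kernel_class_sum phi : balanced_index phi ->
  \sum_(psi | index_kernel psi == index_kernel phi) c psi = 0.
Proof.
(* Induction on the number of pairs outside the kernel, which drops for a strictly coarser one. *)
have [N] := ubnP #|~: index_kernel phi|; elim: N phi => // N IH phi phiN bp.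
have := c0 (kernel_partition_E_h bp).
under eq_bigr do rewrite kernel_partition_constant.
move=> H; rewrite -[RHS]H {H}.
transitivity (\sum_(psi | index_kernel phi \subset index_kernel psi) c psi); last first.
  by rewrite big_mkcond; apply: eq_bigr => psi _; case: (_ \subset _); rewrite ?mul1r ?mul0r.
rewrite [RHS](partition_big (fun psi => index_kernel psi)
  (fun S => index_kernel phi \subset S)) //=.
rewrite (bigD1 (index_kernel phi)) //= [X in _ = _ + X]big1 ?addr0.
  by apply: eq_bigl => psi; have [->|] := eqVneq (index_kernel psi); rewrite ?subxx ?andbF.
move=> S /andP[sub ne].
have [psi0 /andP[sub0 /eqP S0]|none] := pickP (fun psi =>
  (index_kernel phi \subset index_kernel psi) && (index_kernel psi == S)); last by rewrite big_pred0.
rewrite -[RHS](IH psi0).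
- apply: eq_bigl => psi; rewrite S0.
  by have [->|] := eqVneq (index_kernel psi) S; rewrite ?sub ?andbF.
- rewrite -ltnS; apply: leq_trans phiN; rewrite ltnS; apply: proper_card.
  by rewrite properC properEneq S0 eq_sym ne sub.
- exact: balanced_coarser sub0.
Qed.

End Annihilator.

Section Invariant.
Variable t : multi_index n l -> multi_index n k -> C.
Hypotheses (ekl : ~~ odd (k + l)) (ht : alt_intertwines (@monomial_unitary R n) t).

Lemma joint_coeff_perm (s : 'S_n) phi :
  joint_coeff t [ffun x => s (phi x)] = joint_coeff t phi.
Proof.
have uP := permutation_matrix_unitary R s.
rewrite (alt_intertwines_invariant ekl uP (conj uP (permutation_matrix_monomial R s)) ht).
transitivity (\sum_psi (phi == psi)%:R *: (joint_coeff t psi : C^o)); last by rewrite sum_delta_l.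
apply: eq_bigr => psi _; rewrite mulrC; congr (_ * _).
rewrite -forall_eq_ffunE -prod_delta; apply: eq_bigr => x _.
rewrite !mxE ffunE (inj_eq perm_inj) /conj_if; case: odd => //.
exact: rmorph_nat.
Qed.

(** Two indices with the same kernel differ by a bijection between their sets of values, which
    extends to a permutation of all values. *)
Lemma joint_coeff_kernel phi psi : index_kernel phi = index_kernel psi ->
  joint_coeff t phi = joint_coeff t psi.
Proof.
move=> kk.
have kE x y : (phi x == phi y) = (psi x == psi y).
  by have /setP/(_ (x, y)) := kk; rewrite !inE.
pose f v := if [pick x | phi x == v] is Some x then psi x else v.
have fE x : f (phi x) = psi x.
  by rewrite /f; case: pickP => [y|/(_ x)]; rewrite ?eqxx // kE => /eqP.
have [|s sf] := @perm_extension _ [set phi x | x : point k l] f.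
  move=> _ _ /imsetP[x _ ->] /imsetP[y _ ->]; rewrite !fE => /eqP; rewrite -kE => /eqP //.
rewrite -(joint_coeff_perm s phi); congr joint_coeff.
by apply/ffunP => x; rewrite ffunE sf ?imset_f.
Qed.

(** The diagonal matrix with [z] at [v] and 1 elsewhere multiplies the coefficient by a power of [z]
    for the even legs with value [v] and a power of its conjugate for the odd ones. *)
Lemma joint_coeff_balanced phi : joint_coeff t phi != 0 -> balanced_index phi.
Proof.
move=> t0 v; apply/eqP; rewrite -balancedE eq_sym; apply/eqP.
apply: (@unit_circle_exponents C) => z z1.
pose y u : C := if u == v then z else 1.
have y1 u : y u * Num.conj (y u) = 1.
  by rewrite /y; case: eqP => // _; rewrite conjC1 mulr1.
have uU := torus_matrix_unitary y1.
have := alt_intertwines_invariant ekl uU (conj uU (torus_matrix_monomial y)) ht phi.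
have -> : \sum_psi joint_coeff t psi *
    \prod_x conj_if (odd (label x)) (torus_matrix y (phi x) (psi x)) =
  joint_coeff t phi * \prod_x conj_if (odd (label x)) (y (phi x)).
  transitivity (\sum_psi (phi == psi)%:R *:
    (joint_coeff t psi * \prod_x conj_if (odd (label x)) (y (psi x)) : C^o)); last exact: sum_delta_l.
  apply: eq_bigr => psi _; rewrite -[RHS]/(_ * _) mulrCA; congr (_ * _).
  rewrite -forall_eq_ffunE -prod_delta -big_split; apply: eq_bigr => x _ /=.
  rewrite mxE /conj_if; case: odd => //.
  by rewrite rmorphM /= rmorph_nat.
move=> /esym /eqP; rewrite -subr_eq0 -{2}[joint_coeff t phi]mulr1 -mulrBr mulf_eq0 (negPf t0).
rewrite subr_eq0 => /eqP prod1; rewrite -[RHS]prod1 [RHS](bigID (fun x => odd (label x))) /= mulrC.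
congr (_ * _).
  rewrite (bigID (fun x => phi x == v)) /= [X in _ = _ * X]big1 ?mulr1.
    rewrite -prodr_const; apply: esym; apply: congr_big => // x; first by rewrite !inE andbC.
    by case/andP => ox /eqP xv; rewrite /conj_if ox /y xv eqxx.
  by move=> x /andP[ox /negPf xv]; rewrite /conj_if ox /y xv; exact: conjC1.
rewrite (bigID (fun x => phi x == v)) /= [X in _ = _ * X]big1 ?mulr1.
  rewrite -prodr_const; apply: esym; apply: congr_big => // x; first by rewrite !inE andbC.
  by case/andP => /negPf ox /eqP xv; rewrite /conj_if ox /y xv eqxx.
by move=> x /andP[/negPf ox /negPf xv]; rewrite /conj_if ox /y xv.
Qed.

(** The coefficients are constant on kernel classes and supported on balanced ones, and a vector [c]
    annihilating all partitions in [E_h] sums to 0 over each balanced class. *)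
Lemma joint_coeff_E_h_span : exists c : {p | p \in E_h k l} -> C,
  forall psi, joint_coeff t psi = \sum_p c p * (block_constant (val p) psi)%:R.
Proof.
apply: span_of_annihilator => c hc.
have c0 p : p \in E_h k l -> \sum_psi (block_constant p psi)%:R * c psi = 0.
  by move=> pE; exact: (hc (exist _ p pE)).
rewrite (partition_big (fun psi => index_kernel psi) xpredT) //=; apply: big1 => S _.
have [phi /eqP <-|none] := pickP (fun psi => index_kernel psi == S); last by rewrite big_pred0.
transitivity (joint_coeff t phi * \sum_(psi | index_kernel psi == index_kernel phi) c psi).
  rewrite mulr_sumr; apply: eq_bigr => psi /eqP kk.
  by rewrite (joint_coeff_kernel kk).
have [->|t0] := eqVneq (joint_coeff t phi) 0; first by rewrite mul0r.
by rewrite (kernel_class_sum c0 (joint_coeff_balanced t0)) mulr0.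
Qed.

End Invariant.

Lemma monomial_intertwiner_span (T : 'Hom(tens k, tens l)) :
  alt_intertwines (@monomial_unitary R n) (fun j i => T (basis_tensor R i) j) ->
  T \in <<[seq T_ R n p | p in E_h k l]>>%VS.
Proof.
set t := (fun j i => _) => ht; have mG := monomial_matrix_group R n.
have [okl|ekl] := boolP (odd (k + l)).
  suff -> : T = 0 by exact: mem0v.
  apply: hom_ext => i j; rewrite lfunE /= ffunE.
  exact: (alt_intertwines_odd (groupN mG (group1 mG)) okl ht).
have [c hc] := joint_coeff_E_h_span ekl ht.
apply: (@mem_span_T _ _ _ _ _ _ c val) => [[p pE] //|i j].
have -> : T (basis_tensor R i) j = joint_coeff t (join_index i j).
  by rewrite /joint_coeff upper_indexK lower_indexK.
by rewrite hc; apply: eq_bigr => p _; rewrite deltaE.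
Qed.

End MonomialInvariants.

(** * Easiness *)

(** The entries are 0 or 1 and insensitive to conjugation, so the functional at a permutation matrix
    is evaluation of functions on the symmetric group. This is what embeds [S_n]. *)
Lemma alt_permutation_matrix (R : realType) n (s : 'S_n) (w : word n) :
  alt_word (permutation_matrix R s) w = word_eval *%R 1 (coords_Sn R n) w s.
Proof.
transitivity (\prod_(p <- w) ((p.1 == s p.2)%:R : R[i])); last first.
  elim: w => [|p w IH] /=; first by rewrite big_nil ffunE.
  by rewrite big_cons IH !ffunE mxE ffunE.
rewrite big_tnth; apply: eq_bigr => a _.
by rewrite !mxE conj_if_nat !ffunE.
Qed.

Section Duality.
Variables (R : realType) (n : nat) (P A : cstarAlgType R).
Variables (v : 'M[P]_n) (u : 'M[A]_n) (p : {lrmorphism P -> A}).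
Local Notation C := R[i].
Local Notation tens k := {ffun multi_index n k -> R[i]^o}.
Variables (G : 'M[C]_n -> Prop) (D : diagram_family).
Hypotheses (ov : is_free_orthogonal v) (ps : star_preserving p).
Hypotheses (psurj : surjective p) (pu : forall i j, p (v i j) = u i j).
Hypotheses (hG : matrix_group G) (hperm : forall s, G (permutation_matrix R s)).
Hypothesis hchi : forall U, G U -> has_character u U.
Hypothesis hcat : category_of_partitions D.
Hypothesis hT : forall k l p, p \in D k l -> intertwines u (T_ R n p).
Hypothesis hF : forall k l (T : 'Hom(tens k, tens l)),
  alt_intertwines G (fun j i => T (basis_tensor R i) j) ->
  T \in <<[seq T_ R n p | p in D k l]>>%VS.

Lemma easy_of_duality : easy v u /\ corresponding_category u D.
Proof.
have ou := orthogonal_coords_map ps pu ov.1.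
have [su _ _] := ou; have [sv _ _] := ov.1.
have hs := duality_Hom_spanned hchi hT hF.
have [Dp _ _ _ _] := hcat; split; last by split.
split; last by exists D.
- split => //; first exact: coord_alg_dense ov ps psurj pu.
  exact: duality_Hopf_maps hT hF.
- apply: qincluded_relations => // [i j|q q0].
    by apply/ffunP => s; rewrite mxE !ffunE; exact: conjc_nat.
  apply/ffunP => s; rewrite sum_ffunE [RHS]ffunE.
  rewrite -[RHS](character_nceval hchi (hperm s) q0); apply: eq_bigr => -[c w] _.
  by rewrite ffunE alt_permutation_matrix.
- apply: qincluded_relations => // q q0.
  have := @nceval_map R n P A p *%R 1 *%R 1 v u q; rewrite q0 linear0 => <- //.
  - exact: linearP.
  - exact: rmorph1.
  - exact: rmorphM.
Qed.

End Duality.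

Theorem theorem2p4 (R : realType) (n : nat)
  (Oplus Hplus Ostar Hstar : cstarAlgType R)
  (v : 'M[Oplus]_n) (w : 'M[Hplus]_n) (a : 'M[Ostar]_n) (b : 'M[Hstar]_n)
  (hO : is_free_orthogonal v) (hH : is_free_hyperoctahedral v w)
  (hOs : is_half_liberated v a) (hHs : is_half_liberated w b) :
  (easy v a /\ corresponding_category a E_o) /\
  (easy v b /\ corresponding_category b E_h).
Proof.
have gen (A : cstarAlgType R) (X : A -> Prop) x : X x -> ideal_generated X x.
  by move=> Xx I _ h; exact: h.
have half (A B : cstarAlgType R) (x : 'M[A]_n) (y : 'M[B]_n) (q : {lrmorphism A -> B}) :
    (forall i j, q (x i j) = y i j) ->
    (forall z, q z = 0 <-> ideal_generated (half_commutators x) z) ->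
    forall i j k l s t, y i j * y k l * y s t = y s t * y k l * y i j.
  move=> qx qker i j k l s t; apply/eqP; rewrite -subr_eq0 -!qx -!rmorphM -rmorphB.
  apply/eqP/qker; apply: (gen A); exists (x i j), (x k l), (x s t).
  by split=> //; [exists i, j|exists k, l|exists s, t].
split.
- have [p [ps psurj pa pker]] := hOs.
  apply: (easy_of_duality hO ps psurj pa (unitary_matrix_group R n)).
  + exact: permutation_matrix_unitary.
  + move=> U uU; have [f fs fv] := free_orthogonal_model hO uU.
    have [g _ ga] := quotient_factor hOs fs (half_commutators_model fv).
    by apply: (character_of_morphism (f := g)) => i j; rewrite ga.
  + exact: category_E_o.
  + move=> k l q; apply: E_o_intertwines; last exact: half pa pker.
    exact: orthogonal_coords_map ps pa hO.1.
  + exact: unitary_intertwiner_span.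
(* For the hyperoctahedral case the two quotient maps are composed into [r]. The hypothesis named
   [power_coeff] here is [p (v i j) = w i j]. *)
have [p [ps psurj power_coeff pker]] := hH; have [q [qs qsurj qb qker]] := hHs.
have ql : linear (q \o p) by move=> c x y /=; rewrite !linearP.
have qm : monoid_morphism (q \o p).
  by split=> [|x y] /=; rewrite ?rmorph1 // !rmorphM.
have [r rE] := lrmorphism_of ql qm.
have rb i j : r (v i j) = b i j by rewrite rE /= power_coeff.
have rs : star_preserving r by move=> x; rewrite !rE /= ps qs.
have rsurj : surjective r.
  by move=> y; have [x <-] := qsurj y; have [z <-] := psurj x; exists z; rewrite rE.
apply: (easy_of_duality hO rs rsurj rb (monomial_matrix_group R n)).
- by move=> s; split; [exact: permutation_matrix_unitary|exact: permutation_matrix_monomial].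
- move=> U [uU mU]; have [f fs fv] := free_orthogonal_model hO uU.
  (* The model descends in two stages: it kills the cubic relators because [U] is monomial, and the
     induced model of C(H_n^+) kills the half-commutators. *)
  have [g gs gw] := quotient_factor hH fs (cubic_relators_model mU fv).
  have {}gw i j : g (w i j) = antidiag2 (U i j) by rewrite gw.
  have [h _ hb] := quotient_factor hHs gs (half_commutators_model gw).
  by apply: (character_of_morphism (f := h)) => i j; rewrite hb.
- exact: category_E_h.
- move=> k l d; apply: E_h_intertwines; [|exact: half qb qker|].
    exact: orthogonal_coords_map rs rb hO.1.
  move=> i j h jh; rewrite -!qb -!rmorphM -!power_coeff -!rmorphM /=.
  by split; rewrite (pker _).2 ?rmorph0 //; apply: (gen Oplus); exists i, j, h; split=> //; [left|right].
- exact: monomial_intertwiner_span.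
Qed.
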